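(* Let $z(n,d)$ be the number of combinatorial types of $d$-dimensional zonotopes with $n$ generators. For fixed $d$, as $n\to\infty$, $$n^{(d^2-2d)n\left(1+O\left(\frac{1}{\log n}\right)\right)}\ \le\ z(n,d)\ \le\ n^{(d-1)^2n\left(1+O\left(\frac{\log\log n}{\log n}\right)\right)}.$$
   Context: Up to translation, a zonotope in $\mathbb{R}^d$ is a set $Z=\sum_{g\in\mathcal{G}}\mathrm{conv}\{0,g\}$ where $\mathcal{G}$ is a finite non-empty set of pairwise non-collinear non-zero vectors of $\mathbb{R}^d$ (a set of generators); all sets of generators of $Z$ have the same cardinality, called the number of generators of $Z$. Two polytopes have the same combinatorial type when their face lattices are isomorphic.
   Formalization: The dimension d is assumed to be at least 2: for d = 1 and n ≥ 2 there is no 1-dimensional zonotope with n pairwise non-collinear generators, so z(n,1) = 0 and the stated positive lower bound fails. *)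

(* Defs.v *)
From HB Require Import structures.
From mathcomp Require Import all_boot all_order all_algebra.
From mathcomp Require Import all_classical all_reals all_analysis.
Set Implicit Arguments. Unset Strict Implicit. Unset Printing Implicit Defensive.
Import Order.TTheory GRing.Theory Num.Theory.
Local Open Scope ring_scope.
Local Open Scope classical_set_scope.

Section Zonotopes.
Variable R : realType.

Definition dotv (d : nat) (x y : 'rV[R]_d) : R := \sum_(i < d) x 0 i * y 0 i.

Definition zonotope (d n : nat) (g : 'I_n -> 'rV[R]_d) : set 'rV[R]_d :=
  [set x | exists t : 'I_n -> R,
      (forall i, 0 <= t i <= 1) /\ x = \sum_(i < n) t i *: g i].

Definition generator_family (d n : nat) (g : 'I_n -> 'rV[R]_d) : Prop :=
  (forall i, g i != 0) /\
  (forall i j, i != j -> ~ exists c : R, g i = c *: g j).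

Definition full_dim (d n : nat) (g : 'I_n -> 'rV[R]_d) : Prop :=
  \rank (\matrix_(i < n) g i) = d.

(* faces of a polytope P: the empty set, and the sets P ∩ {c.x = m}
   for valid inequalities c.x <= m of P (this includes P itself) *)
Definition faces (d : nat) (P : set 'rV[R]_d) : set (set 'rV[R]_d) :=
  [set F | F = set0 \/
     exists (c : 'rV[R]_d) (m : R),
       (forall x, P x -> dotv c x <= m) /\
       F = [set x | P x /\ dotv c x = m]].

Definition same_comb_type (d e : nat) (P : set 'rV[R]_d) (Q : set 'rV[R]_e)
  : Prop :=
  exists f : {F | faces P F} -> {G | faces Q G},
    bijective f /\
    (forall F F', (proj1_sig F `<=` proj1_sig F') <->
                  (proj1_sig (f F) `<=` proj1_sig (f F'))).

Definition zonotopes_nd (n d : nat) : set (set 'rV[R]_d) :=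
  [set P | exists g : 'I_n -> 'rV[R]_d,
     generator_family g /\ full_dim g /\ P = zonotope g].

Definition has_k_types (d : nat) (S : set (set 'rV[R]_d)) (k : nat) : Prop :=
  exists Ps : 'I_k -> set 'rV[R]_d,
    (forall i, S (Ps i)) /\
    (forall i j, same_comb_type (Ps i) (Ps j) -> i = j) /\
    (forall P, S P -> exists i, same_comb_type P (Ps i)).

(* number of combinatorial types (0 if there were infinitely many) *)
Definition num_types (d : nat) (S : set (set 'rV[R]_d)) : nat :=
  match pselect (exists k, has_k_types S k) with
  | left H => projT1 (cid H)
  | right _ => 0%N
  end.

Definition z (n d : nat) : nat := @num_types d (@zonotopes_nd n d).

End Zonotopes.

(* Main.v *)
Require Import Defs.
From HB Require Import structures.
From mathcomp Require Import all_boot all_order all_algebra.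
From mathcomp Require Import all_classical all_reals all_analysis.
From mathcomp Require Import fingroup perm ring lra zify.
Import Order.TTheory GRing.Theory Num.Theory.
Import numFieldNormedType.Exports.
Local Open Scope classical_set_scope.
Local Open Scope ring_scope.
Set Implicit Arguments. Unset Strict Implicit. Unset Printing Implicit Defensive.

(* Let D = d - 1. The face lattice of a zonotope is the poset of sign vectors
   (covectors) of linear functionals on the generators.

   Upper bound. After a linear map and a rescaling of the generators, these lie
   in an affine hyperplane, so a configuration is a point of R^(nD). The signs
   of the d x d minors determine the covectors, so it suffices to bound the
   number of sign patterns of these minors (a form of Warren's theorem). Choose
   in each closed cell {f_s = 0 or sgn f_s >= eps} a point at which as many
   constraints as possible are active. The number of possible active sets is
   at most the dimension of the space of polynomials of degree
   O(n^D) in every variable (Ronyai-Babai-Ganapathy). The cells with a given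
   active set give disjoint clopen compact pieces of one real algebraic set
   {h = 0} of bounded degree, with h >= 0. For small delta > 0 the function
   h + delta (x_1^N + x_2^N + ...) has a local minimum near each piece, and
   its gradient equations, which equate each x_i^(N-1) to a polynomial of
   lower degree, have at most (N-1)^(nD) solutions.

   Lower bound. An isomorphism of face lattices preserves distances in the tope
   graph, hence comes from a relabelling and a reorientation; so a
   combinatorial type corresponds to at most n! 2^n covector sets of labelled
   configurations. These are counted by adding points one at a time: split the
   n points into D^2 groups; a choice of one point in each group gives D
   spanned hyperplanes, and these meet in a vertex. For generic points the
   vertices have distinct heights, so each is the lowest point of a different
   cell, and the new point can be put in (n/D^2)^(D^2) different cells. *)

(** * Faces of zonotopes *)

(** Where the exponents come from. A coordinate of a point occurs only in minors that use this
    point, so the product of all minors has degree of order n^D in each coordinate; with nD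
    coordinates this allows (C n^D)^(nD) active sets. Inside one active set the minors enter through
    a sum of squares, not a product, so the degree of h does not depend on n and the fibre costs
    only C^(nD). Below, inserting the points yields about (n!)^(D^2) covector sets; relabelling
    costs one factor n!, and D^2 - 1 = d^2 - 2d. The obstacle in the sign count is to separate cells
    without any topology of real algebraic sets. The gap eps turns strict inequalities into closed
    ones, and the maximality of the active set does the rest: at a point where h vanishes and a
    further constraint becomes active, the active set would be larger. So h is positive on the
    boundary of a tube around each piece, and a minimum of the perturbed function is interior, where
    its gradient vanishes. Covectors are represented throughout by functionals, and isomorphisms by
    relations between functionals, so that no quotient by equality of signs is formed. *)

Section DotProduct.
Context {R : realType} {d : nat}.
Implicit Types (x y u : 'rV[R]_d) (a : R).

Lemma dotvC x y : dotv x y = dotv y x.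
Proof. by apply: eq_bigr => i _; rewrite mulrC. Qed.

Lemma dotvDl x y u : dotv (x + y) u = dotv x u + dotv y u.
Proof. by rewrite -big_split; apply: eq_bigr => i _ /=; rewrite mxE mulrDl. Qed.

Lemma dotvZl a x u : dotv (a *: x) u = a * dotv x u.
Proof. by rewrite mulr_sumr; apply: eq_bigr => i _; rewrite mxE mulrA. Qed.

Lemma dotvNl x u : dotv (- x) u = - dotv x u.
Proof. by rewrite -scaleN1r dotvZl mulN1r. Qed.

Lemma dotvBl x y u : dotv (x - y) u = dotv x u - dotv y u.
Proof. by rewrite dotvDl dotvNl. Qed.

Lemma dotvDr x y u : dotv u (x + y) = dotv u x + dotv u y.
Proof. by rewrite !(dotvC u) dotvDl. Qed.

Lemma dotvZr a x u : dotv u (a *: x) = a * dotv u x.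
Proof. by rewrite !(dotvC u) dotvZl. Qed.

Lemma dotvBr x y u : dotv u (x - y) = dotv u x - dotv u y.
Proof. by rewrite !(dotvC u) dotvBl. Qed.

Lemma dotv0l u : dotv 0 u = 0.
Proof. by rewrite -(scale0r 0) dotvZl mul0r. Qed.

Lemma dotv_sumr n (F : 'I_n -> 'rV[R]_d) u :
  dotv u (\sum_i F i) = \sum_i dotv u (F i).
Proof.
elim/big_ind2: _ => // [|x a y b <- <-]; first by rewrite dotvC dotv0l.
exact: dotvDr.
Qed.

Lemma dotvv_ge0 x : 0 <= dotv x x.
Proof. by apply: sumr_ge0 => i _; rewrite -expr2 sqr_ge0. Qed.

Lemma dotvv_eq0 x : (dotv x x == 0) = (x == 0).
Proof.
apply/eqP/eqP => [/eqP|->]; last exact: dotv0l.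
rewrite psumr_eq0 => [/allP /= h|i _]; last by rewrite -expr2 sqr_ge0.
apply/rowP => i; apply/eqP; rewrite mxE.
by have := h i (mem_index_enum i); rewrite -expr2 sqrf_eq0.
Qed.

Lemma dotvv_gt0 x : x != 0 -> 0 < dotv x x.
Proof. by move=> x0; rewrite lt_def dotvv_eq0 x0 dotvv_ge0. Qed.

Lemma dotv_mulmx x y : dotv x y = (x *m y^T) 0 0.
Proof. by rewrite mxE; apply: eq_bigr => i _; rewrite mxE. Qed.

Lemma dotv_delta x i : dotv x (delta_mx 0 i) = x 0 i.
Proof.
rewrite /dotv (bigD1 i) //= mxE !eqxx mulr1 big1 ?addr0 // => j /negPf ji.
by rewrite mxE ji andbF mulr0.
Qed.

End DotProduct.

Section Faces.
Context {R : realType}.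

(** The conformal order on covectors, reversed so that it matches inclusion of faces ([zface_sub]):
    full sign vectors are minimal and correspond to the vertices. *)
Definition covle (d n : nat) (g : 'I_n -> 'rV[R]_d) (c c' : 'rV[R]_d) :=
  forall i, dotv c' (g i) != 0 ->
    Num.sg (dotv c (g i)) = Num.sg (dotv c' (g i)).

Definition zface (d n : nat) (g : 'I_n -> 'rV[R]_d) (c : 'rV[R]_d) :
    set 'rV[R]_d :=
  [set x | exists t : 'I_n -> R,
     (forall i, [/\ 0 <= t i <= 1, 0 < dotv c (g i) -> t i = 1 &
                    dotv c (g i) < 0 -> t i = 0]) /\
     x = \sum_(i < n) t i *: g i]%classic.

(** The support function of the zonotope. *)
Definition zmax (d n : nat) (g : 'I_n -> 'rV[R]_d) (c : 'rV[R]_d) : R :=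
  \sum_(i < n) Num.max 0 (dotv c (g i)).

Section OneFamily.
Context {d n : nat}.
Variable g : 'I_n -> 'rV[R]_d.

Lemma dotv_comb c (t : 'I_n -> R) :
  dotv c (\sum_i t i *: g i) = \sum_i t i * dotv c (g i).
Proof. by rewrite dotv_sumr; apply: eq_bigr => i _; rewrite dotvZr. Qed.

Lemma zmax_term (a t : R) : 0 <= t <= 1 -> t * a <= Num.max 0 a.
Proof.
move=> /andP[t0 t1]; rewrite le_max; case: (lerP a 0) => a0.
  by rewrite mulr_ge0_le0.
by rewrite ler_piMl ?orbT // ltW.
Qed.

Lemma zmax_term_eq (a t : R) : 0 <= t <= 1 -> t * a = Num.max 0 a ->
  (0 < a -> t = 1) /\ (a < 0 -> t = 0).
Proof.
move=> t01; case: (ltgtP 0 a) => [a0|a0|<-] h; split=> //.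
- by move=> _; apply: (mulIf (lt0r_neq0 a0)); rewrite h mul1r.
- by move=> _; apply: (mulIf (ltr0_neq0 a0)); rewrite h mul0r.
Qed.

Lemma zmax_ge c x : zonotope g x -> dotv c x <= zmax g c.
Proof.
move=> [t [t01 ->]]; rewrite dotv_comb; apply: ler_sum => i _.
exact: zmax_term.
Qed.

Lemma zfaceP c x :
  zface g c x <-> zonotope g x /\ dotv c x = zmax g c.
Proof.
split=> [[t [ht ->]]|[[t [t01 ->]] h]].
  split; first by exists t; split=> // i; have [] := ht i.
  rewrite dotv_comb; apply: eq_bigr => i _; have [_ h1 h0] := ht i.
  by case: (ltgtP 0 (dotv c (g i))) => [/h1->|/h0->|<-]; rewrite ?(mul1r, mul0r, mulr0).
exists t; split=> // i.
have {}h : t i * dotv c (g i) = Num.max 0 (dotv c (g i)).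
  move: h; rewrite dotv_comb => h.
  apply/eqP; rewrite eq_sym -subr_eq0; apply/eqP.
  have h' : \sum_j (Num.max 0 (dotv c (g j)) - t j * dotv c (g j)) = 0.
    by rewrite sumrB h subrr.
  have : \sum_j (Num.max 0 (dotv c (g j)) - t j * dotv c (g j)) == 0 by exact/eqP.
  rewrite psumr_eq0; last by move=> j _; rewrite subr_ge0 zmax_term.
  by move=> /allP /(_ i (mem_index_enum i)) /eqP.
by have [h1 h0] := zmax_term_eq (t01 i) h.
Qed.

(** The coefficients 1, 1/2, 0 chosen by sign give a relatively interior point; its membership in
    another face already forces the signs compared in [zface_sub]. *)
Lemma zface_center c : exists t : 'I_n -> R,
  [/\ forall i, 0 <= t i <= 1, zface g c (\sum_i t i *: g i) &
      forall i, (t i = 1 -> 0 < dotv c (g i)) /\ (t i = 0 -> dotv c (g i) < 0)].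
Proof.
pose t i : R := if 0 < dotv c (g i) then 1 else
                if dotv c (g i) < 0 then 0 else 2^-1.
have t01 i : 0 <= t i <= 1 by rewrite /t; case: ifP => _; [|case: ifP => _]; lra.
exists t; split=> //.
  exists t; split=> // i; split=> //; rewrite /t.
    by move=> ->.
  by move=> h; rewrite h ltNge (ltW h).
move=> i; rewrite /t; case: ifP => // _; first by split=> //; lra.
by case: ifP => // _; split=> //; lra.
Qed.

Lemma zface_neq0 c : (zface g c !=set0)%classic.
Proof. by have [t [_ h _]] := zface_center c; eexists; exact: h. Qed.

Lemma covleP c c' : covle g c c' <-> forall i,
  (0 < dotv c' (g i) -> 0 < dotv c (g i)) /\
  (dotv c' (g i) < 0 -> dotv c (g i) < 0).
Proof.
split=> h i; have := h i.
  move=> {}h; split=> h'.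
    by rewrite -sgr_gt0 h ?lt0r_neq0 // sgr_gt0.
  by rewrite -sgr_lt0 h ?ltr0_neq0 // sgr_lt0.
move=> [hp hn]; case: (ltgtP 0 (dotv c' (g i))) => // h' _.
  by rewrite !gtr0_sg // hp.
by rewrite !ltr0_sg // hn.
Qed.

Lemma zface_sub c c' : (zface g c `<=` zface g c')%classic <-> covle g c c'.
Proof.
rewrite covleP; split=> [h i|h x [t [ht ->]]]; last first.
  exists t; split=> // i; have [hp hn] := h i; have [t01 h1 h0] := ht i.
  by split=> // [/hp|/hn].
have [t [t01 hf ht]] := zface_center c.
have /zfaceP[_] := h _ hf; rewrite dotv_comb => hm.
have {}hm : t i * dotv c' (g i) = Num.max 0 (dotv c' (g i)).
  have : \sum_j (Num.max 0 (dotv c' (g j)) - t j * dotv c' (g j)) == 0.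
    by rewrite sumrB hm subrr.
  rewrite psumr_eq0; last by move=> j _; rewrite subr_ge0 zmax_term.
  by move=> /allP /(_ i (mem_index_enum i)); rewrite /= subr_eq0 => /eqP.
have [h1 h0] := zmax_term_eq (t01 i) hm; have [hp hn] := ht i.
by split=> [/h1|/h0].
Qed.

Lemma faces_zonotope F :
  faces (zonotope g) F <-> F = set0 \/ exists c, F = zface g c.
Proof.
split=> [[->|[c [m [hm ->]]]]|[->|[c ->]]]; [by left| |by left|].
  have [hx|hx] := eqVneq m (zmax g c).
    right; exists c; apply/seteqP; split=> x; rewrite zfaceP hx //.
  left; rewrite -subset0 => x /= [zx dx]; have := zmax_ge c zx; rewrite dx => mz.
  have [y /zfaceP [zy hy]] := zface_neq0 c.
  have := hm _ zy; rewrite hy => zm; move: hx.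
  by rewrite eq_le mz zm.
right; exists c, (zmax g c); split; first exact: zmax_ge.
by apply/seteqP; split=> x /=; rewrite zfaceP.
Qed.

End OneFamily.

(** A relation rather than a map, since many functionals induce one covector. Being total,
    surjective and order-compatible in both directions, it amounts to an isomorphism of the quotient
    posets. *)
Definition cov_iso (d e n m : nat) (g : 'I_n -> 'rV[R]_d) (h : 'I_m -> 'rV[R]_e)
    (rho : 'rV[R]_d -> 'rV[R]_e -> Prop) :=
  [/\ forall c, exists c', rho c c', forall c', exists c, rho c c' &
      forall c1 c2 c1' c2', rho c1 c1' -> rho c2 c2' ->
        covle g c1 c2 <-> covle h c1' c2'].

Lemma cov_iso_sym (d e n m : nat) (g : 'I_n -> 'rV[R]_d) (h : 'I_m -> 'rV[R]_e)
    rho : cov_iso g h rho -> cov_iso h g (fun x y => rho y x).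
Proof. by case=> h1 h2 h3; split=> // *; apply: iff_sym; exact: h3. Qed.

(** Choice functions in the two directions are mutually inverse by antisymmetry. *)
Lemma order_bijection (T U : Type) (leT : T -> T -> Prop) (leU : U -> U -> Prop)
    (r : T -> U -> Prop) :
  (forall x, leT x x) -> (forall y, leU y y) ->
  (forall x y, leT x y -> leT y x -> x = y) ->
  (forall x y, leU x y -> leU y x -> x = y) ->
  (forall x, exists y, r x y) -> (forall y, exists x, r x y) ->
  (forall x x' y y', r x y -> r x' y' -> leT x x' <-> leU y y') ->
  exists f : T -> U, bijective f /\ forall x x', leT x x' <-> leU (f x) (f x').
Proof.
move=> rT rU aT aU tot surj rle.
pose f x := projT1 (cid (tot x)); pose k y := projT1 (cid (surj y)).
have fP x : r x (f x) by exact: projT2 (cid (tot x)).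
have kP y : r (k y) y by exact: projT2 (cid (surj y)).
exists f; split=> [|x x']; last exact: (rle _ _ _ _ (fP x) (fP x')).
exists k => [x|y].
  apply: aT; first exact/(rle _ _ _ _ (kP _) (fP _)).
  exact/(rle _ _ _ _ (fP _) (kP _)).
apply: aU; first exact/(rle _ _ _ _ (fP _) (kP _)).
exact/(rle _ _ _ _ (kP _) (fP _)).
Qed.

Lemma same_comb_typeP (d e n m : nat) (g : 'I_n -> 'rV[R]_d) (h : 'I_m -> 'rV[R]_e) :
  same_comb_type (zonotope g) (zonotope h) <-> exists rho, cov_iso g h rho.
Proof.
split=> [[f [[k fK kK] fle]]|[rho [tot surj rle]]].
  have Pg c : faces (zonotope g) (zface g c) by apply/faces_zonotope; right; exists c.
  have Ph c : faces (zonotope h) (zface h c) by apply/faces_zonotope; right; exists c.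
  have Pg0 : faces (zonotope g) set0 by left.
  have Ph0 : faces (zonotope h) set0 by left.
  have Pf F : faces (zonotope h) (proj1_sig (f F)) by exact: proj2_sig (f F).
  (* The empty face is the least element, so it goes to the empty face, and the faces given by
     functionals correspond among themselves. *)
  have f0 : proj1_sig (f (exist _ _ Pg0)) = set0.
    have /fle : (proj1_sig (exist (faces (zonotope g)) _ Pg0) `<=`
       proj1_sig (k (exist _ _ Ph0)))%classic by exact: sub0set.
    by rewrite kK /= subset0.
  exists (fun c c' => proj1_sig (f (exist _ _ (Pg c))) = zface h c'); split.
  - move=> c; have /faces_zonotope[h0|//] := Pf (exist _ _ (Pg c)).
    have /fle /= : (proj1_sig (f (exist _ _ (Pg c))) `<=`
      proj1_sig (f (exist _ _ Pg0)))%classic by rewrite h0.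
    by rewrite subset0 => z0; have [x zx] := zface_neq0 g c; suff: set0 x by []; rewrite -z0.
  - move=> c'; have := proj2_sig (k (exist _ _ (Ph c'))).
    case/faces_zonotope => [k0|[c kc]].
      have kE : k (exist _ _ (Ph c')) = exist _ _ Pg0.
        by case: (k _) k0 => /= F PF F0; subst F; congr exist; exact: Prop_irrelevance.
      have := kK (exist _ _ (Ph c')); rewrite kE => fE.
      have [x] := zface_neq0 h c'.
      by rewrite -[zface h c']/(proj1_sig (exist _ _ (Ph c'))) -fE f0.
    exists c; have -> : exist _ _ (Pg c) = k (exist _ _ (Ph c')).
      by case: (k _) kc => /= F PF F0; subst F; congr exist; exact: Prop_irrelevance.
    by rewrite kK.
  - move=> c1 c2 c1' c2' r1 r2; rewrite -!zface_sub -r1 -r2.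
    exact: (fle (exist _ _ (Pg c1)) (exist _ _ (Pg c2))).
pose r (F : {F | faces (zonotope g) F}) (G : {G | faces (zonotope h) G}) :=
  (proj1_sig F = set0 /\ proj1_sig G = set0) \/ exists c c',
  [/\ rho c c', proj1_sig F = zface g c & proj1_sig G = zface h c'].
have sub_antisym T' (P : T' -> Prop) (A : {x | P x}) (B : {x | P x}) :
  proj1_sig A = proj1_sig B -> A = B.
  case: A B => [a Pa] [b Pb] /= ab; subst b; congr exist; exact: Prop_irrelevance.
apply: (@order_bijection _ _ (fun F F' => proj1_sig F `<=` proj1_sig F')%classic
  (fun F F' => proj1_sig F `<=` proj1_sig F')%classic r).
- by move=> F x.
- by move=> F x.
- by move=> F F' h1 h2; apply: sub_antisym; apply/seteqP.
- by move=> F F' h1 h2; apply: sub_antisym; apply/seteqP.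
- move=> [F PF]; have [F0|[c Fc]] := (faces_zonotope g F).1 PF.
    by exists (exist _ set0 (or_introl erefl)); left.
  have [c' cc'] := tot c.
  have Pc' : faces (zonotope h) (zface h c') by apply/faces_zonotope; right; exists c'.
  by exists (exist _ _ Pc'); right; exists c, c'.
- move=> [F PF]; have [F0|[c' Fc]] := (faces_zonotope h F).1 PF.
    by exists (exist _ set0 (or_introl erefl)); left.
  have [c cc'] := surj c'.
  have Pc : faces (zonotope g) (zface g c) by apply/faces_zonotope; right; exists c.
  by exists (exist _ _ Pc); right; exists c, c'.
- move=> F F' G G' /=.
  case=> [[-> ->]|[c1 [c1' [r1 -> ->]]]] [[-> ->]|[c2 [c2' [r2 -> ->]]]].
  + by split=> _; exact: sub0set.
  + by split=> _; exact: sub0set.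
  + have [[x gx] [y hy]] := (zface_neq0 g c1, zface_neq0 h c1').
    by split=> [/(_ _ gx)|/(_ _ hy)].
  + by rewrite !zface_sub; exact: rle.
Qed.

Lemma same_comb_type_sym (d e : nat) (P : set 'rV[R]_d) (Q : set 'rV[R]_e) :
  same_comb_type P Q -> same_comb_type Q P.
Proof.
move=> [f [[k fK kK] fle]]; exists k; split; first by exists f.
by move=> G G'; rewrite fle !kK.
Qed.

Lemma same_comb_type_trans (d1 d2 d3 : nat) (P : set 'rV[R]_d1)
    (Q : set 'rV[R]_d2) (S : set 'rV[R]_d3) :
  same_comb_type P Q -> same_comb_type Q S -> same_comb_type P S.
Proof.
move=> [f [bf fle]] [k [bk kle]]; exists (k \o f); split; first exact: bij_comp.
by move=> F F'; rewrite fle kle.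
Qed.

(** [covle] compares signs at one index at a time, so a nonzero factor attached to each generator
    cancels. This covers rescaling generators, also by negative numbers. *)
Lemma same_comb_type_signs (d e n : nat) (g : 'I_n -> 'rV[R]_d)
    (h : 'I_n -> 'rV[R]_e) (s : 'I_n -> R) :
  (forall i, s i != 0) ->
  (forall c, exists c', forall i,
     Num.sg (dotv c' (h i)) = s i * Num.sg (dotv c (g i))) ->
  (forall c', exists c, forall i,
     Num.sg (dotv c' (h i)) = s i * Num.sg (dotv c (g i))) ->
  same_comb_type (zonotope g) (zonotope h).
Proof.
move=> s0 tot surj; apply/same_comb_typeP; eexists; split; [exact: tot|exact: surj|].
move=> c1 c2 c1' c2' r1 r2; split=> le12 i; have := le12 i.
  rewrite -sgr_eq0 => {}le12; rewrite -sgr_eq0 r1 r2 mulf_eq0 (negPf (s0 i)) /=.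
  by move=> /le12 ->.
rewrite -sgr_eq0 r1 r2 mulf_eq0 (negPf (s0 i)) /= sgr_eq0 => {}le12 /le12.
exact: mulfI.
Qed.

End Faces.

(** * Generic perturbation and composition of covectors *)

Section Perturbation.
Context {R : realType}.

Lemma horner_sg_near (P : {poly R}) : P.[0] != 0 ->
  \forall t \near 0^'+, Num.sg P.[t] = Num.sg P.[0].
Proof.
move=> P0.
have cP : (horner P @ 0^'+ --> P.[0])%classic.
  by apply: cvg_at_right_filter; exact: continuous_horner.
case: (ltgtP 0 P.[0]) P0 => // P0 _.
  have h : \forall t \near 0^'+, 0 < P.[t] by exact: (cvgr_gt _ cP _ P0).
  by near=> t; rewrite !gtr0_sg //; near: t; exact: h.
have h : \forall t \near 0^'+, P.[t] < 0 by exact: (cvgr_lt _ cP _ P0).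
by near=> t; rewrite !ltr0_sg //; near: t; exact: h.
Unshelve. all: by end_near. Qed.

Lemma horner_neq0_near (P : {poly R}) : P != 0 ->
  \forall t \near 0^'+, P.[t] != 0.
Proof.
move=> P0; have [m [Q]] := multiplicity_XsubC P 0.
rewrite P0 /= subr0 => Q0 ->.
have := @horner_sg_near Q Q0 => h.
near=> t; rewrite hornerM hornerXn mulf_neq0 //.
  by rewrite -sgr_eq0 (near h t) // sgr_eq0.
by rewrite expf_neq0 // gt_eqF.
Unshelve. all: by end_near. Qed.

(** Polynomial along every line: all that a perturbation argument uses, and stable under sums,
    products and determinants without a theory of several variables. *)
Definition linepoly (V : lmodType R) (f : V -> R) :=
  forall p q, exists P : {poly R}, forall t, f (p + t *: q) = P.[t].

Section LinePoly.
Context {V : lmodType R}.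
Implicit Types (f : V -> R).

Lemma linepoly_cst (a : R) : linepoly (fun _ : V => a).
Proof. by move=> p q; exists a%:P => t; rewrite hornerC. Qed.

Lemma linepolyD f1 f2 :
  linepoly f1 -> linepoly f2 -> linepoly (fun x => f1 x + f2 x).
Proof.
move=> h1 h2 p q; have [[P1 e1] [P2 e2]] := (h1 p q, h2 p q).
by exists (P1 + P2) => t; rewrite hornerD e1 e2.
Qed.

Lemma linepolyM f1 f2 :
  linepoly f1 -> linepoly f2 -> linepoly (fun x => f1 x * f2 x).
Proof.
move=> h1 h2 p q; have [[P1 e1] [P2 e2]] := (h1 p q, h2 p q).
by exists (P1 * P2) => t; rewrite hornerM e1 e2.
Qed.

Lemma linepolyN f : linepoly f -> linepoly (fun x => - f x).
Proof.
move=> h p q; have [P e] := h p q.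
by exists (- P) => t; rewrite hornerN e.
Qed.

Lemma linepoly_lin f : (forall x y, f (x + y) = f x + f y) ->
  (forall a x, f (a *: x) = a * f x) -> linepoly f.
Proof.
move=> fD fZ p q; exists ((f p)%:P + (f q) *: 'X) => t.
by rewrite !hornerE fD fZ mulrC.
Qed.

Lemma linepoly_sum (I : Type) (s : seq I) (F : I -> V -> R) :
  (forall i, linepoly (F i)) -> linepoly (fun x => \sum_(i <- s) F i x).
Proof.
move=> h; elim: s => [|i s IH] p q.
  by have [P e] := linepoly_cst 0 p q; exists P => t; rewrite big_nil -e.
by have [P e] := linepolyD (h i) IH p q; exists P => t; rewrite big_cons -e.
Qed.

Lemma linepoly_prod (I : Type) (s : seq I) (F : I -> V -> R) :
  (forall i, linepoly (F i)) -> linepoly (fun x => \prod_(i <- s) F i x).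
Proof.
move=> h; elim: s => [|i s IH] p q.
  by have [P e] := linepoly_cst 1 p q; exists P => t; rewrite big_nil -e.
by have [P e] := linepolyM (h i) IH p q; exists P => t; rewrite big_cons -e.
Qed.

Lemma linepoly_det m (A : V -> 'M[R]_m) :
  (forall i j, linepoly (fun x => A x i j)) -> linepoly (fun x => \det (A x)).
Proof.
move=> h; apply: linepoly_sum => s; apply: linepolyM; first exact: linepoly_cst.
exact: linepoly_prod.
Qed.

Lemma linepoly_sg_near f p q : linepoly f -> f p != 0 ->
  \forall t \near 0^'+, Num.sg (f (p + t *: q)) = Num.sg (f p).
Proof.
move=> h fp; have [P e] := h p q.
have e0 : f p = P.[0] by rewrite -e scale0r addr0.
rewrite e0 in fp *; near=> t; rewrite e; near: t; exact: horner_sg_near.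
Unshelve. all: by end_near. Qed.

Lemma linepoly_neq0_near f p q : linepoly f -> f q != 0 ->
  \forall t \near 0^'+, f (p + t *: (q - p)) != 0.
Proof.
move=> h fq; have [P e] := h p (q - p).
have P0 : P != 0.
  by apply: contra_neq fq => P0; rewrite -(subrK p q) addrC -[q - p]scale1r e P0 horner0.
near=> t; rewrite e; near: t; exact: horner_neq0_near.
Unshelve. all: by end_near. Qed.

(** The functions are treated one at a time: a small move towards a point where [f i] is nonzero
    makes it nonzero, because a nonzero univariate polynomial has no zeros just to the right of 0,
    and keeps all signs already acquired. *)
Lemma perturb (I : finType) (f : I -> V -> R) (p : V) :
  (forall i, linepoly (f i)) -> (forall i, exists q, f i q != 0) ->
  exists p', forall i, f i p' != 0 /\
    (f i p != 0 -> Num.sg (f i p') = Num.sg (f i p)).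
Proof.
move=> lf nz.
suff [p' [h1 h2]] : exists p', (forall i, i \in enum I -> f i p' != 0) /\
    (forall i, f i p != 0 -> Num.sg (f i p') = Num.sg (f i p)).
  by exists p' => i; split; [apply: h1; rewrite mem_enum|exact: h2].
elim: (enum I) => [|i s [p1 [h1 h2]]]; first by exists p.
have [q fq] := nz i.
have keep : \forall t \near 0^'+, forall j : I,
    f j p1 != 0 -> Num.sg (f j (p1 + t *: (q - p1))) = Num.sg (f j p1).
  apply: filter_forall => j; have [f0|f0] := eqVneq (f j p1) 0.
    by near=> t.
  by near=> t => _; near: t; exact: linepoly_sg_near.
have ne : \forall t \near 0^'+, f i (p1 + t *: (q - p1)) != 0.
  exact: linepoly_neq0_near.
have [t [kt nt]] := filter_ex (filterI keep ne).
exists (p1 + t *: (q - p1)); split=> j.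
  rewrite inE => /orP[/eqP -> //|js].
  by rewrite -sgr_eq0 kt ?sgr_eq0; exact: h1.
move=> fp; have fp1 := h2 _ fp.
by rewrite kt // -sgr_eq0 fp1 sgr_eq0.
Unshelve. all: by end_near. Qed.

End LinePoly.

Section Composition.
Context {d : nat} {I : finType}.
Variable v : I -> 'rV[R]_d.

Lemma linepoly_dotvl (w : 'rV[R]_d) : linepoly (fun c => dotv c w).
Proof. by apply: linepoly_lin => *; rewrite (dotvDl, dotvZl). Qed.

(** Composition of covectors in the sense of oriented matroids, realised by [b + t *: u] for small
    positive t. *)
Lemma covector_comp (b u : 'rV[R]_d) : exists c, forall k,
  Num.sg (dotv c (v k)) =
    if dotv b (v k) == 0 then Num.sg (dotv u (v k)) else Num.sg (dotv b (v k)).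
Proof.
have h : \forall t \near 0^'+, forall k, Num.sg (dotv (b + t *: u) (v k)) =
    if dotv b (v k) == 0 then Num.sg (dotv u (v k)) else Num.sg (dotv b (v k)).
  apply: filter_forall => k; case: eqVneq => [b0|b0].
    near=> t; rewrite dotvDl b0 add0r dotvZl sgrM gtr0_sg ?mul1r //.
  near=> t; near: t; apply: (linepoly_sg_near (f := fun c => dotv c (v k))) => //.
  exact: linepoly_dotvl.
by have [t ht] := filter_ex h; exists (b + t *: u).
Unshelve. all: by end_near. Qed.

Lemma generic_covector : (forall k, v k != 0) ->
  exists c, forall k, dotv c (v k) != 0.
Proof.
move=> v0; have [||c hc] := @perturb _ I (fun k c => dotv c (v k)) 0.
- by move=> k; exact: linepoly_dotvl.
- by move=> k; exists (v k); rewrite dotvv_eq0.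
by exists c => k; have [] := hc k.
Qed.

End Composition.
End Perturbation.

(** * Tope graphs *)

Section Topes.
Context {R : realType} {d n : nat}.
Variable g : 'I_n -> 'rV[R]_d.

Definition tope (c : 'rV[R]_d) := forall i, dotv c (g i) != 0.

(** The number of separating hyperplanes. With [tdist_step] it becomes the length of a shortest path
    between topes. *)
Definition tdist (c c' : 'rV[R]_d) : nat :=
  #|[set i | Num.sg (dotv c (g i)) != Num.sg (dotv c' (g i))]%SET|.

Lemma covle_trans c1 c2 c3 : covle g c1 c2 -> covle g c2 c3 -> covle g c1 c3.
Proof.
move=> h12 h23 i h; rewrite -h23 // h12 //.
by rewrite -sgr_eq0 h23 // sgr_eq0.
Qed.

Lemma comp_covle b c (s : 'I_n -> R) :
  (forall k, Num.sg (dotv c (g k)) =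
     if dotv b (g k) == 0 then s k else Num.sg (dotv b (g k))) -> covle g c b.
Proof. by move=> h k /negPf b0; rewrite h b0. Qed.

Hypothesis gg : generator_family g.
Let g0 : forall i, g i != 0 := gg.1.

Lemma tope_ex : exists c, tope c.
Proof. exact: generic_covector. Qed.

(** The triple composition of [b], [u] and an arbitrary tope: [u] decides where [b] vanishes, and
    the tope fills the remaining zeros. *)
Lemma tope_below b u : exists2 T, tope T & covle g T b /\
  forall i, dotv b (g i) = 0 -> dotv u (g i) != 0 ->
    Num.sg (dotv T (g i)) = Num.sg (dotv u (g i)).
Proof.
have [b1 h1] := covector_comp g b u; have [c0 tc0] := tope_ex.
have [T hT] := covector_comp g b1 c0; exists T.
  move=> i; rewrite -sgr_eq0 hT; case: (eqVneq (dotv b1 (g i)) 0) => [_|b1i].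
    by rewrite sgr_eq0.
  by rewrite sgr_eq0.
split=> [|i bi ui].
  exact: covle_trans (comp_covle hT) (comp_covle h1).
have b1i : Num.sg (dotv b1 (g i)) = Num.sg (dotv u (g i)) by rewrite h1 bi eqxx.
by rewrite hT -b1i -sgr_eq0 b1i sgr_eq0 (negPf ui).
Qed.

(** A description of topes by the order alone, hence respected by every isomorphism. *)
Lemma tope_minimal c : tope c <-> forall b, covle g b c -> covle g c b.
Proof.
split=> [tc b bc i _|h i]; first by rewrite bc.
have [T tT [Tc _]] := tope_below c 0; have := h _ Tc i (tT i).
by move=> e; rewrite -sgr_eq0 e sgr_eq0.
Qed.

Lemma covle_tope c T : tope T -> covle g c T ->
  forall i, Num.sg (dotv c (g i)) = Num.sg (dotv T (g i)).
Proof. by move=> tT h i; apply: h. Qed.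

(** The witness is the component of [g j] orthogonal to [g i], nonzero because the two are not
    collinear. *)
Lemma separator i j : i != j ->
  exists u, dotv u (g i) = 0 /\ 0 < dotv u (g j).
Proof.
move=> ij; pose a := dotv (g j) (g i) / dotv (g i) (g i).
have ii0 : dotv (g i) (g i) != 0 by rewrite dotvv_eq0.
have ui : dotv (g j - a *: g i) (g i) = 0.
  by rewrite dotvBl dotvZl /a divfK // subrr.
exists (g j - a *: g i); split=> //.
have -> : dotv (g j - a *: g i) (g j) =
          dotv (g j - a *: g i) (g j - a *: g i).
  by rewrite dotvBr dotvZr ui mulr0 subr0.
apply: dotvv_gt0; apply/eqP => /eqP; rewrite subr_eq0 => /eqP gj.
by apply: (gg.2 j i); [rewrite eq_sym|exists a].
Qed.

Lemma two_signs i j (s s' : R) : i != j -> exists u,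
  Num.sg (dotv u (g i)) = Num.sg s /\ Num.sg (dotv u (g j)) = Num.sg s'.
Proof.
move=> ij; have [u [ui uj]] := separator ij.
have [w [wj wi]] : exists w, dotv w (g j) = 0 /\ 0 < dotv w (g i).
  by apply: separator; rewrite eq_sym.
exists (s *: w + s' *: u); rewrite !dotvDl !dotvZl ui wj !mulr0 addr0 add0r.
by rewrite !sgrM !(gtr0_sg wi) !(gtr0_sg uj) !mulr1.
Qed.

(** Adjacency in terms of the order only, so that isomorphisms transport it: the face of [b] has no
    vertices besides the two given ones. Equal topes are allowed, whence the inequality in
    [tadj_dist]. *)
Definition tadj (c1 c2 : 'rV[R]_d) := exists b,
  [/\ covle g c1 b, covle g c2 b &
      forall T, tope T -> covle g T b -> covle g T c1 \/ covle g T c2].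

(** If [c1] and [c2] differed at i and j, then [b] would vanish at both, and a tope below [b] could
    follow [c1] at i and [c2] at j, so it would be neither of them. *)
Lemma tadj_dist c1 c2 : tope c1 -> tope c2 -> tadj c1 c2 -> (tdist c1 c2 <= 1)%N.
Proof.
move=> t1 t2 [b [b1 b2 h]]; rewrite leqNgt; apply/negP => /card_gt1P.
move=> [i [j [+ + ij]]]; rewrite !inE => di dj.
have b0 k : Num.sg (dotv c1 (g k)) != Num.sg (dotv c2 (g k)) -> dotv b (g k) = 0.
  by move=> ne; apply/eqP; apply: contraNT ne => bk; rewrite b1 // b2.
have [u [ui uj]] := two_signs (dotv c1 (g i)) (dotv c2 (g j)) ij.
have [T tT [Tb hT]] := tope_below b u.
have Ti : Num.sg (dotv T (g i)) = Num.sg (dotv c1 (g i)).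
  by rewrite hT ?b0 // -sgr_eq0 ui sgr_eq0.
have Tj : Num.sg (dotv T (g j)) = Num.sg (dotv c2 (g j)).
  by rewrite hT ?b0 // -sgr_eq0 uj sgr_eq0.
case: (h _ tT Tb) => hc.
  by move: dj; rewrite -Tj (covle_tope t1 hc) eqxx.
by move: di; rewrite -Ti (covle_tope t2 hc) eqxx.
Qed.

Lemma sgr_cases (x : R) : x != 0 -> Num.sg x = 1 \/ Num.sg x = -1.
Proof. by case: sgrP => // _ _; [left|right]. Qed.

Lemma sgr_opp (x y : R) : x != 0 -> y != 0 -> Num.sg x != Num.sg y ->
  Num.sg x = - Num.sg y.
Proof.
by move=> /sgr_cases[|] -> /sgr_cases[|] ->; rewrite ?opprK ?eqxx.
Qed.

Lemma sgr_segment (a b t : R) : 0 < t < 1 -> a != 0 -> Num.sg a = Num.sg b ->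
  Num.sg (a + t * (b - a)) = Num.sg a.
Proof.
move=> t01; have -> : a + t * (b - a) = (1 - t) * a + t * b by ring.
have [t0 t1] : 0 < t /\ 0 < 1 - t by split; lra.
case: (ltgtP 0 a) => // a0 _ e.
  have b0 : 0 < b by rewrite -sgr_gt0 -e sgr_gt0.
  by rewrite !gtr0_sg // addr_gt0 // mulr_gt0.
have b0 : b < 0 by rewrite -sgr_lt0 -e sgr_lt0.
by rewrite !ltr0_sg // -oppr_gt0 opprD -!mulrN addr_gt0 // mulr_gt0 // oppr_gt0.
Qed.

(** The witness is a positive combination of the two topes, weighted so that the opposite values at
    the one separating generator cancel; the common signs elsewhere survive. *)
Lemma dist1_tadj c1 c2 : tope c1 -> tope c2 -> tdist c1 c2 = 1%N -> tadj c1 c2.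
Proof.
move=> t1 t2 /eqP /cards1P[i hi].
have dE k : (Num.sg (dotv c1 (g k)) != Num.sg (dotv c2 (g k))) = (k == i).
  by rewrite -[k == i]finset.in_set1 -hi inE.
pose a c := `|dotv c (g i)|^-1.
have a0 c : tope c -> 0 < a c by move=> tc; rewrite invr_gt0 normr_gt0.
pose b := a c1 *: c1 + a c2 *: c2.
have aE c : tope c -> a c * dotv c (g i) = Num.sg (dotv c (g i)).
  by move=> tc; rewrite /a mulrC {1}[dotv c _]numEsg mulfK // normr_eq0.
have bi : dotv b (g i) = 0.
  rewrite dotvDl !dotvZl !aE //; apply/eqP; rewrite addr_eq0; apply/eqP.
  by apply: sgr_opp => //; rewrite dE.
have bk k : k != i -> Num.sg (dotv b (g k)) = Num.sg (dotv c1 (g k)).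
  move=> ki; have /eqP e : Num.sg (dotv c1 (g k)) == Num.sg (dotv c2 (g k)).
    by rewrite -[_ == _]negbK dE.
  rewrite dotvDl !dotvZl; have := t1 k; case: (ltgtP 0 (dotv c1 (g k))) => // c1k _.
    have c2k : 0 < dotv c2 (g k) by rewrite -sgr_gt0 -e sgr_gt0.
    by rewrite !gtr0_sg // addr_gt0 // mulr_gt0 // a0.
  have c2k : dotv c2 (g k) < 0 by rewrite -sgr_lt0 -e sgr_lt0.
  by rewrite !ltr0_sg // -oppr_gt0 opprD addr_gt0 // -mulrN mulr_gt0 ?a0 // oppr_gt0.
have b1 : covle g c1 b.
  move=> k; have [->|ki] := eqVneq k i; first by rewrite bi eqxx.
  by rewrite bk.
have b2 : covle g c2 b.
  move=> k; have [->|ki] := eqVneq k i; first by rewrite bi eqxx.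
  by rewrite bk // => _; apply/esym/eqP; rewrite -[_ == _]negbK dE.
exists b; split=> // T tT Tb.
have [e|e] := eqVneq (Num.sg (dotv T (g i))) (Num.sg (dotv c1 (g i))).
  left=> k _; have [->|ki] := eqVneq k i; first by [].
  by rewrite Tb ?bk // -sgr_eq0 bk // sgr_eq0.
right=> k _; have [->|ki] := eqVneq k i.
  rewrite (sgr_opp (tT i) (t1 i) e) (sgr_opp (t1 i) (t2 i)) ?opprK //.
  by rewrite dE.
by rewrite Tb ?b2 // -sgr_eq0 bk // sgr_eq0.
Qed.

(** Walk along the segment from [c1] towards [c2] and stop just after the first separating
    hyperplane. The endpoint is first moved inside its cell so that no two hyperplanes are crossed
    at the same time. *)
Lemma tdist_step c1 c2 m : tope c1 -> tope c2 -> tdist c1 c2 = m.+1 ->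
  exists y, [/\ tope y, tdist c1 y = 1%N & tdist y c2 = m].
Proof.
move=> t1 t2 hm.
(* A functional [c3] is nonzero on [w (i, j)] exactly when the segment from [c1] to [c3] does not
   meet hyperplanes i and j simultaneously. The diagonal entries keep the signs of [c2]. *)
pose w (p : 'I_n * 'I_n) : 'rV[R]_d :=
  if p.1 == p.2 then g p.1 else
  dotv c1 (g p.1) *: g p.2 - dotv c1 (g p.2) *: g p.1.
have w0 p : w p != 0.
  rewrite /w; case: ifP => [_|/negbT np]; first exact: g0.
  apply/eqP => /eqP; rewrite subr_eq0 => /eqP e.
  apply: (gg.2 p.2 p.1); first by rewrite eq_sym.
  exists ((dotv c1 (g p.1))^-1 * dotv c1 (g p.2)).
  by rewrite -scalerA -e scalerA mulVf ?scale1r.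
have [c0 hc0] := generic_covector w0.
have [c3 hc3] := covector_comp w c2 c0.
have c3E k : Num.sg (dotv c3 (g k)) = Num.sg (dotv c2 (g k)).
  by have := hc3 (k, k); rewrite /w /= eqxx (negPf (t2 k)).
have w3 i j : i != j -> dotv c1 (g i) * dotv c3 (g j) != dotv c1 (g j) * dotv c3 (g i).
  move=> ij; have : dotv c3 (w (i, j)) != 0.
    by rewrite -sgr_eq0 hc3; case: (eqVneq (dotv c2 _) 0) => h; rewrite sgr_eq0.
  by rewrite /w /= (negPf ij) dotvBr !dotvZr subr_eq0.
have t3 : tope c3 by move=> k; rewrite -sgr_eq0 c3E sgr_eq0.
have h3 : tdist c1 c3 = m.+1.
  by rewrite -hm /tdist; congr #|pred_of_set _|; apply/setP => k; rewrite !inE c3E.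
have [i0 hi0] : exists i, Num.sg (dotv c1 (g i)) != Num.sg (dotv c3 (g i)).
  by have /card_gt0P[i] : (0 < tdist c1 c3)%N; rewrite ?h3 // inE; exists i.
pose tm i := dotv c1 (g i) / (dotv c1 (g i) - dotv c3 (g i)).
pose P i := Num.sg (dotv c1 (g i)) != Num.sg (dotv c3 (g i)).
case: (@arg_minP _ _ _ i0 P tm hi0) => i Pi imin.
(* [a] and [b] have opposite signs; the segment vanishes at time [a/(a-b)] *)
have seg (a b : R) : a != 0 -> b != 0 -> Num.sg a != Num.sg b ->
    [/\ 0 < a / (a - b) < 1, a - b != 0 &
     forall t, 0 <= t -> t < a / (a - b) -> Num.sg (a + t * (b - a)) = Num.sg a].
  move=> a0 b0 ab; have := sgr_opp a0 b0 ab.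
  case: (ltgtP 0 a) a0 => // a0 _; case: (ltgtP 0 b) b0 => // b0 _;
    rewrite ?(gtr0_sg a0) ?(gtr0_sg b0) ?(ltr0_sg a0) ?(ltr0_sg b0) => e;
    try by move: e; lra.
  - have d0 : 0 < a - b by lra.
    split=> [||t t0 tl]; first by rewrite divr_gt0 //= ltr_pdivrMr // mul1r; lra.
      exact: lt0r_neq0.
    rewrite gtr0_sg //; move: tl; rewrite ltr_pdivlMr //; lra.
  - have d0 : 0 < b - a by lra.
    have -> : a / (a - b) = (- a) / (b - a) by rewrite -[b - a]opprB invrN mulrNN.
    split=> [||t t0 tl]; first by rewrite divr_gt0 ?oppr_gt0 //= ltr_pdivrMr // mul1r; lra.
      by rewrite -opprB oppr_eq0; exact: lt0r_neq0.
    rewrite ltr0_sg //; move: tl; rewrite ltr_pdivlMr //; lra.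
have [tm01 tmd _] := seg _ _ (t1 i) (t3 i) Pi.
pose b := c1 + tm i *: (c3 - c1).
have bi : dotv b (g i) = 0.
  rewrite dotvDl dotvZl dotvBl /tm -[dotv c3 _ - _]opprB mulrN divfK // subrr.
  by [].
have bk k : k != i -> Num.sg (dotv b (g k)) = Num.sg (dotv c1 (g k)).
  move=> ki; rewrite dotvDl dotvZl dotvBl; have [Pk|Pk] := boolP (P k).
    have [_ tkd ->] := seg _ _ (t1 k) (t3 k) Pk => //; first by case/andP: tm01 => /ltW.
    rewrite lt_neqAle imin // andbT; apply/eqP => e.
    have := w3 _ _ ki; rewrite eq_sym => /eqP; apply.
    move: e; rewrite /tm => /eqP; rewrite eqr_div // => /eqP; lra.
  have /eqP e : Num.sg (dotv c1 (g k)) == Num.sg (dotv c3 (g k)) by rewrite -[_ == _]negbK.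
  exact: sgr_segment.
(* [b] lies on hyperplane i only, so composing it with [c3] changes the sign of [c1] at i and
   nowhere else. *)
have [y hy] := covector_comp g b c3.
have yi : Num.sg (dotv y (g i)) = Num.sg (dotv c3 (g i)) by rewrite hy bi eqxx.
have yk k : k != i -> Num.sg (dotv y (g k)) = Num.sg (dotv c1 (g k)).
  by move=> ki; rewrite hy -sgr_eq0 bk // sgr_eq0 (negPf (t1 k)).
exists y; split.
- move=> k; rewrite -sgr_eq0; have [->|ki] := eqVneq k i.
    by rewrite yi sgr_eq0.
  by rewrite yk // sgr_eq0.
- apply/eqP/cards1P; exists i; apply/setP => k; rewrite !inE.
  have [->|ki] := eqVneq k i; first by rewrite yi.
  by rewrite yk // eqxx.
- apply/eqP; rewrite -eqSS -h3 /tdist (cardsD1 i [set _ | _ != Num.sg (dotv c3 _)]).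
  rewrite inE -/(P i) Pi add1n eqSS; apply/eqP; congr #|pred_of_set _|; apply/setP => k; rewrite !inE.
  have [->|ki] := eqVneq k i; first by rewrite yi c3E eqxx.
  by rewrite yk // c3E.
Qed.

End Topes.

Section TopeDistance.
Context {R : realType} {d n : nat}.
Variable g : 'I_n -> 'rV[R]_d.

Lemma tdist_triangle c1 c2 c3 :
  (tdist g c1 c3 <= tdist g c1 c2 + tdist g c2 c3)%N.
Proof.
apply: leq_trans (leq_card_setU _ _); apply: subset_leq_card.
apply/fintype.subsetP => k; rewrite !inE; apply: contraR.
by rewrite negb_or !negbK => /andP[/eqP -> ->].
Qed.

(** The distances from [T] to [p] and to [m] differ by exactly one, through the index i, and the
    nearer end is on the side of [T]. *)
Lemma tdist_halfspace T p m i : tope g T -> tope g p -> tope g m ->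
  (forall k, (Num.sg (dotv p (g k)) != Num.sg (dotv m (g k))) = (k == i)) ->
  (Num.sg (dotv T (g i)) == Num.sg (dotv p (g i))) =
  (tdist g T p < tdist g T m)%N.
Proof.
move=> tT tp tm pm.
have pmk k : k != i -> Num.sg (dotv p (g k)) = Num.sg (dotv m (g k)).
  by move=> ki; apply/eqP; rewrite -[_ == _]negbK pm.
have pmi : Num.sg (dotv p (g i)) != Num.sg (dotv m (g i)) by rewrite pm.
have le c c' : Num.sg (dotv T (g i)) = Num.sg (dotv c (g i)) ->
    Num.sg (dotv T (g i)) != Num.sg (dotv c' (g i)) ->
    (forall k, k != i -> Num.sg (dotv c (g k)) = Num.sg (dotv c' (g k))) ->
    tdist g T c' = (tdist g T c).+1.
  move=> e ne cc'; rewrite /tdist (cardsD1 i) inE ne add1n.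
  congr (#|pred_of_set _|.+1); apply/setP => k; rewrite !inE.
  have [->|ki] := eqVneq k i; first by rewrite e eqxx.
  by rewrite cc'.
have [e|ne] := eqVneq (Num.sg (dotv T (g i))) (Num.sg (dotv p (g i))).
  by rewrite (le p m) ?e // ltnS leqnn.
rewrite (le m p) //; first by apply/esym/negbTE; rewrite -leqNgt leqnSn.
  rewrite (sgr_opp (tT i) (tp i) ne) (sgr_opp (tp i) (tm i) pmi) opprK //.
by move=> k /pmk.
Qed.

Hypothesis gg : generator_family g.

(** A generic functional projected to the orthogonal complement of [g i] vanishes on no other
    generator; its compositions with [g i] and [- g i] are the two ends. *)
Lemma edge_topes i : exists p m, [/\ tope g p, tope g m,
  Num.sg (dotv p (g i)) = 1 &
  forall k, (Num.sg (dotv p (g k)) != Num.sg (dotv m (g k))) = (k == i)].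
Proof.
have g0 := gg.1.
have ii0 : dotv (g i) (g i) != 0 by rewrite dotvv_eq0.
pose a j := dotv (g j) (g i) / dotv (g i) (g i).
pose w j := if j == i then g i else g j - a j *: g i.
have w0 j : w j != 0.
  rewrite /w; case: ifP => // /negbT ji; apply/eqP => /eqP.
  by rewrite subr_eq0 => /eqP e; apply: (gg.2 j i ji); exists (a j).
have [c0 hc0] := generic_covector w0.
pose b := c0 - (dotv c0 (g i) / dotv (g i) (g i)) *: g i.
have bi : dotv b (g i) = 0 by rewrite dotvBl dotvZl divfK // subrr.
have bk k : k != i -> dotv b (g k) != 0.
  move=> ki; have := hc0 k; rewrite /w (negPf ki) dotvBl dotvBr dotvZl dotvZr /a.
  by rewrite (dotvC (g i) (g k)) mulrAC [X in X / _]mulrC mulrAC.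
have [p hp] := covector_comp g b (g i).
have [m hm] := covector_comp g b (- g i).
have pi : Num.sg (dotv p (g i)) = 1.
  by rewrite hp bi eqxx gtr0_sg // dotvv_gt0.
have mi : Num.sg (dotv m (g i)) = -1.
  by rewrite hm bi eqxx dotvNl sgrN gtr0_sg // dotvv_gt0.
exists p, m; split=> // k.
- rewrite -sgr_eq0; have [->|ki] := eqVneq k i; first by rewrite pi oner_eq0.
  by rewrite hp (negPf (bk k ki)) sgr_eq0 bk.
- rewrite -sgr_eq0; have [->|ki] := eqVneq k i.
    by rewrite mi oppr_eq0 oner_eq0.
  by rewrite hm (negPf (bk k ki)) sgr_eq0 bk.
- have [->|ki] := eqVneq k i; first by rewrite pi mi; apply/eqP; lra.
  by rewrite hp hm (negPf (bk k ki)) eqxx.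
Qed.

End TopeDistance.

(** * From lattice isomorphisms to relabellings and reorientations *)

Section Isomorphism.
Context {R : realType}.

Section OneWay.
Context {d e n : nat}.
Variables (g : 'I_n -> 'rV[R]_d) (h : 'I_n -> 'rV[R]_e).
Variable rho : 'rV[R]_d -> 'rV[R]_e -> Prop.
Hypotheses (gg : generator_family g) (hg : generator_family h).
Hypothesis iso : cov_iso g h rho.

Lemma cov_iso_tope c c' : rho c c' -> tope g c -> tope h c'.
Proof.
case: iso => tot surj rle r /(tope_minimal gg) tc; apply/(tope_minimal hg) => b' bc'.
have [b rb] := surj b'; apply/(rle _ _ _ _ r rb); apply: tc.
exact/(rle _ _ _ _ rb r).
Qed.

Lemma cov_iso_tadj c1 c2 c1' c2' (sym : forall c c', rho c c' -> tope h c' -> tope g c) :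
  rho c1 c1' -> rho c2 c2' -> tadj g c1 c2 -> tadj h c1' c2'.
Proof.
case: iso => tot surj rle r1 r2 [b [b1 b2 hb]].
have [b' rb] := tot b; exists b'; split; [exact/(rle _ _ _ _ r1 rb)|exact/(rle _ _ _ _ r2 rb)|].
move=> T' tT' T'b; have [T rT] := surj T'.
have tT : tope g T := sym _ _ rT tT'.
have /(rle _ _ _ _ rT rb)Tb := T'b.
by case: (hb _ tT Tb) => Tc; [left|right]; [exact/(rle _ _ _ _ rT r1)|exact/(rle _ _ _ _ rT r2)].
Qed.

End OneWay.

(** Each step of a geodesic from [tdist_step] is an adjacency, so its image has length at most 1,
    and the triangle inequality adds the steps up. *)
Lemma cov_iso_tdist_le d e n (g : 'I_n -> 'rV[R]_d) (h : 'I_n -> 'rV[R]_e) rho :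
  generator_family g -> generator_family h -> cov_iso g h rho ->
  forall c1 c2 c1' c2', rho c1 c1' -> rho c2 c2' -> tope g c1 -> tope g c2 ->
  (tdist h c1' c2' <= tdist g c1 c2)%N.
Proof.
move=> gg hg iso c1 c2 c1' c2' r1 r2 t1 t2.
have sym c c' : rho c c' -> tope h c' -> tope g c.
  by move=> r; exact: (cov_iso_tope hg gg (cov_iso_sym iso)).
have [tot surj rle] := iso.
move hm : (tdist g c1 c2) => m.
elim: m c1 c1' r1 t1 hm => [|m IH] c1 c1' r1 t1 hm.
  have eqs k : Num.sg (dotv c1 (g k)) = Num.sg (dotv c2 (g k)).
    move/eqP: hm; rewrite cards_eq0 => /eqP/setP/(_ k); rewrite !inE => /negbT.
    by rewrite negbK => /eqP.
  rewrite leqn0 cards_eq0; apply/eqP/setP => k; rewrite !inE.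
  have /(rle _ _ _ _ r1 r2) -> : covle g c1 c2 by move=> i _; exact: eqs.
    by rewrite eqxx.
  exact: (cov_iso_tope gg hg iso r2 t2).
have [y [ty d1 d2]] := tdist_step gg t1 t2 hm.
have [y' ry] := tot y.
apply: leq_trans (tdist_triangle _ _ y' _) _; rewrite -[m.+1]add1n.
apply: leq_add; last exact: (IH y).
apply: (tadj_dist hg (cov_iso_tope gg hg iso r1 t1) (cov_iso_tope gg hg iso ry ty)).
apply: (cov_iso_tadj iso sym r1 ry); exact: dist1_tadj.
Qed.

Lemma cov_iso_tdist d e n (g : 'I_n -> 'rV[R]_d) (h : 'I_n -> 'rV[R]_e) rho :
  generator_family g -> generator_family h -> cov_iso g h rho ->
  forall c1 c2 c1' c2', rho c1 c1' -> rho c2 c2' -> tope g c1 -> tope g c2 ->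
  tdist h c1' c2' = tdist g c1 c2.
Proof.
move=> gg hg iso c1 c2 c1' c2' r1 r2 t1 t2; apply/eqP.
rewrite eqn_leq (cov_iso_tdist_le gg hg iso r1 r2) //=.
apply: (cov_iso_tdist_le hg gg (cov_iso_sym iso)) => //.
  exact: (cov_iso_tope gg hg iso r1).
exact: (cov_iso_tope gg hg iso r2).
Qed.

(* Half-spaces of topes are determined by the distances to the two ends of an
   edge crossing the hyperplane, hence are preserved by the isomorphism. *)
Lemma cov_iso_reorientation d e n (g : 'I_n -> 'rV[R]_d) (h : 'I_n -> 'rV[R]_e) rho :
  generator_family g -> generator_family h -> cov_iso g h rho ->
  exists (s : {perm 'I_n}) (eps : 'I_n -> R), (forall i, eps i = 1 \/ eps i = -1) /\
  forall c c', rho c c' ->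
    forall i, Num.sg (dotv c' (h (s i))) = eps i * Num.sg (dotv c (g i)).
Proof.
move=> gg hg iso; have [tot surj rle] := iso.
have sym c c' : rho c c' -> tope h c' -> tope g c.
  by move=> r; exact: (cov_iso_tope hg gg (cov_iso_sym iso)).
have top c c' : rho c c' -> tope g c -> tope h c' by exact: cov_iso_tope.
have local i : exists je : 'I_n * R, (je.2 = 1 \/ je.2 = -1) /\
    forall c c', rho c c' -> tope g c ->
    Num.sg (dotv c' (h je.1)) = je.2 * Num.sg (dotv c (g i)).
  have [p [m [tp tm p1 pm]]] := edge_topes gg i.
  have [[p' rp] [m' rm]] := (tot p, tot m).
  have /eqP/cards1P[j hj] : tdist h p' m' = 1%N.
    rewrite (cov_iso_tdist gg hg iso rp rm tp tm).
    by apply/eqP/cards1P; exists i; apply/setP => k; rewrite !inE pm.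
  have {}hj k : (Num.sg (dotv p' (h k)) != Num.sg (dotv m' (h k))) = (k == j).
    by move/setP/(_ k): hj; rewrite !inE.
  exists (j, Num.sg (dotv p' (h j))); split; first exact: sgr_cases (top _ _ rp tp j).
  move=> T T' rT tT /=.
  have tp' := top _ _ rp tp; have tm' := top _ _ rm tm; have tT' := top _ _ rT tT.
  have hs := tdist_halfspace tT' tp' tm' hj.
  rewrite (cov_iso_tdist gg hg iso rT rp) // (cov_iso_tdist gg hg iso rT rm) // in hs.
  rewrite -(tdist_halfspace tT tp tm pm) p1 in hs.
  have [e1|e1] := eqVneq (Num.sg (dotv T (g i))) 1.
    by rewrite e1 eqxx in hs; rewrite e1 mulr1; exact/eqP.
  have [e2|e2] := sgr_cases (tT i); first by rewrite e2 eqxx in e1.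
  rewrite e2 mulrN1; apply: (sgr_opp (tT' j) (tp' j)).
  by rewrite hs (negPf e1).
have [f hf] := choice local.
(* If two generators had the same image, the product of their signs would be the same on all topes;
   but by [two_signs] a tope can show the opposite product. *)
have inj : injective (fun i => (f i).1).
  move=> i1 i2 /= e12; apply/eqP/negP => /negP ne.
  have sgE (s : R) : s = 1 \/ s = -1 -> Num.sg s = s.
    by case=> ->; rewrite ?sgrN sgr1.
  pose q := (f i1).2 * (f i2).2.
  have [u [u1 u2]] := two_signs gg 1 (- q) ne.
  have [T tT [_ hT]] := tope_below gg 0 u.
  have [T' rT] := tot T.
  have q1 : q = 1 \/ q = -1.
    rewrite /q; have [[-> | ->] _] := hf i1; have [[-> | ->] _] := hf i2;
      rewrite ?(mulr1, mul1r, mulrN1, opprK); by [left|right].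
  have u1' : Num.sg (dotv u (g i1)) = 1 by rewrite u1 sgr1.
  have u2' : Num.sg (dotv u (g i2)) = - q by rewrite u2 sgrN sgE.
  have T1 : Num.sg (dotv T (g i1)) = 1.
    by rewrite hT ?dotv0l // -sgr_eq0 u1' oner_eq0.
  have T2 : Num.sg (dotv T (g i2)) = - q.
    rewrite hT ?dotv0l // -sgr_eq0 u2'.
    by case: q1 => ->; rewrite ?opprK ?oppr_eq0 oner_eq0.
  have [_ /(_ _ _ rT tT)] := hf i1; have [_ /(_ _ _ rT tT)] := hf i2.
  rewrite -e12 => ->; rewrite T1 T2 /q.
  by have [[-> | ->] _] := hf i1; have [[-> | ->] _] := hf i2; lra.
exists (perm inj), (fun i => (f i).2); split=> [i|c c' r i]; first by have [] := hf i.
rewrite permE; have [e1 hfi] := hf i.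
have e0 : (f i).2 != 0 by case: e1 => ->; rewrite ?oppr_eq0 oner_eq0.
(* Only topes have been matched so far. A general covector vanishes at i exactly when topes of both
   signs lie below it, and this property is carried over in both directions. *)
have [c0|c0] := eqVneq (dotv c (g i)) 0.
  have below (u : 'rV[R]_d) : dotv u (g i) != 0 -> dotv c' (h (f i).1) != 0 ->
      Num.sg (dotv c' (h (f i).1)) = (f i).2 * Num.sg (dotv u (g i)).
    move=> u0 ne; have [T tT [Tc Tu]] := tope_below gg c u.
    have [T' rT] := tot T; have /(rle _ _ _ _ rT r) Tc' := Tc.
    by rewrite -Tc' // (hfi _ _ rT tT) Tu.
  rewrite c0 sgr0 mulr0; apply/eqP; rewrite sgr_eq0; apply/negP => /negP ne.
  have := below (g i); rewrite dotvv_eq0 gg.1 => /(_ isT ne).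
  have := below (- g i); rewrite dotvNl oppr_eq0 dotvv_eq0 gg.1 => /(_ isT ne) ->.
  by rewrite sgrN gtr0_sg ?dotvv_gt0 ?gg.1 //; case: e1 => ->; lra.
have [ne|c'0] := boolP (dotv c' (h (f i).1) != 0).
  have [T tT [Tc _]] := tope_below gg c 0.
  have [T' rT] := tot T; have /(rle _ _ _ _ rT r) Tc' := Tc.
  by rewrite -Tc' // (hfi _ _ rT tT) Tc.
move: c'0; rewrite negbK => /eqP c'0.
have opp (u : 'rV[R]_e) : dotv u (h (f i).1) != 0 ->
    Num.sg (dotv u (h (f i).1)) = (f i).2 * Num.sg (dotv c (g i)).
  move=> u0; have [T' tT' [Tc' Tu]] := tope_below hg c' u.
  have [T rT] := surj T'; have /(rle _ _ _ _ rT r) Tc := Tc'.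
  by rewrite -Tu // (hfi _ _ rT (sym _ _ rT tT')) Tc.
have := opp (h (f i).1); rewrite dotvv_eq0 hg.1 => /(_ isT).
have := opp (- h (f i).1); rewrite dotvNl oppr_eq0 dotvv_eq0 hg.1 => /(_ isT) <-.
by rewrite sgrN gtr0_sg ?dotvv_gt0 ?hg.1 //; lra.
Qed.

End Isomorphism.

(** * Covector sets as elements of a finite type *)

Section CovectorSets.
Context {R : realType}.

(** Signs with values in a finite type, so that covector sets can be counted. *)
Definition sgb (x : R) : bool * bool := (0 < x, x < 0).

Lemma sgb_sg x y : sgb x = sgb y <-> Num.sg x = Num.sg y.
Proof.
rewrite /sgb; split=> [[e1 e2]|e].
  case: (ltgtP 0 x) e1 e2 => [x0|x0|<-]; case: (ltgtP 0 y) => [y0|y0|<-] //.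
    by rewrite !gtr0_sg.
  by rewrite !ltr0_sg.
by rewrite -[0 < x]sgr_gt0 -[x < 0]sgr_lt0 e sgr_gt0 sgr_lt0.
Qed.

Definition swapb (p : bool * bool) := (p.2, p.1).

Lemma sgbN x : sgb (- x) = swapb (sgb x).
Proof. by rewrite /sgb /swapb oppr_gt0 oppr_lt0. Qed.

Definition sgvec d n (g : 'I_n -> 'rV[R]_d) c := [ffun i => sgb (dotv c (g i))].

Definition covset d n (g : 'I_n -> 'rV[R]_d) : {set {ffun 'I_n -> bool * bool}} :=
  [set s | `[<exists c, s = sgvec g c>]]%SET.

Lemma covsetP d n (g : 'I_n -> 'rV[R]_d) s :
  reflect (exists c, s = sgvec g c) (s \in covset g).
Proof. by rewrite inE; exact: asboolP. Qed.

Definition reorient n (pe : {perm 'I_n} * {ffun 'I_n -> bool})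
    (s : {ffun 'I_n -> bool * bool}) : {ffun 'I_n -> bool * bool} :=
  [ffun i => let j := (pe.1^-1)%g i in if pe.2 j then swapb (s j) else s j].

Lemma same_comb_type_reorient d e n (g : 'I_n -> 'rV[R]_d) (h : 'I_n -> 'rV[R]_e) :
  generator_family g -> generator_family h ->
  same_comb_type (zonotope g) (zonotope h) ->
  exists pe, covset h = [set reorient pe s | s in covset g]%SET.
Proof.
move=> gg hg /same_comb_typeP[rho iso].
have [s [eps [eps1 hs]]] := cov_iso_reorientation gg hg iso.
have [tot surj _] := iso.
have main c c' : rho c c' ->
    sgvec h c' = reorient (s, [ffun i => eps i == -1]) (sgvec g c).
  move=> r; apply/ffunP => i; rewrite !ffunE /= !ffunE.
  have := hs _ _ r ((s^-1)%g i); rewrite permKV.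
  have [e1|e1] := eps1 ((s^-1)%g i); rewrite e1.
    have -> : (1 == -1 :> R) = false by apply/eqP; lra.
    by rewrite mul1r => /sgb_sg.
  by rewrite eqxx mulN1r -sgrN => /sgb_sg ->; rewrite sgbN.
exists (s, [ffun i => eps i == -1]); apply/setP => v.
apply/covsetP/imsetP => [[c' ->]|[u /covsetP[c ->] ->]].
  have [c r] := surj c'; exists (sgvec g c); last exact: main.
  by apply/covsetP; exists c.
by have [c' r] := tot c; exists c'; rewrite (main _ _ r).
Qed.

Lemma covset_sub d e n (g : 'I_n -> 'rV[R]_d) (h : 'I_n -> 'rV[R]_e) c :
  covset g = covset h ->
  exists c', forall i, Num.sg (dotv c' (h i)) = Num.sg (dotv c (g i)).
Proof.
move=> e0; have : sgvec g c \in covset g by apply/covsetP; exists c.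
rewrite e0 => /covsetP[c' ec]; exists c' => i.
by move/ffunP/(_ i): ec; rewrite !ffunE => /sgb_sg ->.
Qed.

Lemma covset_comb_type d e n (g : 'I_n -> 'rV[R]_d) (h : 'I_n -> 'rV[R]_e) :
  covset g = covset h -> same_comb_type (zonotope g) (zonotope h).
Proof.
move=> e0; apply: (@same_comb_type_signs R d e n g h (fun=> 1)) => [i|c|c'].
- exact: oner_neq0.
- have [c' hc] := covset_sub c e0; exists c' => i; rewrite mul1r; exact: hc.
- have [c hc] := covset_sub c' (esym e0).
  by exists c => i; rewrite mul1r hc.
Qed.

End CovectorSets.

(** * Chirotopes *)

Section CrossProduct.
Context {R : realType} {D : nat}.
Implicit Types (A : 'M[R]_(D, D.+1)) (w y : 'rV[R]_D.+1).

(** The generalised cross product: cofactors along an added top row, on whose entries they do not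
    depend. *)
Definition cross A : 'rV[R]_D.+1 :=
  \row_k cofactor (col_mx 0 A : 'M[R]_(1 + D)) 0 k.

Lemma dotv_cross w A : dotv w (cross A) = \det (col_mx w A : 'M[R]_(1 + D)).
Proof.
rewrite (expand_det_row _ (lshift D 0)); apply: eq_bigr => k _.
rewrite mxE col_mxEu; congr (_ * _).
rewrite /cofactor; congr (_ * \det _).
by apply/matrixP => i j; rewrite !mxE; case: splitP => // a; rewrite ord1.
Qed.

Lemma cross_orth A i : dotv (row i A) (cross A) = 0.
Proof.
rewrite dotv_cross.
apply: (@determinant_alternate _ _ _ (lshift D (0 : 'I_1)) (rshift 1 i)) => // j.
by rewrite col_mxEu col_mxEd mxE.
Qed.

(** The D rows cannot span, so some unit vector is independent of them; its product with [cross A]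
    is the nonzero determinant of the completed matrix. *)
Lemma cross_neq0 A : row_free A -> cross A != 0.
Proof.
move=> Af; apply/eqP => c0.
have : ~~ (1%:M <= A)%MS.
  apply/negP => /mxrankS; rewrite mxrank1 => h.
  by have := leq_trans h (rank_leq_row A); rewrite ltnn.
move=> /row_subPn[i /negP hi]; apply: hi.
set w := row i _; have := dotv_cross w A; rewrite c0 dotvC dotv0l => /esym/eqP.
rewrite -[_ == 0]negbK -unitfE -unitmxE -row_free_unit => /negP nf.
apply: contrapT => nw; apply: nf; apply: inj_row_free => v.
rewrite -[v]hsubmxK (mul_row_col (lsubmx v : 'rV_1) (rsubmx v) w A).
set a := lsubmx v; set b := rsubmx v => e.
have a0 : a = 0.
  apply: contrapT => a0; apply: nw; rewrite [a]mx11_scalar in e a0.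
  rewrite mul_scalar_mx in e.
  have a00 : a 0 0 != 0 by apply/eqP => a00; apply: a0; rewrite a00 raddf0.
  have -> : w = (- (a 0 0)^-1 *: b) *m A.
    rewrite -scalemxAl; move/eqP: e; rewrite addr_eq0 => /eqP e.
    by rewrite -[b *m A]opprK -e scaleNr scalerN opprK scalerA mulVf ?scale1r.
  exact: submxMl.
have b0 : b = 0.
  by apply: (row_free_inj Af); move: e; rewrite a0 mul0mx add0r mul0mx.
by rewrite a0 b0 row_mx0.
Qed.

Lemma dotv_rows0 n p (B : 'M[R]_(n, p)) (y : 'rV[R]_p) :
  (forall i, dotv (row i B) y = 0) <-> y *m B^T = 0.
Proof.
have E i : (y *m B^T) 0 i = dotv (row i B) y.
  by rewrite mxE; apply: eq_bigr => k _; rewrite !mxE mulrC.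
split=> [h|h i]; first by apply/rowP => i; rewrite E h mxE.
by rewrite -E h mxE.
Qed.

(** After subtracting the projection on [cross A], the rest of [y] is orthogonal to all rows of the
    invertible matrix with [cross A] on top of [A]. *)
Lemma cross_uniq A y : row_free A -> (forall i, dotv (row i A) y = 0) ->
  exists mu, y = mu *: cross A.
Proof.
move=> Af hy; have x0 := cross_neq0 Af; set x := cross A in x0 *.
have xx0 : dotv x x != 0 by rewrite dotvv_eq0.
exists (dotv x y / dotv x x); apply/eqP; rewrite -subr_eq0; apply/eqP.
set y' := y - _.
have B_unit : (col_mx x A : 'M[R]_(1 + D)) \in unitmx.
  by rewrite unitmxE -dotv_cross unitfE.
have : y' *m (col_mx x A : 'M[R]_(1 + D))^T = 0.
  apply/(dotv_rows0 (col_mx x A : 'M[R]_(1 + D))) => i.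
  rewrite -[i](@splitK 1 D); case: (@fintype.split 1 D i) => k /=.
    rewrite rowKu ord1 row_id /y' dotvBr dotvZr divfK ?subrr //.
  by rewrite rowKd /y' dotvBr dotvZr cross_orth mulr0 hy subr0.
move=> /(congr1 (mulmx^~ (invmx (col_mx x A : 'M[R]_(1 + D))^T))).
by rewrite mulmxK ?unitmx_tr // mul0mx.
Qed.

End CrossProduct.

Section Chirotope.
Context {R : realType}.

Definition spanning d n (g : 'I_n -> 'rV[R]_d) :=
  forall c, (forall i, dotv c (g i) = 0) -> c = 0.

Lemma full_dim_spanning d n (g : 'I_n -> 'rV[R]_d) : full_dim g <-> spanning g.
Proof.
rewrite /full_dim; set M := \matrix_(i < n) g i.
have E c : (forall i, dotv c (g i) = 0) <-> c *m M^T = 0.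
  split=> [h|/dotv_rows0 h i]; first by apply/dotv_rows0 => i; rewrite rowK dotvC.
  by rewrite -(h i) rowK dotvC.
split=> [/eqP fr c|sp]; last first.
  rewrite -mxrank_tr; apply/eqP; apply: inj_row_free => v /E; exact: sp.
have Mf : row_free M^T by rewrite /row_free mxrank_tr.
by move=> /E h; apply: (row_free_inj Mf); rewrite h mul0mx.
Qed.

Section Fixed.
Context {D n : nat}.
Implicit Types (g h : 'I_n -> 'rV[R]_D.+1).

Definition gdet g (s : 'I_D.+1 -> 'I_n) : R := \det (\matrix_(k < _) g (s k)).

Definition gcross g (s : 'I_D -> 'I_n) := cross (\matrix_(k < _) g (s k)).

Definition scons (i : 'I_n) (s : 'I_D -> 'I_n) : 'I_D.+1 -> 'I_n :=
  fun k => oapp s i (unlift ord0 k).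

Lemma dotv_gcross g s i : dotv (g i) (gcross g s) = gdet g (scons i s).
Proof.
rewrite dotv_cross /gdet; congr (\det _); apply/matrixP => a b.
rewrite -[a](@splitK 1 D); case: (@fintype.split 1 D a) => k /=.
  rewrite col_mxEu ord1 mxE /scons.
  have -> : lshift D (0 : 'I_1) = ord0 :> 'I_D.+1 by apply: val_inj.
  by rewrite unlift_none.
rewrite col_mxEd !mxE /scons.
have -> : rshift 1 k = lift ord0 k :> 'I_D.+1 by apply: val_inj.
by rewrite liftK.
Qed.

Definition nonzeros g x := #|[set i | dotv x (g i) != 0]%SET|.

(** Moving from [x] along [y] until the first of the shrinking entries reaches zero flips no sign
    and creates one more zero. *)
Lemma conformal_step g x y : (forall i, dotv x (g i) = 0 -> dotv y (g i) = 0) ->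
  (exists k, dotv y (g k) * dotv x (g k) < 0) ->
  exists2 b, 0 < b & covle g x (x + b *: y) /\
    (nonzeros g (x + b *: y) < nonzeros g x)%N.
Proof.
move=> yx [k hk].
pose P i := dotv y (g i) * dotv x (g i) < 0.
pose r i := - dotv x (g i) / dotv y (g i).
case: (@arg_minP _ _ _ k P r hk) => i Pi imin.
have ne j : P j -> dotv x (g j) != 0 /\ dotv y (g j) != 0.
  by move=> Pj; split; apply/eqP => e; move: Pj; rewrite /P e ?mulr0 ?mul0r ltxx.
have r0 : 0 < r i.
  have [xi yi] := ne _ Pi; rewrite /r -(pmulr_lgt0 _ (_ : 0 < dotv y (g i) ^+ 2)).
    by rewrite expr2 mulrA divfK // mulNr oppr_gt0 mulrC.
  by rewrite exprn_even_gt0.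
have main j : dotv (x + r i *: y) (g j) != 0 ->
    Num.sg (dotv x (g j)) = Num.sg (dotv (x + r i *: y) (g j)).
  rewrite dotvDl dotvZl => hz.
  have [x0|x0] := eqVneq (dotv x (g j)) 0.
    by move: hz; rewrite yx // x0 mulr0 addr0 eqxx.
  have [Pj|Pj] := boolP (P j); last first.
    move: Pj; rewrite /P -leNgt => Pj.
    case: (ltgtP 0 (dotv x (g j))) x0 => // x0 _.
      rewrite !gtr0_sg //; have : 0 <= dotv y (g j) by rewrite -(pmulr_lge0 _ x0).
      by move=> y0; rewrite ltr_wpDr // mulr_ge0 // ltW.
    rewrite !ltr0_sg //; have : dotv y (g j) <= 0 by rewrite -(nmulr_lge0 _ x0).
    by move=> y0; rewrite -oppr_gt0 opprD ltr_wpDr ?oppr_gt0 // -mulrN mulr_ge0 ?oppr_ge0 // ltW.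
  have [_ y0] := ne _ Pj; have := imin _ Pj; rewrite {2}/r; move: hz Pj; rewrite /P.
  move: (r i) => t; case: (ltgtP 0 (dotv y (g j))) y0 => // y0 _ hz.
    rewrite pmulr_rlt0 // => x0'; rewrite ler_pdivlMr // => ht.
    rewrite !ltr0_sg // lt_neqAle hz /=; lra.
  rewrite nmulr_rlt0 // => x0'; rewrite ler_ndivlMr // => ht.
  rewrite !gtr0_sg // lt_neqAle eq_sym hz /=; lra.
exists (r i) => //; split; first exact: main.
apply: proper_card; apply/fintype.properP; split.
  apply/fintype.subsetP => j; rewrite !inE => hz.
  by rewrite -sgr_eq0 main // sgr_eq0.
exists i; rewrite !inE; first by have [] := ne _ Pi.
have [xi yi] := ne _ Pi.
by rewrite negbK dotvDl dotvZl /r divfK // subrr.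
Qed.

Lemma sgr_conform_add (a b s : R) :
  (a = 0 \/ Num.sg a = s) -> (b = 0 \/ Num.sg b = s) ->
  (s != 0 -> a != 0 \/ b != 0) -> Num.sg (a + b) = s.
Proof.
case=> [->|<-]; case=> [->|e]; rewrite ?(add0r, addr0) //.
- have [->|s0] := eqVneq s 0; first by rewrite sgr0.
  by move=> /(_ isT)[]; rewrite eqxx.
- case: (ltgtP 0 a) e => a0; last by rewrite -a0 sgr0 => /eqP; rewrite sgr_eq0 => /eqP ->; rewrite addr0 sgr0.
    by rewrite (gtr0_sg a0) => /eqP; rewrite sgr_cp0 => b0; rewrite gtr0_sg // addr_gt0.
  rewrite (ltr0_sg a0) => /eqP; rewrite sgr_cp0 => b0; rewrite ltr0_sg //.
  by rewrite -oppr_gt0 opprD addr_gt0 ?oppr_gt0.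
Qed.

(* Every vector is a sum of vectors conformal to it whose zeros span a
   hyperplane; the signs of the latter are signs of determinants. *)
Lemma chirotope_covector g h : spanning g ->
  (forall s, Num.sg (gdet g s) = Num.sg (gdet h s)) ->
  forall x, exists x', forall i, Num.sg (dotv x' (h i)) = Num.sg (dotv x (g i)).
Proof.
move=> sp chi x; have [m] := ubnP (nonzeros g x); elim: m => // m IH in x *.
rewrite ltnS => xm.
have [x0|/existsNP[j /eqP xj]] := pselect (forall i, dotv x (g i) = 0).
  by exists 0 => i; rewrite x0 dotv0l.
(* Either some [y] has all the zeros of [x] and more, and then [x] splits into conformal vectors
   with fewer nonzero entries, or the zeros of [x] determine it up to a factor. *)
have [[y [y0 yx [j' [xj' yj']]]]|nA] := pselect (exists y, [/\ y != 0,
   forall i, dotv x (g i) = 0 -> dotv y (g i) = 0 &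
   exists j', dotv x (g j') != 0 /\ dotv y (g j') = 0]).
  have [k yk] : exists k, dotv y (g k) != 0.
    apply: contrapT => /forallNP h0; move/eqP: y0; apply; apply: sp => i.
    by apply/eqP; rewrite -[_ == _]negbK; apply/negP/h0.
  have xk : dotv x (g k) != 0 by apply: contra_neq yk; exact: yx.
  (* The factor makes [y1] opposite to [x] at k, which is what [conformal_step] asks for. *)
  pose y1 := - (dotv x (g k) * dotv y (g k)) *: y.
  have y1x i : dotv x (g i) = 0 -> dotv y1 (g i) = 0.
    by move=> /yx e; rewrite dotvZl e mulr0.
  have [|b b0 [cu nu]] := conformal_step y1x.
    have sq (a c : R) : - (a * c) * c * a = - (a * c) ^+ 2 by ring.
    by exists k; rewrite dotvZl sq oppr_lt0 exprn_even_gt0 // mulf_neq0.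
  (* The second summand comes from the opposite direction: [x - a *: y1] if a zero is reached there
     as well, and [- y1] itself, which is then conformal to [x], if not. *)
  have [v [al [be [al0 be0 xE [cv nv]]]]] : exists v al be, [/\ 0 < al, 0 < be,
      x = al *: (x + b *: y1) + be *: v & covle g x v /\ (nonzeros g v < nonzeros g x)%N].
    have [ex|nex] := pselect (exists k, dotv (- y1) (g k) * dotv x (g k) < 0).
      have [i /y1x e|a a0 [cv nv]] := conformal_step _ ex.
        by rewrite dotvNl e oppr0.
      exists (x + a *: - y1), (a / (a + b)), (b / (a + b)); split=> //.
      - by rewrite divr_gt0 // addr_gt0.
      - by rewrite divr_gt0 // addr_gt0.
      - have ab0 : a + b != 0 by rewrite gt_eqF // addr_gt0.
        apply/rowP => i; rewrite !mxE; field.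
        exact: ab0.
    exists (- y1), 1, b; split=> //; first by apply/rowP => i; rewrite !mxE; ring.
    split.
      move=> i vi; have xi : dotv x (g i) != 0.
        by apply: contra_neq vi => /y1x e; rewrite dotvNl e oppr0.
      have : 0 <= dotv (- y1) (g i) * dotv x (g i).
        by rewrite leNgt; apply/negP => lt0; apply: nex; exists i.
      case: (ltgtP 0 (dotv x (g i))) xi => // xi _.
        by rewrite pmulr_lge0 // => h0; rewrite !gtr0_sg // lt_def vi.
      by rewrite nmulr_lge0 // => h0; rewrite !ltr0_sg // lt_neqAle vi.
    apply: proper_card; apply/fintype.properP; split.
      apply/fintype.subsetP => i; rewrite !inE; apply: contra_neq => /y1x e.
      by rewrite dotvNl e oppr0.
    by exists j'; rewrite !inE // negbK dotvNl dotvZl yj' mulr0 oppr0.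
  have [u' hu'] := IH _ (leq_trans nu xm); have [v' hv'] := IH _ (leq_trans nv xm).
  exists (u' + v') => i; rewrite dotvDl; apply: sgr_conform_add.
  - have [e|ne] := eqVneq (dotv (x + b *: y1) (g i)) 0; [left|right].
      by apply/eqP; rewrite -sgr_eq0 hu' e sgr0.
    by rewrite hu' cu.
  - have [e|ne] := eqVneq (dotv v (g i)) 0; [left|right].
      by apply/eqP; rewrite -sgr_eq0 hv' e sgr0.
    by rewrite hv' cv.
  - rewrite sgr_eq0 => xi; apply/orP.
    have -> : (dotv u' (h i) == 0) = (dotv (x + b *: y1) (g i) == 0).
      by rewrite -sgr_eq0 hu' sgr_eq0.
    have -> : (dotv v' (h i) == 0) = (dotv v (g i) == 0).
      by rewrite -sgr_eq0 hv' sgr_eq0.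
    rewrite -negb_and; apply: contraNN xi => /andP[/eqP eu /eqP ev].
    by rewrite xE (dotvDl (al *: _)) (dotvZl al) (dotvZl be) eu ev !mulr0 addr0.
have key y : (forall i, dotv x (g i) = 0 -> dotv y (g i) = 0) ->
    exists mu, y = mu *: x.
  move=> hy; exists (dotv y (g j) / dotv x (g j)).
  apply/eqP; rewrite -subr_eq0; apply/negP => /negP y0; apply: nA; eexists.
  split; [exact: y0| |exists j; split=> //].
    by move=> i xi; rewrite dotvBl dotvZl xi mulr0 hy // subr0.
  by rewrite dotvBl dotvZl divfK // subrr.
(* The generators on the hyperplane of [x], with zero rows in place of the others. Its kernel is the
   line of [x], so the rank is D and D independent generators can be selected. *)
pose A := \matrix_(i < n) (if dotv x (g i) == 0 then g i else 0).
have xA : x *m A^T = 0.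
  apply/dotv_rows0 => i; rewrite rowK; case: eqP => [e|_]; last exact: dotv0l.
  by rewrite dotvC.
have x0 : x != 0 by apply: contra_neq xj => ->; rewrite dotv0l.
have rA : \rank A = D.
  have le1 : (\rank (kermx A^T) <= 1)%N.
    apply: leq_trans (_ : \rank x <= 1)%N; last exact: rank_leq_row.
    apply: mxrankS; apply/row_subP => i; apply/sub_rVP; apply: key => k xk.
    have /dotv_rows0/(_ k) : row i (kermx A^T) *m A^T = 0.
      by rewrite -row_mul mulmx_ker row0.
    by rewrite rowK xk eqxx dotvC.
  have ge1 : (1 <= \rank (kermx A^T))%N.
    apply: leq_trans (_ : \rank x <= _)%N; first by rewrite lt0n mxrank_eq0.
    by apply: mxrankS; apply/sub_kermxP.
  have := rank_leq_col A; move: le1 ge1; rewrite mxrank_ker mxrank_tr; lia.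
have [s [sx sf]] : exists s : 'I_D -> 'I_n,
    (forall k, dotv x (g (s k)) = 0) /\ row_free (\matrix_(k < _) g (s k)).
  have [f ff] : exists f : 'I_D -> 'I_n, row_free (rowsub f A).
    have aux r : \rank A = r -> exists f : 'I_r -> 'I_n, row_free (rowsub f A).
      by move=> <-; exists (maxrankfun A); exact: maxrowsub_free.
    exact: aux.
  have fx k : dotv x (g (f k)) = 0.
    apply/eqP/negP => /negP xk; move: ff => /row_freeP[B] /matrixP/(_ k k).
    rewrite !mxE eqxx /= big1 => [/eqP|a _]; first by rewrite eq_sym oner_eq0.
    by rewrite !mxE (negPf xk) mxE mul0r.
  exists f; split=> //; have -> // : \matrix_(k < _) g (f k) = rowsub f A.
  by apply/matrixP => a b; rewrite !mxE fx eqxx.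
have [|mu xE] := @cross_uniq _ _ _ x sf.
  by move=> i; rewrite rowK dotvC.
(* The same scalar and the same selection serve for [h]: the value at i is [mu] times a determinant,
   whose sign is common to both families. *)
exists (mu *: gcross h s) => i.
rewrite dotvZl sgrM dotvC dotv_gcross -chi -dotv_gcross dotvC -sgrM.
by rewrite -dotvZl /gcross -xE.
Qed.

Lemma chirotope_covset g h : spanning g -> spanning h ->
  (forall s, Num.sg (gdet g s) = Num.sg (gdet h s)) -> covset g = covset h.
Proof.
move=> sg sh chi; apply/setP => v; apply/covsetP/covsetP => -[c ->].
  have [c' hc] := chirotope_covector sg chi c; exists c'; apply/ffunP => i.
  by rewrite !ffunE; apply/sgb_sg.
have [c' hc] := chirotope_covector sh (fun s => esym (chi s)) c.
by exists c'; apply/ffunP => i; rewrite !ffunE; apply/sgb_sg.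
Qed.

End Fixed.
End Chirotope.

(** * Polynomial functions *)

Section PolynomialFunctions.
Context {R : realType} {k : nat}.
Implicit Types (x y : 'rV[R]_k) (f : 'rV[R]_k -> R) (m : {ffun 'I_k -> nat}).

Definition mono m x : R := \prod_i x 0 i ^+ m i.

Definition peval (s : seq (R * {ffun 'I_k -> nat})) x :=
  \sum_(am <- s) am.1 * mono am.2 x.

Definition spanned (B : pred {ffun 'I_k -> nat}) f :=
  exists s, all (fun am => B am.2) s /\ forall x, f x = peval s x.

(** Both degrees are tracked: [zero_pattern_bound] uses the degree in each variable, [bezout_bound]
    the total degree. *)
Definition degle (t : nat) (b : 'I_k -> nat) : pred {ffun 'I_k -> nat} :=
  fun m => (\sum_i m i <= t)%N && [forall i, m i <= b i]%N.

Lemma spanned_ext B f f' : (forall x, f x = f' x) -> spanned B f -> spanned B f'.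
Proof. by move=> e [s [sB fs]]; exists s; split=> // x; rewrite -e. Qed.

Lemma spanned_le (B B' : pred _) f : (forall m, B m -> B' m) ->
  spanned B f -> spanned B' f.
Proof.
move=> le [s [sB fs]]; exists s; split=> //.
by apply: sub_all sB => am; exact: le.
Qed.

Lemma spanned0 B : spanned B (fun=> 0).
Proof. by exists [::]; split=> // x; rewrite /peval big_nil. Qed.

Lemma spannedD B f f' : spanned B f -> spanned B f' ->
  spanned B (fun x => f x + f' x).
Proof.
move=> [s [sB fs]] [s' [sB' fs']]; exists (s ++ s'); rewrite all_cat sB sB'.
by split=> // x; rewrite fs fs' /peval big_cat.
Qed.

Lemma spanned_mono (B : pred _) a m : B m -> spanned B (fun x => a * mono m x).
Proof.
move=> Bm; exists [:: (a, m)]; rewrite /= Bm; split=> // x.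
by rewrite /peval big_seq1.
Qed.

Lemma spanned_sum (I : Type) (r : seq I) (P : pred I) B (F : I -> 'rV[R]_k -> R) :
  (forall i, P i -> spanned B (F i)) -> spanned B (fun x => \sum_(i <- r | P i) F i x).
Proof.
move=> h; elim: r => [|i r IH].
  by apply: spanned_ext (spanned0 B) => x; rewrite big_nil.
have [Pi|Pi] := boolP (P i).
  by apply: spanned_ext (spannedD (h i Pi) IH) => x; rewrite big_cons Pi.
by apply: spanned_ext IH => x; rewrite big_cons (negPf Pi).
Qed.

Definition madd m m' : {ffun 'I_k -> nat} := [ffun i => (m i + m' i)%N].

Lemma monoD m m' x : mono m x * mono m' x = mono (madd m m') x.
Proof.
by rewrite /mono -big_split; apply: eq_bigr => i _; rewrite /= ffunE exprD.
Qed.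

Lemma spannedM (B1 B2 B3 : pred _) f f' :
  (forall m m', B1 m -> B2 m' -> B3 (madd m m')) ->
  spanned B1 f -> spanned B2 f' -> spanned B3 (fun x => f x * f' x).
Proof.
move=> h [s [sB fs]] [s' [sB' fs']].
exists [seq (am.1 * am'.1, madd am.2 am'.2) | am <- s, am' <- s'].
split=> [|x].
  apply/allP => _ /allpairsP[[p q] [/= ps qs ->]] /=.
  by apply: h; [exact: (allP sB)|exact: (allP sB')].
rewrite fs fs' /peval big_flatten big_map big_distrl; apply: eq_bigr => am _.
rewrite /= big_map big_distrr; apply: eq_bigr => am' _ /=.
by rewrite -monoD mulrACA.
Qed.

Lemma degle_add t1 t2 b1 b2 m m' : degle t1 b1 m -> degle t2 b2 m' ->
  degle (t1 + t2) (fun i => b1 i + b2 i)%N (madd m m').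
Proof.
move=> /andP[h1 /forallP h2] /andP[h3 /forallP h4]; apply/andP; split.
  under eq_bigr do rewrite ffunE; rewrite big_split; exact: leq_add.
by apply/forallP => i; rewrite ffunE leq_add.
Qed.

Lemma degle_le t1 t2 b1 b2 : (t1 <= t2)%N -> (forall i, b1 i <= b2 i)%N ->
  forall m, degle t1 b1 m -> degle t2 b2 m.
Proof.
move=> ht hb m /andP[h1 /forallP h2]; rewrite /degle (leq_trans h1 ht) /=.
by apply/forallP => i; exact: leq_trans (h2 i) (hb i).
Qed.

Definition pdeg t b f := spanned (degle t b) f.

Lemma pdeg_ext t b f f' : (forall x, f x = f' x) -> pdeg t b f -> pdeg t b f'.
Proof. exact: spanned_ext. Qed.

Lemma pdeg_le t1 t2 b1 b2 f : (t1 <= t2)%N -> (forall i, b1 i <= b2 i)%N ->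
  pdeg t1 b1 f -> pdeg t2 b2 f.
Proof. by move=> ht hb; apply: spanned_le; exact: degle_le. Qed.

Lemma pdegM t1 t2 b1 b2 f f' : pdeg t1 b1 f -> pdeg t2 b2 f' ->
  pdeg (t1 + t2) (fun i => b1 i + b2 i)%N (fun x => f x * f' x).
Proof. by apply: spannedM => m m'; exact: degle_add. Qed.

Lemma pdegD t b f f' : pdeg t b f -> pdeg t b f' -> pdeg t b (fun x => f x + f' x).
Proof. exact: spannedD. Qed.

Lemma pdeg_cst t b (a : R) : pdeg t b (fun=> a).
Proof.
apply: (@spanned_ext _ (fun x => a * mono [ffun=> 0%N] x)) => [x|].
  by rewrite /mono big1 ?mulr1 // => i _; rewrite ffunE.
apply: spanned_mono; apply/andP; split.
  by rewrite big1 // => i _; rewrite ffunE.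
by apply/forallP => i; rewrite ffunE.
Qed.

Lemma pdeg_coord j : pdeg 1 (fun i => i == j) (fun x => x 0 j).
Proof.
apply: (@spanned_ext _ (fun x => 1 * mono [ffun i => nat_of_bool (i == j)] x)).
  move=> x; rewrite mul1r /mono (bigD1 j) //= ffunE eqxx big1 ?mulr1 // => i.
  by rewrite ffunE => /negPf ->.
apply: spanned_mono; apply/andP; split; last by apply/forallP => i; rewrite ffunE.
by rewrite (bigD1 j) //= ffunE eqxx big1 // => i; rewrite ffunE => /negPf ->.
Qed.

Lemma pdegZ t b (a : R) f : pdeg t b f -> pdeg t b (fun x => a * f x).
Proof.
move=> h; apply: (@pdeg_le (0 + t) t (fun i => 0 + b i)%N) => //.
by apply: pdegM => //; exact: pdeg_cst.
Qed.

Lemma pdegN t b f : pdeg t b f -> pdeg t b (fun x => - f x).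
Proof. by move=> /(pdegZ (-1)); apply: pdeg_ext => x; rewrite mulN1r. Qed.

Lemma pdegB t b f f' : pdeg t b f -> pdeg t b f' -> pdeg t b (fun x => f x - f' x).
Proof. by move=> h h'; apply: pdegD => //; exact: pdegN. Qed.

Lemma pdeg_sum (I : Type) (r : seq I) (P : pred I) t b (F : I -> 'rV[R]_k -> R) :
  (forall i, P i -> pdeg t b (F i)) -> pdeg t b (fun x => \sum_(i <- r | P i) F i x).
Proof. exact: spanned_sum. Qed.

Lemma pdeg_prod (I : Type) (r : seq I) (P : pred I) (t : I -> nat)
    (b : I -> 'I_k -> nat) (F : I -> 'rV[R]_k -> R) :
  (forall i, P i -> pdeg (t i) (b i) (F i)) ->
  pdeg (\sum_(i <- r | P i) t i) (fun j => \sum_(i <- r | P i) b i j)%N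
    (fun x => \prod_(i <- r | P i) F i x).
Proof.
move=> h; elim: r => [|i r IH].
  by apply: pdeg_ext (pdeg_cst _ _ 1) => x; rewrite big_nil.
have [Pi|Pi] := boolP (P i).
  apply: pdeg_ext (_ : pdeg _ _ (fun x => F i x * \prod_(j <- r | P j) F j x)).
    by move=> x; rewrite big_cons Pi.
  apply: pdeg_le (pdegM (h i Pi) IH) => [|j]; by rewrite big_cons Pi.
apply: pdeg_ext (_ : pdeg _ _ (fun x => \prod_(j <- r | P j) F j x)).
  by move=> x; rewrite big_cons (negPf Pi).
apply: pdeg_le IH => [|j]; by rewrite big_cons (negPf Pi).
Qed.

Lemma pdegX t b f n : pdeg t b f -> pdeg (t * n) (fun j => b j * n)%N (fun x => f x ^+ n).
Proof.
move=> h; elim: n => [|n IH]; first by apply: pdeg_ext (pdeg_cst _ _ 1).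
apply: pdeg_ext (_ : pdeg _ _ (fun x => f x * f x ^+ n)); first by move=> x; rewrite exprS.
by apply: pdeg_le (pdegM h IH) => [|j]; rewrite mulnS.
Qed.

Lemma spanned_continuous B f : spanned B f -> continuous f.
Proof.
move=> [s [_ fs]]; have -> : f = peval s by apply/funext.
have cp (r : seq 'I_k) m : continuous (fun x => \prod_(i <- r) x 0 i ^+ m i).
  elim: r => [|i r IH].
    by under eq_fun do rewrite big_nil; exact: cst_continuous.
  have ci : continuous (fun x : 'rV[R]_k => x 0 i ^+ m i).
    move=> x; apply: (@continuous_comp _ _ _ (fun y : 'rV[R]_k => y 0 i)
      (fun a : R => a ^+ m i)).
      exact: coord_continuous.
    exact: exprn_continuous.
  by under eq_fun do rewrite big_cons; move=> x; exact: cvgM (ci x) (IH x).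
elim: {fs} s => [|[a m] s IH].
  rewrite (_ : peval [::] = fun=> 0); first exact: cst_continuous.
  by apply/funext => x; rewrite /peval big_nil.
rewrite (_ : peval _ = fun x => a * mono m x + peval s x); last first.
  by apply/funext => x; rewrite /peval big_cons.
have cm : continuous (fun x => a * mono m x).
  by move=> x; exact: cvgM (cvg_cst a) (cp _ m x).
by move=> x; exact: cvgD (cm x) (IH x).
Qed.

Lemma spanned_linepoly B f : spanned B f -> linepoly f.
Proof.
move=> [s [_ fs]]; have -> : f = peval s by apply/funext.
apply: linepoly_sum => am; apply: linepolyM; first exact: linepoly_cst.
apply: linepoly_prod => i; elim: (am.2 i) => [|n IH] p q.
  by have [P e] := linepoly_cst (V := 'rV[R]_k) 1 p q; exists P => t; rewrite -e.
have lc : linepoly (fun x : 'rV[R]_k => x 0 i) by apply: linepoly_lin => *; rewrite !mxE.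
by have [P e] := linepolyM lc IH p q; exists P => t; rewrite -e exprS.
Qed.

(** Partial derivatives through restriction to coordinate lines. The degree bound is left as it was;
    the power sum added later is of large enough degree to dominate it. *)
Lemma peval_deriv t b s i : all (fun am => degle t b am.2) s ->
  exists r, pdeg t b r /\ forall x, exists P : {poly R},
    (forall a, peval s (x + a *: delta_mx 0 i) = P.[a]) /\ P^`().[0] = r x.
Proof.
elim: s => [_|[c m] s IH] /=.
  exists (fun=> 0); split; first exact: pdeg_cst.
  by move=> x; exists 0; split=> [a|]; rewrite ?derivC ?horner0 ?linear0 ?horner0 // /peval big_nil.
move=> /andP[dm /IH[r [rd hr]]].
pose m' := [ffun j => if j == i then (m i).-1 else m j].
exists (fun x => (c * (m i)%:R) * mono m' x + r x); split.
  apply: pdegD => //; apply: spanned_mono; move: dm => /andP[h1 /forallP h2].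
  have mm j : (m' j <= m j)%N by rewrite ffunE; case: eqP => // ->; exact: leq_pred.
  apply/andP; split; first by apply: leq_trans h1; exact: leq_sum.
  by apply/forallP => j; exact: leq_trans (mm j) (h2 j).
move=> x; have [P [eP dP]] := hr x.
pose C := c * \prod_(j | j != i) x 0 j ^+ m j.
exists (C *: ('X + (x 0 i)%:P) ^+ m i + P); split=> [a|].
  rewrite /peval big_cons /= -[X in _ + X]/(peval s _) eP hornerD hornerZ.
  rewrite horner_exp !hornerE /C -!mulrA; congr (_ * _ + _).
  rewrite /mono (bigD1 i) //= !mxE !eqxx mulr1 mulrC [a + _]addrC; congr (_ * _).
  by apply: eq_bigr => j /negPf ji; rewrite !mxE ji andbF mulr0 addr0.
rewrite derivD hornerD dP derivZ hornerZ deriv_exp derivD derivX derivC addr0 mul1r.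
rewrite hornerMn horner_exp !hornerE; congr (_ + _).
have -> : mono m' x = x 0 i ^+ (m i).-1 * \prod_(j | j != i) x 0 j ^+ m j.
  rewrite /mono (bigD1 i) //= ffunE eqxx; congr (_ * _).
  by apply: eq_bigr => j /negPf ji; rewrite ffunE ji.
by rewrite /C -mulr_natr; ring.
Qed.

End PolynomialFunctions.

(** * Zero patterns and Bezout bound *)

Section DimensionCounting.
Context {R : realType}.

(** The matrix of values of the functions at the points factors through a space with basis [J];
    without a relation between its rows its rank is the size of [I]. *)
Lemma dim_bound (I J : finType) (E : J -> I -> R) (c : I -> J -> R) :
  (forall l : I -> R, (forall b, \sum_a l a * \sum_j c a j * E j b = 0) ->
    forall a, l a = 0) -> (#|I| <= #|J|)%N.
Proof.
move=> indep.
pose C := \matrix_(a < #|I|, j < #|J|) c (enum_val a) (enum_val j).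
pose F := \matrix_(j < #|J|, b < #|I|) E (enum_val j) (enum_val b).
have free : row_free (C *m F).
  apply: inj_row_free => v vM; apply/rowP => a; rewrite mxE.
  rewrite -[a]enum_valK; apply: (indep (fun i => v 0 (enum_rank i))) => b.
  have := congr1 (fun M : 'rV[R]_#|I| => M 0 (enum_rank b)) vM.
  rewrite !mxE => h0; rewrite -[RHS]h0 (reindex_onto enum_val enum_rank) //=; last first.
    by move=> i _; rewrite enum_rankK.
  apply: eq_big => [i|i _]; first by rewrite enum_valK eqxx.
  rewrite enum_valK mxE; congr (_ * _).
  rewrite (reindex_onto enum_val enum_rank) //=; last first.
    by move=> j _; rewrite enum_rankK.
  apply: eq_big => [j|j _]; first by rewrite enum_valK eqxx.
  by rewrite !mxE enum_rankK.
have : (\rank (C *m F) <= #|J|)%N.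
  exact: leq_trans (mxrankM_maxl _ _) (rank_leq_col _).
by rewrite (eqP free).
Qed.

Context {k : nat}.
Implicit Types (x : 'rV[R]_k).

Definition bmono e (j : {ffun 'I_k -> 'I_e}) x : R := \prod_i x 0 i ^+ j i.

Lemma card_bmono e : #|{ffun 'I_k -> 'I_e}| = (e ^ k)%N.
Proof. by rewrite card_ffun !card_ord. Qed.

Lemma mono_bmono e (m : {ffun 'I_k -> nat}) : (forall i, m i < e)%N ->
  exists j : {ffun 'I_k -> 'I_e}, forall x, mono m x = bmono j x.
Proof.
move=> h; exists [ffun i => Ordinal (h i)] => x.
by apply: eq_bigr => i _; rewrite ffunE.
Qed.

(** Agreement is required at the points [u a] only, so equations that hold there can be used as
    rewriting rules. *)
Definition reducible (I : finType) (u : I -> 'rV[R]_k) e (f : 'rV[R]_k -> R) :=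
  exists c : {ffun 'I_k -> 'I_e} -> R, forall a, f (u a) = \sum_j c j * bmono j (u a).

Section Reducible.
Context {I : finType}.
Variables (u : I -> 'rV[R]_k) (e : nat).

Lemma reducibleD f f' : reducible u e f -> reducible u e f' ->
  reducible u e (fun x => f x + f' x).
Proof.
move=> [c hc] [c' hc']; exists (fun j => c j + c' j) => a.
by rewrite hc hc' -big_split; apply: eq_bigr => j _; rewrite mulrDl.
Qed.

Lemma reducibleZ a f : reducible u e f -> reducible u e (fun x => a * f x).
Proof.
move=> [c hc]; exists (fun j => a * c j) => b.
by rewrite hc mulr_sumr; apply: eq_bigr => j _; rewrite mulrA.
Qed.

Lemma reducible_ext f f' : (forall a, f (u a) = f' (u a)) ->
  reducible u e f -> reducible u e f'.
Proof. by move=> ff [c hc]; exists c => a; rewrite -ff. Qed.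

Lemma reducible_bmono j : reducible u e (bmono (e := e) j).
Proof.
exists (fun j' => (j' == j)%:R) => a; rewrite (bigD1 j) //= eqxx mul1r.
by rewrite big1 ?addr0 // => j' /negPf ->; rewrite mul0r.
Qed.

Lemma reducible_spanned B f : spanned B f ->
  (forall m, B m -> reducible u e (mono m)) -> reducible u e f.
Proof.
move=> [s [sB fs]] h; apply: (@reducible_ext (peval s)) => [a|]; first by rewrite fs.
elim: s sB {fs} => [_|[c m] s IH] /=.
  by exists (fun=> 0) => a; rewrite /peval big_nil big1 // => j _; rewrite mul0r.
move=> /andP[Bm /IH hs].
apply: (@reducible_ext (fun x => c * mono m x + peval s x)).
  by move=> a; rewrite /peval big_cons.
by apply: reducibleD => //; apply: reducibleZ; exact: h.
Qed.

Lemma reducible_card (G : I -> 'rV[R]_k -> R) :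
  (forall a, reducible u e (G a)) ->
  (forall l : I -> R, (forall b, \sum_a l a * G a (u b) = 0) -> forall a, l a = 0) ->
  (#|I| <= e ^ k)%N.
Proof.
move=> red indep; have [c hc] := choice red.
rewrite -card_bmono; apply: (@dim_bound _ _ (fun j b => bmono j (u b)) c) => l hl.
by apply: indep => b; rewrite -[RHS](hl b); apply: eq_bigr => a _; rewrite hc.
Qed.

End Reducible.

(* Ronyai-Babai-Ganapathy: the products of the [Q s] not vanishing at [u a]
   are linearly independent functions. *)
Lemma zero_pattern_bound (S I : finType) (Q : S -> 'rV[R]_k -> R)
    (t : S -> nat) (b : S -> 'I_k -> nat) (De : nat) (u : I -> 'rV[R]_k) :
  (forall s, pdeg (t s) (b s) (Q s)) -> (forall j, \sum_s b s j <= De)%N ->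
  injective (fun a => [set s | Q s (u a) == 0]%SET) ->
  (#|I| <= De.+1 ^ k)%N.
Proof.
move=> dQ bD inj.
pose Z a := [set s | Q s (u a) == 0]%SET.
pose G a x := \prod_(s | s \notin Z a) Q s x.
apply: (@reducible_card _ u _ G) => [a|l hl].
  have := @pdeg_prod R k S (index_enum S) (fun s => s \notin Z a) t b Q (fun s _ => dQ s).
  move=> h; apply: reducible_spanned h _ => m /andP[_ /forallP hm].
  have [i|j hj] := @mono_bmono De.+1 m; last first.
    by have [c hc] := reducible_bmono u j; exists c => a'; rewrite hj.
  rewrite ltnS; apply: leq_trans (hm i) _; apply: leq_trans (bD i).
  by rewrite [X in (_ <= X)%N](bigID (fun s => s \notin Z a)) leq_addr.
have GZ a c : G a (u c) != 0 -> Z c \subset Z a.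
  move=> g0; apply/fintype.subsetP => s sc; apply: contraNT g0 => sa.
  by rewrite /G (bigD1 s) //=; move: sc; rewrite inE => /eqP ->; rewrite mul0r.
apply: contrapT => /existsNP[a0 /eqP la0].
(* Among the indices with nonzero coefficient take one with the largest zero set and evaluate at its
   point: another term surviving there would have a zero set containing this one, hence equal to
   it. *)
case: (@arg_maxnP _ a0 (fun a => l a != 0) (fun a => #|Z a|) la0) => a la amax.
move: (hl a); rewrite (bigD1 a) //= big1 ?addr0 => [/eqP|c ca].
  rewrite mulf_eq0 (negPf la) /= => /eqP; apply/eqP.
  by apply/prodf_neq0 => s; rewrite inE.
have [-> | lc] := eqVneq (l c) 0; first by rewrite mul0r.
have [-> | /GZ sub] := eqVneq (G c (u a)) 0; first by rewrite mulr0.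
suff e : Z a = Z c by move: ca; rewrite (inj _ _ e) eqxx.
by apply/eqP; rewrite eqEcard sub; exact: amax.
Qed.

(** Replacing a factor [x_i ^ e] by [r i] lowers the total degree, so at the solutions every
    polynomial becomes a combination of the e^k monomials with exponents below e. Interpolating
    products of affine forms, each nonzero at a single solution, are independent there. *)
Lemma bezout_bound (I : finType) (u : I -> 'rV[R]_k) (e : nat)
    (r : 'I_k -> 'rV[R]_k -> R) (b : 'I_k -> nat) : (0 < e)%N -> injective u ->
  (forall i, pdeg e.-1 b (r i)) ->
  (forall a i, u a 0 i ^+ e = r i (u a)) -> (#|I| <= e ^ k)%N.
Proof.
move=> e0 inj dr hr.
have red m : reducible u e (mono m).
  have [n] := ubnP (\sum_i m i)%N; elim: n => // n IH in m *; rewrite ltnS => mn.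
  have [/forallP h|/forallPn[i]] := boolP [forall i, m i < e]%N.
    have [j hj] := mono_bmono h; have [c hc] := reducible_bmono u j.
    by exists c => a; rewrite hj.
  rewrite -leqNgt => ei.
  pose m' : {ffun 'I_k -> nat} := [ffun j => if j == i then (m i - e)%N else m j].
  have sm : (\sum_j m j = e + \sum_j m' j)%N.
    rewrite (bigD1 i) //= [in RHS](bigD1 i) //= ffunE eqxx addnA subnKC //.
    by congr (_ + _)%N; apply: eq_bigr => j /negPf ji; rewrite ffunE ji.
  apply: (@reducible_ext _ _ _ (fun x => r i x * mono m' x)) => [a|].
    rewrite -hr /mono [in RHS](bigD1 i) //= (bigD1 i) //= ffunE eqxx mulrA -exprD subnKC //.
    by congr (_ * _); apply: eq_bigr => j /negPf ji; rewrite ffunE ji.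
  apply: (@reducible_spanned _ _ _ (fun m0 => \sum_j m0 j < n)%N).
    apply: (spannedM (B1 := degle e.-1 b) (B2 := pred1 m')) (dr i) _.
      move=> m1 m2 /andP[h1 _] /eqP ->; apply: leq_trans mn; rewrite sm.
      under eq_bigr do rewrite ffunE; rewrite big_split /= ltn_add2r.
      by rewrite -(prednK e0) ltnS.
    apply: spanned_ext (_ : spanned _ (fun x => 1 * mono m' x)) => [x|].
      by rewrite mul1r.
    by apply: spanned_mono; rewrite /= eqxx.
  by move=> m0; exact: IH.
have redT f : spanned predT f -> reducible u e f.
  by move=> /reducible_spanned; apply.
pose w a b' := u a - u b'.
have wP a b' : b' != a -> dotv (w a b') (u a - u b') != 0.
  by move=> ba; rewrite dotvv_eq0 subr_eq0; apply: contraNneq ba => /inj ->.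
pose G a x := \prod_(b' | b' != a) dotv (w a b') (x - u b').
have Gb a c : c != a -> G a (u c) = 0.
  by move=> ca; rewrite /G (bigD1 c) //= subrr dotvC dotv0l mul0r.
apply: (@reducible_card _ u _ G) => [a|l hl a].
  apply: redT.
  have h b' : b' != a -> pdeg 1 (fun=> 1%N) (fun x => dotv (w a b') (x - u b')).
    move=> _; apply: pdeg_ext (_ : pdeg _ _ (fun x => \sum_i w a b' 0 i * (x 0 i - u b' 0 i))).
      by move=> x; apply: eq_bigr => i _; rewrite !mxE.
    apply: pdeg_sum => i _; apply: pdegZ; apply: pdegB; last exact: pdeg_cst.
    by apply: pdeg_le (pdeg_coord i) => // j; case: (j == i).
  have := @pdeg_prod R k I (index_enum I) _ _ _ _ h.
  by apply: spanned_le.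
move: (hl a); rewrite (bigD1 a) //= big1 ?addr0 => [/eqP|c ca]; last first.
  by rewrite Gb ?mulr0 // eq_sym.
rewrite mulf_eq0 => /orP[/eqP //|/eqP]; rewrite /G => /eqP.
by apply: contraTeq => _; apply/prodf_neq0 => b'; exact: wP.
Qed.

End DimensionCounting.

(** * Critical points *)

Section CriticalPoints.
Context {R : realType}.

Lemma right_min_deriv (P : {poly R}) :
  (\forall t \near 0^'+, P.[0] <= P.[t]) -> 0 <= P^`().[0].
Proof.
move=> h; rewrite leNgt; apply/negP => neg.
have [Q PE] : exists Q, P = P.[0]%:P + 'X * Q.
  have /factor_theorem[Q hQ] : root (P - P.[0]%:P) 0.
    by rewrite /root hornerD hornerN hornerC subrr.
  by exists Q; rewrite mulrC -[X in _ * X]subr0 -polyC0 -hQ addrC subrK.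
have QE : P^`().[0] = Q.[0].
  by rewrite PE derivD derivC add0r derivM derivX mul1r hornerD hornerM hornerX mul0r addr0.
rewrite QE in neg.
have near1 := @horner_sg_near R Q (ltr0_neq0 neg).
have [t [[ht sQ] t0]] := filter_ex (filterI (filterI h near1) (nbhs_right_gt 0)).
move: ht; rewrite [in X in _ <= X]PE hornerD hornerC hornerM hornerX lerDl.
by rewrite pmulr_rge0 // leNgt -sgr_lt0 sQ sgr_lt0 neg.
Qed.

Context {k : nat}.
Implicit Types (x y : 'rV[R]_k).

Lemma closed_region (S : finType) (c : S -> 'rV[R]_k -> R) :
  (forall s, continuous (c s)) -> closed [set y | forall s, 0 <= c s y].
Proof.
move=> cc; have -> : [set y | forall s, 0 <= c s y] =
    \bigcap_(s in [set: S]) (c s @^-1` [set r | 0 <= r]).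
  by apply/seteqP; split=> y /= h s; [move=> _|]; exact: h.
apply: closed_bigI => s _; apply: closed_comp; last exact: closed_ge.
by move=> y _; exact: cc.
Qed.

(** On the compact boundary of the region h has a positive minimum, which exceeds [dl * p x0] for
    small dl. This is the value of the perturbed function at [x0], so its minimum is not on the
    boundary. *)
Lemma interior_minimum (S : finType) (c : S -> 'rV[R]_k -> R)
    (h p : 'rV[R]_k -> R) x0 :
  (forall s, continuous (c s)) -> continuous h -> continuous p ->
  bounded_set [set y | forall s, 0 <= c s y] ->
  (forall y, 0 <= p y) ->
  (forall s, 0 <= c s x0) -> h x0 = 0 ->
  (forall y, (forall s, 0 <= c s y) -> (exists s, c s y = 0) -> 0 < h y) ->
  \forall dl \near 0^'+, exists y, (forall s, 0 < c s y) /\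
    forall y', (forall s, 0 <= c s y') -> h y + dl * p y <= h y' + dl * p y'.
Proof.
move=> cc ch cp bU p0 c0 h0 hb.
have cU := closed_region cc.
set U := [set y | forall s, 0 <= c s y] in bU cU.
have kU : compact U := bounded_closed_compact bU cU.
have near s : \forall dl \near 0^'+, forall y, U y -> c s y = 0 -> dl * p x0 < h y.
  have cB : compact (U `&` c s @^-1` [set 0]).
    apply: compact_closedI => //; apply: closed_comp; last exact: closed_eq.
    by move=> y _; exact: cc.
  have [[y1 B1]|nB] := pselect (U `&` c s @^-1` [set 0] !=set0); last first.
    by near=> dl => y Uy cy; case: nB; exists y.
  have [||y2 /set_mem[U2 c2] ymin] := EVT_min_rV _ cB (f := h).
  - by exists y1.
  - by move=> y; apply: continuous_subspaceT => ?; exact: ch.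
  have h2 : 0 < h y2 by apply: hb => //; exists s.
  have pp : 0 < p x0 + 1 by rewrite ltr_wpDl.
  have q0 : 0 < h y2 / (p x0 + 1) by rewrite divr_gt0.
  near=> dl => y Uy cy; apply: lt_le_trans (_ : h y2 <= _); last by apply: ymin; exact/mem_set.
  apply: le_lt_trans (_ : dl * (p x0 + 1) < h y2).
    by rewrite ler_wpM2l ?lerDl // ltW.
  rewrite -ltr_pdivlMr //; near: dl; exact: nbhs_right_lt.
have nearS : \forall dl \near 0^'+, forall s y, U y -> c s y = 0 -> dl * p x0 < h y.
  by apply: filter_forall => s; exact: near.
near=> dl.
have dl0 : 0 < dl by near: dl; exact: nbhs_right_gt.
have hdl : forall s y, U y -> c s y = 0 -> dl * p x0 < h y by near: dl; exact: nearS.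
have cdp : continuous (fun y => dl * p y).
  by move=> y; exact: cvgM (cvg_cst dl) (cp y).
have cF : continuous (fun y => h y + dl * p y).
  by move=> y; exact: cvgD (ch y) (cdp y).
have [||y /set_mem Uy ymin] := EVT_min_rV _ kU (f := fun y => h y + dl * p y).
- by exists x0.
- by apply: continuous_subspaceT.
exists y; split=> [s|y' Uy']; last by apply: ymin; exact/mem_set.
rewrite lt_def Uy andbT; apply/negP => /eqP cs.
have := ymin x0 (mem_set c0); rewrite h0 add0r leNgt => /negP; apply.
by apply: lt_le_trans (hdl _ _ Uy cs) _; rewrite lerDl mulr_ge0 // ltW.
Unshelve. all: by end_near. Qed.

Definition power_sum e x : R := \sum_i x 0 i ^+ e.

Lemma power_sum_line e x i (a : R) :
  power_sum e.+1 (x + a *: delta_mx 0 i) =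
  (('X + (x 0 i)%:P) ^+ e.+1 + (\sum_(j | j != i) x 0 j ^+ e.+1)%:P).[a].
Proof.
rewrite /power_sum (bigD1 i) //= !mxE !eqxx mulr1 hornerD hornerC horner_exp !hornerE.
rewrite addrC [a + _]addrC addrC; congr (_ + _).
by apply: eq_bigr => j /negPf ji; rewrite !mxE ji andbF mulr0 addr0.
Qed.

(** At an interior minimum the derivatives along [delta_mx 0 i] and its opposite are both
    nonnegative, hence zero. The functions [r] are fixed before [dl] and the region, so one system
    of equations serves all regions. *)
Lemma interior_gradient t b (h : 'rV[R]_k -> R) e : pdeg t b h ->
  exists r : 'I_k -> 'rV[R]_k -> R, (forall i, pdeg t b (r i)) /\
  forall (S : finType) (c : S -> 'rV[R]_k -> R) (dl : R) y,
    (forall s, linepoly (c s)) -> dl != 0 -> (forall s, 0 < c s y) ->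
    (forall y', (forall s, 0 <= c s y') ->
       h y + dl * power_sum e.+1 y <= h y' + dl * power_sum e.+1 y') ->
    forall i, y 0 i ^+ e = - (dl * e.+1%:R)^-1 * r i y.
Proof.
move=> [s [sd hs]].
have [r hr] := choice (fun i => peval_deriv i sd).
exists r; split=> [i|S c dl y lc dl0 cy ymin i]; first by have [] := hr i.
have [_ /(_ y) [P [hP dP]]] := hr i.
pose Q : {poly R} := ('X + (y 0 i)%:P) ^+ e.+1 + (\sum_(j | j != i) y 0 j ^+ e.+1)%:P.
pose F := P + dl *: Q.
have FE a : F.[a] = h (y + a *: delta_mx 0 i) + dl * power_sum e.+1 (y + a *: delta_mx 0 i).
  by rewrite hs hP power_sum_line hornerD hornerZ.
have F0 : F.[0] = h y + dl * power_sum e.+1 y by rewrite FE scale0r addr0.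
have near q : \forall t \near 0^'+, h y + dl * power_sum e.+1 y <=
    h (y + t *: q) + dl * power_sum e.+1 (y + t *: q).
  have : \forall t \near 0^'+, forall s, Num.sg (c s (y + t *: q)) = Num.sg (c s y).
    by apply: filter_forall => s'; apply: linepoly_sg_near; rewrite ?lt0r_neq0.
  apply: filterS => t' hsg; apply: ymin => s'.
  by rewrite -sgr_ge0 hsg sgr_ge0 ltW.
have dF : F^`().[0] = r i y + dl * (e.+1%:R * y 0 i ^+ e).
  rewrite derivD hornerD dP derivZ hornerZ derivD derivC addr0 deriv_exp derivD derivX.
  rewrite derivC addr0 mul1r hornerMn horner_exp !hornerE /= -mulr_natl.
  by rewrite mulrA.
have F1 : 0 <= F^`().[0].
  apply: right_min_deriv; apply: filterS (near (delta_mx 0 i)) => a.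
  by rewrite F0 FE.
have F2 : 0 <= (F \Po (- 'X))^`().[0].
  apply: right_min_deriv; apply: filterS (near (- delta_mx 0 i)) => a.
  by rewrite !horner_comp !hornerN !hornerX oppr0 F0 FE scaleNr -scalerN.
have {F1 F2} : F^`().[0] = 0.
  apply/eqP; rewrite eq_le F1 andbT; move: F2.
  rewrite deriv_comp hornerM horner_comp derivN derivX !hornerN hornerX hornerC oppr0.
  by rewrite mulrN1 oppr_ge0.
rewrite dF => /eqP; rewrite addrC addr_eq0 => /eqP e0.
rewrite mulNr -mulrN -e0 mulrA mulKf // mulf_neq0 //.
Qed.

End CriticalPoints.

(** * Sign patterns *)

Section SignPatterns.
Context {R : realType} {k : nat}.
Implicit Types (x y : 'rV[R]_k).

Section Setup.
Context {S I : finType}.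
Variables (f : S -> 'rV[R]_k -> R) (b : S -> 'I_k -> nat) (E De : nat) (s0 : S).
Variables (u : I -> 'rV[R]_k) (eps : R).
Hypotheses (df : forall s, pdeg E (b s) (f s))
  (bDe : forall j, (\sum_s 3 * b s j <= De)%N)
  (bnd : bounded_set [set x | 0 <= f s0 x]) (us0 : forall a, 0 < f s0 (u a))
  (uinj : forall a a', (forall s, Num.sg (f s (u a)) = Num.sg (f s (u a'))) -> a = a')
  (eps0 : 0 < eps) (epsf : forall a s, f s (u a) != 0 -> eps <= `|f s (u a)|).

Let sg a s := Num.sg (f s (u a)).
(** Zero exactly when [f s x] is 0, eps or -eps; on a closed cell [K a] this says that the
    constraint of s is active. *)
Let Q s x := f s x * (f s x ^+ 2 - eps ^+ 2).
Let A x : {set S} := [set s | Q s x == 0]%SET.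

Let K a x := forall s, (sg a s = 0 -> f s x = 0) /\ (sg a s != 0 -> eps <= sg a s * f s x).

Let Q0 s x : (Q s x == 0) = [|| f s x == 0, f s x == eps | f s x == - eps].
Proof. by rewrite /Q mulf_eq0 subr_eq0 eqf_sqr. Qed.

Let Ku a : K a (u a).
Proof.
move=> s; rewrite /sg; split=> [/eqP|]; first by rewrite sgr_eq0 => /eqP.
by rewrite sgr_eq0 => /epsf; rewrite normrEsg mulrC.
Qed.

Let extreme a : exists x, K a x /\ forall y, K a y -> (#|A y| <= #|A x|)%N.
Proof.
pose P n := `[< exists x, K a x /\ #|A x| = n >].
have exP : exists n, P n by exists #|A (u a)|; apply/asboolP; exists (u a); split=> //; exact: Ku.
have ubP n : P n -> (n <= #|S|)%N by move=> /asboolP[x [_ <-]]; exact: max_card.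
case: (ex_maxnP exP ubP) => n /asboolP[x [Kx xn]] nmax; exists x; split=> // y Ky.
by rewrite xn; apply: nmax; apply/asboolP; exists y.
Qed.

Let X a := projT1 (cid (extreme a)).
Let KX a : K a (X a). Proof. by have [] := projT2 (cid (extreme a)). Qed.
Let Xmax a y : K a y -> (#|A y| <= #|A (X a)|)%N.
Proof. by have [_] := projT2 (cid (extreme a)); exact. Qed.

Let sg_KX a s : Num.sg (f s (X a)) = sg a s.
Proof.
have [h0 h1] := KX a s; have [e|ne] := eqVneq (sg a s) 0.
  by rewrite h0 // e sgr0.
have := h1 ne; have : sg a s = 1 \/ sg a s = -1.
  by apply: sgr_cases; rewrite -sgr_eq0.
case=> -> h; first by rewrite gtr0_sg //; move: h eps0; lra.
by rewrite ltr0_sg //; move: h eps0; lra.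
Qed.

Let pQ s : pdeg (3 * E) (fun j => 3 * b s j)%N (Q s).
Proof.
have h2 : pdeg (E * 2) (fun j => b s j * 2)%N (fun x => f s x ^+ 2 - eps ^+ 2).
  by apply: pdegB; [exact: pdegX|exact: pdeg_cst].
by apply: pdeg_le (pdegM (df s) h2) => [|j]; lia.
Qed.

Section Fibre.
Variable B : {set S}.

Let h x := \sum_(s in B) Q s x ^+ 2.

Let ph : pdeg (6 * E) (fun j => \sum_s 6 * b s j)%N h.
Proof.
apply: pdeg_sum => s sB; apply: pdeg_le (pdegX 2 (pQ s)) => [|j]; first by lia.
by rewrite (bigD1 s) //=; lia.
Qed.

(** On [B] the value of [f s] at [X a] is one of 0, eps, -eps, and the tube has radius eps/3, less
    than half their spacing, so tubes around different values are disjoint. The square keeps it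
    polynomial. Off [B] the inequality of the cell is kept. *)
Let c a s x := if s \in B then (eps / 3) ^+ 2 - (f s x - f s (X a)) ^+ 2
               else sg a s * f s x - eps.

Let pc a s : pdeg (E + E + E) (fun j => b s j * 2)%N (c a s).
Proof.
rewrite /c; case: (s \in B); apply: pdegB; try exact: pdeg_cst.
  have h1 : pdeg E (b s) (fun x => f s x - f s (X a)).
    by apply: pdegB => //; exact: pdeg_cst.
  by apply: pdeg_le (pdegX 2 h1) => [|j] //; lia.
by apply: pdegZ; apply: pdeg_le (df s) => [|j]; lia.
Qed.

Let in_tube (p q : R) : 0 <= (eps / 3) ^+ 2 - (p - q) ^+ 2 -> `|p - q| <= eps / 3.
Proof.
rewrite subr_ge0 -[(p - q) ^+ 2]real_normK ?num_real // ler_sqr ?nnegrE //.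
by rewrite divr_ge0 // ltW.
Qed.

Let snap (p q : R) : [|| p == 0, p == eps | p == - eps] ->
  [|| q == 0, q == eps | q == - eps] -> `|p - q| < eps -> p = q.
Proof.
rewrite ltr_norml => /or3P[] /eqP -> /or3P[] /eqP -> /andP[] //; lra.
Qed.

(** The exponent 6E+2 is even, which makes the power sum nonnegative, and leaves 6E+1 after
    differentiation, more than the degree 6E of h. *)
Let fibre_min : \forall dl \near 0^'+, forall a, A (X a) = B -> exists y,
  (forall s, 0 < c a s y) /\ forall y', (forall s, 0 <= c a s y') ->
    h y + dl * power_sum (6 * E).+2 y <= h y' + dl * power_sum (6 * E).+2 y'.
Proof.
apply: filter_forall => a; have [AB|nAB] := pselect (A (X a) = B); last first.
  by near=> dl => AB; case: nAB.
have sgB s : s \notin B -> sg a s != 0.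
  apply: contraNneq => s00; rewrite -AB inE Q0.
  by have [->] := KX a s; rewrite ?eqxx.
suff : \forall dl \near 0^'+, exists y,
  (forall s, 0 < c a s y) /\ forall y', (forall s, 0 <= c a s y') ->
    h y + dl * power_sum (6 * E).+2 y <= h y' + dl * power_sum (6 * E).+2 y'.
  by apply: filterS => dl hdl _.
apply: (@interior_minimum _ k S (c a) h (power_sum (6 * E).+2) (X a)).
- by move=> s; exact: spanned_continuous (pc a s).
- exact: spanned_continuous ph.
- have pp : pdeg (6 * E).+2 (fun=> (6 * E).+2) (power_sum (R := R) (k := k) (6 * E).+2).
    apply: pdeg_sum => i _; apply: pdeg_le (pdegX _ (pdeg_coord i)) => [|j]; first by rewrite mul1n.
    by case: (j == i); rewrite ?mul1n.
  exact: spanned_continuous pp.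
(* In the region [f s0] is at least eps, or within eps/3 of a value that is at least eps; either way
   it is nonnegative. *)
- apply: sub_boundedr bnd => P hP y /= hy; apply: hP; have := hy s0; rewrite /c /=.
  have sg1 : sg a s0 = 1 by rewrite /sg gtr0_sg.
  case: ifP => _; last by rewrite sg1 mul1r; move: eps0; lra.
  move=> /in_tube; rewrite ler_norml; have [_] := KX a s0.
  rewrite sg1 oner_eq0 mul1r => /(_ isT); move: eps0; lra.
- by move=> y; apply: sumr_ge0 => i _; rewrite exprn_even_ge0 //= oddM.
- move=> s; rewrite /c; case: ifP => sB.
    by rewrite subrr expr0n /= subr0 exprn_even_ge0.
  by rewrite subr_ge0; have [_] := KX a s; apply; apply: sgB; rewrite sB.
- rewrite /h big1 // => s; rewrite -AB inE => /eqP ->; by rewrite expr0n.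
(* If h vanished at a boundary point, the values on [B] would equal those at [X a], so the point
   would lie in [K a] with all of [B] active. The constraint s that is tight there is outside [B],
   against the maximality of [A (X a)]. *)
- move=> y cy [s cs]; rewrite lt_def; have h0 : 0 <= h y.
    by apply: sumr_ge0 => i _; exact: sqr_ge0.
  rewrite h0 andbT; apply/negP; rewrite psumr_eq0 => [/allP hy|i _]; last exact: sqr_ge0.
  have fy s' : s' \in B -> f s' y = f s' (X a).
    move=> sB; have := cy s'; rewrite /c sB => /in_tube tube; apply: snap.
    - have := hy s' (mem_index_enum _); rewrite sB /= sqrf_eq0 Q0 //.
    - by rewrite -Q0; move: sB; rewrite -AB inE.
    - by apply: le_lt_trans tube _; move: eps0; lra.
  have Ky : K a y.
    move=> s'; have [sB|sB] := boolP (s' \in B); first by rewrite fy //; exact: KX.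
    split=> [e|_]; first by move/eqP: (sgB _ sB).
    by have := cy s'; rewrite /c (negPf sB) subr_ge0.
  have BA : B \subset A y.
    apply/fintype.subsetP => s' sB; rewrite inE Q0 fy // -Q0.
    by move: sB; rewrite -AB inE.
  have sNB : s \notin B.
    apply/negP => sB; move: cs; rewrite /c sB fy // subrr expr0n /= subr0 => /eqP.
    by rewrite expf_eq0 /= gt_eqF // divr_gt0.
  have sA : s \in A y.
    rewrite inE Q0; move: cs; rewrite /c (negPf sNB).
    have sg1 : sg a s = 1 \/ sg a s = -1.
      by apply: sgr_cases; rewrite -sgr_eq0; exact: sgB.
    case: sg1 => -> /eqP; rewrite subr_eq0; first by rewrite mul1r => ->; rewrite orbT.
    by rewrite mulN1r eqr_oppLR => ->; rewrite !orbT.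
  have := Xmax Ky; rewrite AB leqNgt => /negP; apply.
  by apply: proper_card; apply/fintype.properP; split=> //; exists s.
Unshelve. all: by end_near. Qed.

(** One dl works for all cells of the fibre, so their minima solve a single system to which
    [bezout_bound] applies with exponent 6E+1. *)
Lemma fibre_bound : (#|[set a | A (X a) == B]%SET| <= (6 * E).+1 ^ k)%N.
Proof.
have [dl [hdl dl0]] := filter_ex (filterI fibre_min (nbhs_right_gt 0)).
pose J := {a | A (X a) == B}.
have ex (a : J) : exists y, (forall s, 0 < c (val a) s y) /\
  forall y', (forall s, 0 <= c (val a) s y') ->
    h y + dl * power_sum (6 * E).+2 y <= h y' + dl * power_sum (6 * E).+2 y'.
  by apply: hdl; exact/eqP/(valP a).
have [Y hY] := choice ex.
have -> : #|[set a | A (X a) == B]%SET| = #|{: J}|.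
  by rewrite card_sig; apply: eq_card => a; rewrite !inE.
have [r [dr hr]] := interior_gradient (6 * E).+1 ph.
have gradJ (a : J) i : Y a 0 i ^+ (6 * E).+1 = - (dl * (6 * E).+2%:R)^-1 * r i (Y a).
  have [cY minY] := hY a.
  apply: (hr _ _ _ _ _ _ cY minY); last exact: lt0r_neq0.
  by move=> s; exact: spanned_linepoly (pc (val a) s).
apply: (@bezout_bound R k J Y (6 * E).+1 (fun i x => - (dl * (6 * E).+2%:R)^-1 * r i x)
  (fun j => \sum_s 6 * b s j)%N) => //; last by move=> i; apply: pdegZ; exact: dr.
(* A shared minimum determines every sign: on [B] because the two tubes meet, off [B] because the
   sign is that of [f s] at this point. *)
move=> a1 a2 Y12; apply: val_inj; apply: uinj => s; rewrite -!/(sg _ _).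
have [c1 _] := hY a1; have [c2 _] := hY a2; rewrite -Y12 in c2.
have {}c1 := c1 s; have {}c2 := c2 s; move: c1 c2; rewrite /c.
have AB (a : J) : A (X (val a)) = B by exact/eqP/(valP a).
case: ifP => sB.
  move=> /ltW/in_tube t1 /ltW/in_tube t2; rewrite -!sg_KX; congr Num.sg.
  have inA (a : J) : Q s (X (val a)) == 0.
    by have : s \in A (X (val a)) by [rewrite AB]; rewrite inE.
  apply: snap; rewrite -?Q0 //; move: t1 t2 eps0; rewrite !ler_norml ltr_norml; lra.
have sgB (a : J) : sg (val a) s = 1 \/ sg (val a) s = -1.
  apply: sgr_cases; rewrite -sgr_eq0; move/negbT: sB; apply: contraNneq => s00.
  by have : s \in A (X (val a)); [rewrite inE Q0; have [->] := KX (val a) s; rewrite ?eqxx|rewrite AB].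
by move: eps0; case: (sgB a1) => ->; case: (sgB a2) => -> //; lra.
Qed.

End Fibre.

Lemma separated_pattern_bound : (#|I| <= (De.+1 * (6 * E).+1) ^ k)%N.
Proof.
pose phi a := A (X a).
pose J := {B : {set S} | B \in codom phi}.
have ex (B : J) : exists a, phi a = val B.
  by have /codomP[a e] := valP B; exists a.
have [rep hrep] := choice ex.
have cJ : (#|{: J}| <= De.+1 ^ k)%N.
  apply: (@zero_pattern_bound R k S J Q (fun=> 3 * E)%N (fun s j => 3 * b s j)%N De
    (fun B => X (rep B)) pQ bDe) => B1 B2 e.
  by apply: val_inj; rewrite -!hrep.
have -> : #|I| = (\sum_(B : J) #|[set a | phi a == val B]%SET|)%N.
  have mem a : phi a \in codom phi by exact: codom_f.
  rewrite -sum1_card (partition_big (fun a => Sub (phi a) (mem a) : J) predT) //=.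
  apply: eq_bigr => B _; rewrite -sum1_card; apply: eq_bigl => a.
  by rewrite inE -val_eqE.
rewrite expnMn; apply: leq_trans (_ : \sum_(B : J) (6 * E).+1 ^ k <= _)%N.
  by apply: leq_sum => B _; exact: fibre_bound.
by rewrite sum_nat_const leq_mul2r cJ orbT.
Qed.

End Setup.

(** Finitely many points admit a common gap eps, and [f s0], positive at all of them, confines them
    to a bounded set, which gives compactness. *)
Theorem sign_pattern_bound (S I : finType) (f : S -> 'rV[R]_k -> R)
    (b : S -> 'I_k -> nat) (E De : nat) (s0 : S) (u : I -> 'rV[R]_k) :
  (forall s, pdeg E (b s) (f s)) -> (forall j, \sum_s 3 * b s j <= De)%N ->
  bounded_set [set x | 0 <= f s0 x] -> (forall a, 0 < f s0 (u a)) ->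
  (forall a a', (forall s, Num.sg (f s (u a)) = Num.sg (f s (u a'))) -> a = a') ->
  (#|I| <= (De.+1 * (6 * E).+1) ^ k)%N.
Proof.
move=> df bDe bnd us0 uinj.
have small : \forall e \near 0^'+, forall a s, f s (u a) != 0 -> e <= `|f s (u a)|.
  apply: filter_forall => a; apply: filter_forall => s.
  have [->|ne] := eqVneq (f s (u a)) 0; first by near=> e => /eqP[].
  near=> e => _; near: e; apply: nbhs_right_ltW.
  by rewrite normr_gt0.
have [e [he e0]] := filter_ex (filterI small (nbhs_right_gt 0)).
exact: (separated_pattern_bound df bDe bnd us0 uinj e0 he).
Unshelve. all: by end_near. Qed.

End SignPatterns.

(** * Upper bound *)

Section Normalization.
Context {R : realType} {D n : nat}.

Definition nvars := #|{: 'I_n * 'I_D}|.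

Definition affine_family (x : 'rV[R]_nvars) (i : 'I_n) : 'rV[R]_D.+1 :=
  \row_k (if unlift ord0 k is Some j then x 0 (enum_rank (i, j)) else 1).

(** Take [c] nonzero on all generators, divide each [g i] by [dotv c (g i)], and use [c] as
    coordinate 0; this coordinate is then 1. *)
Lemma normalization (g : 'I_n -> 'rV[R]_D.+1) : generator_family g -> spanning g ->
  exists x, spanning (affine_family x) /\
    same_comb_type (zonotope g) (zonotope (affine_family x)).
Proof.
move=> [g0 _] sp.
(* The extra index makes coordinate 0 of [c] nonzero, so that [c] can replace the first vector of
   the dual basis. *)
have [|c hc] := @generic_covector R D.+1 (option 'I_n)
  (fun o => if o is Some i then g i else delta_mx 0 ord0).
  case=> [i|]; first exact: g0.
  by apply/eqP => /rowP/(_ ord0); rewrite !mxE !eqxx /=; apply/eqP; exact: oner_neq0.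
have c00 : c 0 ord0 != 0 by have := hc None; rewrite dotv_delta.
have cg i : dotv c (g i) != 0 := hc (Some i).
pose x : 'rV[R]_nvars := \row_v
  (g (enum_val v).1 0 (lift ord0 (enum_val v).2) / dotv c (g (enum_val v).1)).
pose L (b : 'rV[R]_D.+1) : 'rV[R]_D.+1 :=
  b 0 ord0 *: c + \row_k (if k == ord0 then 0 else b 0 k).
have dotL b i : dotv b (affine_family x i) = dotv (L b) (g i) / dotv c (g i).
  rewrite /L dotvDl dotvZl mulrDl mulfK // /dotv big_ord_recl !mxE unlift_none mulr1.
  congr (_ + _); rewrite big_ord_recl !mxE eqxx mul0r add0r mulr_suml.
  apply: eq_bigr => j _; rewrite !mxE liftK mxE enum_rankK /=.
  by rewrite -mulrA.
have sgL b i : Num.sg (dotv b (affine_family x i)) =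
    Num.sg (dotv c (g i)) * Num.sg (dotv (L b) (g i)).
  by rewrite dotL sgrM sgrV mulrC.
have L0 b : L b = 0 -> b = 0.
  move=> Lb; have b0 : b 0 ord0 = 0.
    move/rowP/(_ ord0): Lb; rewrite !mxE eqxx addr0 => /eqP.
    by rewrite mulf_eq0 (negPf c00) orbF => /eqP.
  apply/rowP => k; rewrite mxE; have [->//|k0] := eqVneq k ord0.
  by move/rowP/(_ k): Lb; rewrite !mxE b0 mul0r add0r (negPf k0).
exists x; split=> [b hb|].
  apply: L0; apply: sp => i; apply/eqP; rewrite -sgr_eq0.
  have := sgL b i; rewrite hb sgr0 => /esym/eqP.
  by rewrite mulf_eq0 !sgr_eq0 (negPf (cg i)).
apply: (same_comb_type_signs (s := fun i => Num.sg (dotv c (g i)))) => [i|b|b].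
- by rewrite sgr_eq0.
- pose q := b 0 ord0 / c 0 ord0.
  exists (\row_k (if k == ord0 then q else b 0 k - q * c 0 k)) => i.
  rewrite sgL; congr (_ * Num.sg (dotv _ _)).
  apply/rowP => k; rewrite !mxE eqxx; case: eqP => [->|_].
    by rewrite addr0 /q divfK.
  by rewrite addrC subrK.
- by exists (L b) => i; rewrite sgL.
Qed.

Lemma pdeg_affine_family i (l : 'I_D.+1) :
  pdeg 1 (fun v : 'I_nvars => (enum_val v).1 == i) (fun x => affine_family x i 0 l).
Proof.
have [j ->|->] := unliftP ord0 l; last first.
  by apply: pdeg_ext (pdeg_cst _ _ 1) => x; rewrite mxE unlift_none.
apply: pdeg_ext (_ : pdeg _ _ (fun x => x 0 (enum_rank (i, j)))).
  by move=> x; rewrite mxE liftK.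
apply: pdeg_le (pdeg_coord _) => // v; case: eqP => [->|//].
by rewrite enum_rankK eqxx.
Qed.

Lemma pdeg_gdet (s : 'I_D.+1 -> 'I_n) :
  pdeg D.+1 (fun v : 'I_nvars => \sum_k ((enum_val v).1 == s k))%N
    (fun x => gdet (affine_family x) s).
Proof.
apply: pdeg_sum => sg _; apply: pdegZ.
have h (k : 'I_D.+1) : pdeg 1 (fun v : 'I_nvars => (enum_val v).1 == s k)
    (fun x => (\matrix_(k < D.+1) affine_family x (s k)) k (sg k)).
  by apply: pdeg_ext (pdeg_affine_family (s k) (sg k)) => x; rewrite [RHS]mxE.
have := @pdeg_prod R nvars 'I_D.+1 (index_enum _) xpredT (fun=> 1%N) _ _ (fun k _ => h k).
by rewrite sum_nat_const card_ord muln1.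
Qed.

(** Summed over the D+1 positions k, this bounds by (D+1) n^D the degree, in a coordinate of point
    i, of the product of all minors. *)
Lemma card_ffun_fix (k : 'I_D.+1) (i : 'I_n) :
  (\sum_(s : {ffun 'I_D.+1 -> 'I_n}) (i == s k) <= n ^ D)%N.
Proof.
rewrite -[X in (_ <= X ^ _)%N]card_ord -[X in (_ <= _ ^ X)%N]card_ord -card_ffun.
rewrite -big_mkcond sum1dep_card.
pose r (s : {ffun 'I_D.+1 -> 'I_n}) : {ffun 'I_D -> 'I_n} := [ffun j => s (lift k j)].
rewrite -(@card_in_imset _ _ r); first exact: max_card.
move=> s1 s2; rewrite !inE => /eqP e1 /eqP e2 e; apply/ffunP => j.
have [j' ->|->] := unliftP k j; last by rewrite -e1.
by move/ffunP/(_ j'): e; rewrite !ffunE.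
Qed.

Lemma ball_bounded m (rho : R) :
  bounded_set [set x : 'rV[R]_m | 0 <= rho - \sum_i x 0 i ^+ 2].
Proof.
exists (1 + `|rho|); split; first exact: num_real.
move=> M hM x /=; rewrite subr_ge0 => hx.
rewrite [leLHS]/Num.norm /= mx_normrE; apply/bigmax_leP; split.
  by apply: le_trans (ltW hM); rewrite addr_ge0.
move=> [a i] _ /=; rewrite ord1; apply: le_trans (ltW hM).
have xi : x 0 i ^+ 2 <= rho.
  by apply: le_trans hx; rewrite (bigD1 i) //= lerDl sumr_ge0 // => j _; exact: sqr_ge0.
have r0 : 0 <= rho := le_trans (sqr_ge0 _) xi.
rewrite -ler_sqr ?nnegrE ?addr_ge0 // real_normK ?num_real // (ger0_norm r0).
by apply: le_trans xi _; nra.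
Qed.

(** The sign patterns are those of all minors and of one ball. In 7 = 3 * 2 + 1, the ball
    contributes its degree 2 in each variable, tripled as for every [f s], and 1 is the successor in
    [sign_pattern_bound]. The degree 2 stays within D+1 as D is positive. *)
Theorem comb_type_upper K (Ps : 'I_K -> set 'rV[R]_D.+1) : (0 < D)%N ->
  (forall i, @zonotopes_nd R n D.+1 (Ps i)) ->
  (forall i j, same_comb_type (Ps i) (Ps j) -> i = j) ->
  (K <= ((3 * (D.+1 * n ^ D) + 7) * (6 * D.+1).+1) ^ (n * D))%N.
Proof.
move=> D0 hP inj.
have ex i : exists x, spanning (affine_family x) /\
    same_comb_type (Ps i) (zonotope (affine_family x)).
  have [g [gg [/full_dim_spanning sp ->]]] := hP i.
  exact: normalization.
have [u hu] := choice ex.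
(* Larger than the squared norm of each of the chosen points. *)
pose rho := \sum_a (1 + \sum_v u a 0 v ^+ 2).
pose f (o : option {ffun 'I_D.+1 -> 'I_n}) (x : 'rV[R]_nvars) :=
  if o is Some s then gdet (affine_family x) s else rho - \sum_v x 0 v ^+ 2.
pose b (o : option {ffun 'I_D.+1 -> 'I_n}) (v : 'I_nvars) :=
  if o is Some s then (\sum_k ((enum_val v).1 == s k))%N else 2%N.
have -> : (n * D = nvars)%N by rewrite /nvars card_prod !card_ord.
have -> : (3 * (D.+1 * n ^ D) + 7 = (3 * (D.+1 * n ^ D) + 6).+1)%N by rewrite !addnS.
rewrite -[X in (X <= _)%N]card_ord.
apply: (@sign_pattern_bound R nvars _ 'I_K f b D.+1 (3 * (D.+1 * n ^ D) + 6) None u).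
- case=> [s|]; first exact: pdeg_gdet.
  apply: pdegB; first exact: pdeg_cst.
  apply: pdeg_sum => v _; apply: pdeg_le (pdegX 2 (pdeg_coord v)) => // j.
  by case: (j == v).
- move=> v; rewrite (bigD1 None) //= addnC leq_add2r.
  rewrite (reindex_omap Some id) /=; last by case.
  rewrite (eq_bigl xpredT); last by move=> s; rewrite eqxx.
  rewrite -big_distrr leq_mul2l /= exchange_big /=.
  rewrite -[X in (_ <= X * _)%N]card_ord -sum_nat_const; apply: leq_sum => k _.
  exact: card_ffun_fix.
- exact: ball_bounded.
- move=> a; rewrite /f subr_gt0 /rho (bigD1 a) //=.
  rewrite -addrA addrCA ltrDl ltr_pwDl // sumr_ge0 // => a' _.
  by rewrite addr_ge0 // sumr_ge0 // => v _; exact: sqr_ge0.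
- move=> a a' e; apply: inj.
  have [[sa ta] [sa' ta']] := (hu a, hu a').
  apply: same_comb_type_trans ta (same_comb_type_trans _ (same_comb_type_sym ta')).
  apply: covset_comb_type; apply: chirotope_covset => // s.
  have := e (Some (finfun s)); rewrite /f /gdet.
  have E (x : 'rV[R]_nvars) : \matrix_(k < D.+1) affine_family x (finfun s k) =
      \matrix_(k < D.+1) affine_family x (s k).
    by apply/matrixP => i j; rewrite !mxE ffunE.
  by rewrite !E.
Qed.

End Normalization.

(** * Uniform configurations *)

Section UniformConfigurations.
Context {R : realType} {D : nat}.

Lemma linepoly_cross (V : lmodType R) (A : V -> 'M[R]_(D, D.+1)) :
  (forall i j, linepoly (fun x => A x i j)) ->
  forall k, linepoly (fun x => cross (A x) 0 k).
Proof.
move=> h k p q.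
have [|P e] := @linepolyM _ V (fun=> (-1) ^+ (0 + k)) (fun x =>
  \det (row' (0 : 'I_(1 + D)) (col' k (col_mx 0 (A x) : 'M[R]_(1 + D))))) (linepoly_cst _) _ p q.
  apply: linepoly_det => i j p' q'.
  have [a|a ia] := splitP (lift (0 : 'I_(1 + D)) i).
    by rewrite ord1.
  have [P e] := h a (lift k j) p' q'; exists P => t; rewrite -e !mxE.
  have -> : fintype.split (lift (0 : 'I_(1 + D)) i) = inr a.
    case: splitP => b eb; first by move: eb; rewrite ia ord1.
    by congr inr; apply: val_inj; apply/eqP; rewrite -(eqn_add2l 1) -ia -eb.
  by [].
by exists P => t; rewrite -e mxE.
Qed.

Lemma cross_neq0_free (A : 'M[R]_(D, D.+1)) : cross A != 0 -> row_free A.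
Proof.
apply: contraNT => nf; apply/eqP/rowP => k.
rewrite -dotv_delta dotvC dotv_cross mxE; apply/eqP.
apply: contraNT nf; rewrite -unitfE -unitmxE -row_free_unit => fr.
apply: inj_row_free => u uA.
have := row_free_inj fr (_ : row_mx (0 : 'rV_1) u *m _ = row_mx 0 0 *m _).
rewrite !(@mul_row_col _ 1 1 D D.+1) uA !mul0mx => /(_ erefl) /eq_row_mx[_].
by [].
Qed.

Lemma cross_scale (A : 'M[R]_(D, D.+1)) y : row_free A -> y != 0 ->
  (forall i, dotv (row i A) y = 0) -> exists2 mu, mu != 0 & cross A = mu *: y.
Proof.
move=> Af y0 /(cross_uniq Af)[mu yE].
have mu0 : mu != 0 by apply: contraNneq y0 => m0; rewrite yE m0 scale0r.
exists mu^-1; first by rewrite invr_eq0.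
by rewrite yE scalerA mulVf // scale1r.
Qed.

Definition rows n (V : 'M[R]_(n, D.+1)) i := row i V.

Definition uniform n (V : 'M[R]_(n, D.+1)) :=
  forall s : 'I_D.+1 -> 'I_n, injective s -> gdet (rows V) s != 0.

Lemma gdet_perm n (g : 'I_n -> 'rV[R]_D.+1) (s : 'I_D.+1 -> 'I_n) (p : {perm 'I_D.+1}) :
  gdet g (s \o p) = (-1) ^+ p * gdet g s.
Proof.
rewrite /gdet -det_perm -det_mulmx -row_permE; congr (\det _).
by apply/matrixP => i j; rewrite !mxE.
Qed.

Lemma gdet_noninj n (g : 'I_n -> 'rV[R]_D.+1) (s : 'I_D.+1 -> 'I_n) :
  ~ injective s -> gdet g s = 0.
Proof.
move=> ni; have [i [j [ij sij]]] : exists i j, i != j /\ s i = s j.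
  apply: contrapT => h; apply: ni => i j sij; apply/eqP/negP => /negP ij.
  by apply: h; exists i, j.
by apply: (determinant_alternate ij) => k; rewrite !mxE sij.
Qed.

Lemma gdet_spanning n (g : 'I_n -> 'rV[R]_D.+1) (s : 'I_D.+1 -> 'I_n) :
  gdet g s != 0 -> spanning g.
Proof.
rewrite -unitfE -unitmxE => un c hc.
have : c *m (\matrix_(k < D.+1) g (s k))^T = 0.
  by apply/dotv_rows0 => i; rewrite rowK dotvC.
move=> /(congr1 (mulmx^~ (invmx (\matrix_(k < D.+1) g (s k))^T))).
by rewrite mulmxK ?unitmx_tr // mul0mx.
Qed.

Lemma uniform_spanning n (V : 'M[R]_(n, D.+1)) : (D < n)%N -> uniform V ->
  spanning (rows V).
Proof.
move=> Dn uV; apply: gdet_spanning (uV (widen_ord Dn) _).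
by move=> i j /(congr1 val) /= /val_inj.
Qed.

Lemma ord_avoid n (s : 'I_D -> 'I_n) : (D < n)%N -> exists i, forall k, s k != i.
Proof.
move=> Dn; have : (#|codom s| < #|'I_n|)%N.
  by rewrite card_ord; apply: leq_ltn_trans (leq_image_card _ _) _; rewrite card_ord.
move=> lt; have /card_gt0P[i] : (0 < #|[predC codom s]|)%N.
  by rewrite -(ltn_add2l #|codom s|) addn0 cardC.
rewrite !inE => ni; exists i => k; apply: contraNneq ni => <-; exact: codom_f.
Qed.

Lemma uniform_gcross n (V : 'M[R]_(n, D.+1)) (s : 'I_D -> 'I_n) : (D < n)%N ->
  uniform V -> injective s -> gcross (rows V) s != 0.
Proof.
move=> Dn uV si; have [i hi] := ord_avoid s Dn.
have : gdet (rows V) (scons i s) != 0.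
  apply: uV => a b; rewrite /scons.
  case: (unliftP ord0 a) => [a' ->|->]; case: (unliftP ord0 b) => [b' ->|->] //=.
  - by move=> /si ->.
  - by move=> e; have := hi a'; rewrite e eqxx.
  - by move=> e; have := hi b'; rewrite e eqxx.
by rewrite -dotv_gcross; apply: contraNneq => ->; rewrite dotvC dotv0l.
Qed.

(** Any two distinct indices belong to an injective selection, so a zero row or two collinear rows
    would annul a minor. *)
Lemma uniform_generator n (V : 'M[R]_(n, D.+1)) : (0 < D)%N -> (D < n)%N ->
  uniform V -> generator_family (rows V) /\ full_dim (rows V).
Proof.
move=> D0 Dn uV; split; last first.
  by apply/full_dim_spanning; exact: uniform_spanning.
have key i j : i != j -> exists (s : 'I_D.+1 -> 'I_n) a b,
    [/\ injective s, a != b, s a = i & s b = j].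
  move=> ij; pose a : 'I_D.+1 := ord0; pose b : 'I_D.+1 := ord_max.
  have ab : a != b by rewrite -val_eqE /= eq_sym -lt0n.
  pose w : 'I_D.+1 -> 'I_n := widen_ord Dn.
  have wi : injective w by move=> x y /(congr1 val) /= /val_inj.
  pose p1 := tperm (w a) i.
  pose p2 := tperm (p1 (w b)) j.
  exists (fun k => p2 (p1 (w k))), a, b; split=> //.
  - by move=> x y /perm_inj /perm_inj /wi.
  - rewrite {1}/p1 tpermL /p2 tpermD //; last by rewrite eq_sym.
    apply/eqP => e; have : p1 (w b) = p1 (w a) by rewrite e /p1 tpermL.
    by move=> /perm_inj /wi ba; rewrite ba eqxx in ab.
  - by rewrite /p2 tpermL.
split=> [i|i j ij [c gij]].
  have [j ij] : exists j, i != j.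
    have [j hj] := @ord_avoid n (fun=> i) Dn; exists j; exact: (hj (Ordinal D0)).
  have [s [a [b [si _ sa _]]]] := key i j ij.
  apply: contraNneq (uV s si) => gi0; apply/eqP.
  have := expand_det_row (\matrix_(k < D.+1) rows V (s k)) a; rewrite /gdet => ->.
  by apply: big1 => l _; rewrite mxE sa gi0 mxE mul0r.
have [s [a [b [si ab sa sb]]]] := key i j ij.
have /negP := uV s si; apply; rewrite -[_ == 0]negbK -unitfE -unitmxE.
apply/negP => un.
have : (delta_mx 0 a - c *: delta_mx 0 b : 'rV[R]_D.+1) *m
    \matrix_(k < D.+1) rows V (s k) = 0 *m \matrix_(k < D.+1) rows V (s k).
  by rewrite mulmxBl -scalemxAl -!rowE !rowK sa sb mul0mx gij subrr.
move=> /(can_inj (mulmxK un)) /rowP/(_ a); rewrite !mxE !eqxx (negPf ab) mulr0 subr0.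
by move/eqP; rewrite oner_eq0.
Qed.

End UniformConfigurations.

(** * Generic vertices *)

Section GenericRealization.
Context {R : realType} {D' n r : nat}.
Local Notation D := D'.+1.
Variable lab : 'I_D * 'I_D * 'I_r -> 'I_n.
Hypothesis lab_inj : injective lab.
Implicit Types (V : 'M[R]_(n, D.+1)) (tau : {ffun 'I_D * 'I_D -> 'I_r}).

(** Group (j, k) supplies the k-th point spanning the j-th hyperplane, and [tau] says which of its r
    points. *)
Definition selection tau (j k : 'I_D) : 'I_n := lab (j, k, tau (j, k)).

Definition normals V tau : 'M[R]_(D, D.+1) :=
  \matrix_(j < D) gcross (rows V) (selection tau j).

(** Homogeneous coordinates of the intersection of the D hyperplanes; the point is finite when
    coordinate 0 is nonzero. *)
Definition vertex V tau : 'rV[R]_D.+1 := cross (normals V tau).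

Definition height (x : 'rV[R]_D.+1) : R := \sum_k x 0 k.

(** The difference of the heights after division by coordinate 0, with denominators cleared so that
    it is polynomial in [V]. *)
Definition height_gap V tau tau' : R :=
  height (vertex V tau) * vertex V tau' 0 ord0 -
  height (vertex V tau') * vertex V tau 0 ord0.

Let ei (i : 'I_D.+1) : 'rV[R]_D.+1 := delta_mx 0 i.

Let dot_ei i j : dotv (ei i) (ei j) = (i == j)%:R.
Proof. by rewrite dotv_delta mxE eqxx eq_sym. Qed.

(* The D vectors e_m with m different from 1+j, listed so that e_0 has index k0. *)
Let bas (k0 j k : 'I_D) : 'I_D.+1 := lift (lift ord0 j) (tperm ord0 k0 k).

Let bas_neq k0 j k : bas k0 j k != lift ord0 j.
Proof. by rewrite eq_sym; exact: neq_lift. Qed.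

Let bas_inj k0 j : injective (bas k0 j).
Proof. by move=> k k' /lift_inj /perm_inj. Qed.

Let bas_k0 k0 j : bas k0 j k0 = ord0.
Proof. by apply: val_inj; rewrite /= tpermR. Qed.

Let bas_eq0 k0 j k : (bas k0 j k == ord0) = (k == k0).
Proof. by rewrite -(bas_k0 k0 j) (inj_eq (@bas_inj k0 j)). Qed.

(* If the selected points of group j span the hyperplane x_(1+j) = beta_j x_0,
   the vertex is e_0 + sum_j beta_j e_(1+j). *)
Lemma vertex_example V tau k0 (beta : 'I_D -> R) :
  (forall j k, row (selection tau j k) V =
     ei (bas k0 j k) + ((k == k0)%:R * beta j) *: ei (lift ord0 j)) ->
  exists2 mu, mu != 0 &
    vertex V tau = mu *: (ei ord0 + \sum_j beta j *: ei (lift ord0 j)).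
Proof.
move=> hV.
have VE j k l : V (selection tau j k) l =
    (ei (bas k0 j k) + ((k == k0)%:R * beta j) *: ei (lift ord0 j)) 0 l.
  by rewrite -hV mxE.
(* The normal vector of the hyperplane on which coordinate 1+j is [beta j] times coordinate 0. *)
pose y j := ei (lift ord0 j) - beta j *: ei ord0.
have y0 j : y j != 0.
  apply/eqP => /rowP/(_ (lift ord0 j)); rewrite !mxE !eqxx /= mulr0 subr0.
  by move/eqP; rewrite oner_eq0.
have hN j : exists2 mu, mu != 0 & row j (normals V tau) = mu *: y j.
  rewrite rowK /gcross; apply: cross_scale => [|//|k]; last first.
    rewrite rowK /rows hV dotvDl dotvZl !dotvBr !dotvZr !dot_ei bas_eq0.
    rewrite (negPf (bas_neq _ _ _)) eqxx; case: eqP => _ /=; ring.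
  apply: inj_row_free => u uA; apply/rowP => k.
  have := congr1 (fun M : 'rV[R]_D.+1 => M 0 (bas k0 j k)) uA.
  rewrite !mxE (bigD1 k) //= big1 => [|k' kk'].
    rewrite !mxE VE !mxE !eqxx /=.
    by rewrite (negPf (bas_neq _ _ _)) mulr0 !addr0 mulr1.
  rewrite !mxE VE !mxE !eqxx /=.
  rewrite (negPf (bas_neq _ _ _)) (inj_eq (@bas_inj k0 j)) eq_sym (negPf kk').
  by rewrite mulr0 addr0 mulr0.
have hN' j : exists m, m != 0 /\ row j (normals V tau) = m *: y j.
  by have [m m0 e] := hN j; exists m.
have [mu hmu] := choice hN'.
pose x := ei ord0 + \sum_j beta j *: ei (lift ord0 j).
have xE k : x 0 k = if unlift ord0 k is Some j then beta j else 1.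
  rewrite /x !mxE eqxx /= summxE; have [j ->|->] := unliftP ord0 k.
    rewrite eq_sym (negPf (neq_lift _ _)) add0r (bigD1 j) //= !mxE !eqxx mulr1 big1 ?addr0 // => j' jj'.
    by rewrite !mxE (inj_eq lift_inj) eq_sym (negPf jj') andbF mulr0.
  by rewrite eqxx big1 ?addr0 // => j _; rewrite !mxE (negPf (neq_lift _ _)) mulr0.
apply: cross_scale => [||j].
- apply: inj_row_free => u uA; apply/rowP => j.
  have := congr1 (fun M : 'rV[R]_D.+1 => M 0 (lift ord0 j)) uA.
  have nE j' : normals V tau j' (lift ord0 j) = mu j' * (j == j')%:R.
    have [_ e] := hmu j'; rewrite -[LHS]/((normals V tau) j' _).
    have -> : normals V tau j' (lift ord0 j) = row j' (normals V tau) 0 (lift ord0 j).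
      by rewrite [RHS]mxE.
    by rewrite e !mxE !eqxx (inj_eq lift_inj) /= mulr0 subr0.
  rewrite !mxE (bigD1 j) //= big1 => [|j' jj'].
    rewrite nE eqxx mulr1 addr0 => /eqP; rewrite mulf_eq0.
    by have [m0 _] := hmu j; rewrite (negPf m0) orbF => /eqP.
  by rewrite nE eq_sym (negPf jj') !mulr0.
- apply/eqP => /rowP/(_ ord0); rewrite -/x xE unlift_none mxE.
  by move/eqP; rewrite oner_eq0.
- have [_ ->] := hmu j; rewrite dotvZl /y dotvBl dotvZl !(dotvC (ei _)) !dotv_delta.
  by rewrite -/x !xE liftK unlift_none mulr1 subrr mulr0.
Qed.

Let example k0 (q0 : option ('I_D * 'I_D * 'I_r)) : 'M[R]_(n, D.+1) :=
  \matrix_(i, l) \sum_q (lab q == i)%:R *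
    (ei (bas k0 q.1.1 q.1.2) + (q0 == Some q)%:R *: ei (lift ord0 q.1.1)) 0 l.

Let row_example k0 q0 q : row (lab q) (example k0 q0) =
  ei (bas k0 q.1.1 q.1.2) + (q0 == Some q)%:R *: ei (lift ord0 q.1.1).
Proof.
apply/rowP => l; rewrite mxE [LHS]mxE (bigD1 q) //= eqxx mul1r big1 ?addr0 // => q' qq'.
by rewrite (inj_eq lab_inj) (negPf qq') mul0r.
Qed.

Lemma vertex_example_ex tau : exists V, vertex V tau 0 ord0 != 0.
Proof.
exists (example ord0 None); have [j k|mu mu0 ->] := @vertex_example (example ord0 None) tau ord0 (fun=> 0).
  by rewrite /selection row_example /= mulr0 !scale0r.
rewrite !mxE summxE big1 ?addr0 ?eqxx ?mulr1 // => j _.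
by rewrite !mxE mul0r.
Qed.

(** Where the selections differ, the point chosen by [tau] is shifted by one unit and no other point
    is: this raises the height of the normalised vertex of [tau] from 1 to 2 and leaves that of
    [tau'] at 1. *)
Lemma height_gap_ex tau tau' : tau != tau' -> exists V, height_gap V tau tau' != 0.
Proof.
move=> ne; have [[j0 k0] hjk] : exists jk, tau jk != tau' jk.
  apply: contrapT => /forallNP h; move/eqP: ne; apply; apply/ffunP => jk.
  by apply/eqP; rewrite -[_ == _]negbK; apply/negP/h.
pose q0 := (j0, k0, tau (j0, k0)).
have [j k|mu mu0 v1] := @vertex_example (example k0 (Some q0)) tau k0 (fun j => (j0 == j)%:R).
  rewrite /selection row_example /=; congr (_ + _ *: _).
  rewrite -natrM mulnb; congr (_%:R); congr nat_of_bool.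
  apply/eqP/andP => [[ej ek _]|[/eqP ek /eqP ej]]; first by rewrite ej ek !eqxx.
  by rewrite /q0 ek ej.
have [j k|mu' mu'0 v2] := @vertex_example (example k0 (Some q0)) tau' k0 (fun=> 0).
  rewrite /selection row_example /= mulr0; congr (_ + _ *: _).
  have -> // : (Some q0 == Some (j, k, tau' (j, k))) = false.
  apply/eqP => -[ej ek e]; move/eqP: hjk; apply.
  by rewrite e ej ek.
exists (example k0 (Some q0)); rewrite /height_gap v1 v2.
have hE m (be : 'I_D -> R) : height (m *: (ei ord0 + \sum_j be j *: ei (lift ord0 j))) =
    m * (1 + \sum_j be j).
  rewrite /height; under eq_bigr do rewrite mxE; rewrite -mulr_sumr; congr (_ * _).
  under eq_bigr do rewrite mxE; rewrite big_split /=; congr (_ + _).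
    by rewrite (bigD1 ord0) //= mxE !eqxx big1 ?addr0 // => k k0'; rewrite mxE (negPf k0') andbF.
  under eq_bigr do rewrite summxE; rewrite exchange_big /=; apply: eq_bigr => j _.
  rewrite (bigD1 (lift ord0 j)) //= !mxE !eqxx mulr1 big1 ?addr0 // => k kj.
  by rewrite !mxE (negPf kj) andbF mulr0.
have zE m (be : 'I_D -> R) : (m *: (ei ord0 + \sum_j be j *: ei (lift ord0 j))) 0 ord0 = m.
  rewrite !mxE summxE big1 ?addr0 ?eqxx ?mulr1 // => j _.
  by rewrite !mxE (negPf (neq_lift _ _)) andbF mulr0.
have s1 : \sum_j ((j0 == j)%:R : R) = 1.
  rewrite (bigD1 j0) //= eqxx big1 ?addr0 // => j jj.
  by rewrite eq_sym (negPf jj).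
rewrite !hE !zE s1 big1_eq addr0.
have -> : mu * (1 + 1) * mu' - mu' * 1 * mu = mu * mu' by ring.
by rewrite mulf_neq0.
Qed.

Lemma linepoly_entry i j : linepoly (fun V => V i j).
Proof. by apply: linepoly_lin => *; rewrite !mxE. Qed.

Lemma linepoly_gdet s : linepoly (fun V => gdet (rows V) s).
Proof.
apply: linepoly_det => i j p q; have [P e] := linepoly_entry (s i) j p q.
by exists P => t; rewrite -e !mxE.
Qed.

Lemma linepoly_vertex tau k : linepoly (fun V => vertex V tau 0 k).
Proof.
apply: linepoly_cross => j l p q.
have h : linepoly (fun V => gcross (rows V) (selection tau j) 0 l).
  apply: linepoly_cross => a b p' q'; have [P e] := linepoly_entry (selection tau j a) b p' q'.
  by exists P => t; rewrite -e !mxE.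
by have [P e] := h p q; exists P => t; rewrite -e mxE.
Qed.

Lemma linepoly_height_gap tau tau' : linepoly (fun V => height_gap V tau tau').
Proof.
have hh t : linepoly (fun V => height (vertex V t)).
  by apply: linepoly_sum => k; exact: linepoly_vertex.
apply: linepolyD; first by apply: linepolyM => //; exact: linepoly_vertex.
by apply: linepolyN; apply: linepolyM => //; exact: linepoly_vertex.
Qed.

Lemma gdet_ex s : injective s -> exists V, gdet (rows V) s != 0.
Proof.
move=> si; exists (\matrix_(i, l) (s l == i)%:R).
have -> : gdet (rows (\matrix_(i, l) (s l == i)%:R : 'M[R]_(n, D.+1))) s = \det (1%:M : 'M[R]_D.+1).
  by congr (\det _); apply/matrixP => i j; rewrite !mxE (inj_eq si) eq_sym.
by rewrite det1 oner_neq0.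
Qed.

Lemma generic_realization V0 : exists V, uniform V /\
  [/\ uniform V0 -> forall s, Num.sg (gdet (rows V) s) = Num.sg (gdet (rows V0) s),
     forall tau, vertex V tau 0 ord0 != 0 &
     forall tau tau', tau != tau' -> height_gap V tau tau' != 0].
Proof.
pose T := {ffun 'I_D * 'I_D -> 'I_r}.
(* All conditions in one family for [perturb]. Non-injective selections, whose minors vanish
   identically, get the constant 1; diagonal pairs stand for the finiteness of a vertex. *)
pose F (o : {ffun 'I_D.+1 -> 'I_n} + T * T) V : R :=
  match o with
  | inl s => if injectiveb s then gdet (rows V) s else 1
  | inr p => if p.1 == p.2 then vertex V p.1 0 ord0 else height_gap V p.1 p.2
  end.
have [||V hV] := @perturb R _ _ F V0.
- rewrite /F; case=> [s|[t t']] /=; [case: (injectiveb s)|case: (t == t')].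
  + exact: linepoly_gdet.
  + exact: linepoly_cst.
  + exact: linepoly_vertex.
  + exact: linepoly_height_gap.
- rewrite /F; case=> [s|[t t']] /=; [case si: (injectiveb s)|case tt': (t == t')].
  + exact/gdet_ex/injectiveP.
  + by exists 0; exact: oner_neq0.
  + exact: vertex_example_ex.
  + by apply: height_gap_ex; rewrite tt'.
have gE s V1 : gdet (rows V1) (finfun s) = gdet (rows V1) s.
  by congr (\det _); apply/matrixP => i j; rewrite !mxE ffunE.
have inj_fin (s : 'I_D.+1 -> 'I_n) : injective s -> injectiveb (finfun s).
  by move=> si; apply/injectiveP => i j; rewrite !ffunE => /si.
exists V; split=> [s si|].
  by have [] := hV (inl (finfun s)); rewrite /F inj_fin // gE.
split=> [uV0 s|tau|tau tau' ne].
- have [si|ni] := pselect (injective s); last by rewrite !gdet_noninj.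
  have [_] := hV (inl (finfun s)); rewrite /F inj_fin // !gE; apply; exact: uV0.
- by have [] := hV (inr (tau, tau)); rewrite /F /= eqxx.
- by have [] := hV (inr (tau, tau')); rewrite /F /= (negPf ne).
Qed.

End GenericRealization.

(** * Cells *)

Section Cells.
Context {R : realType} {D' n r : nat}.
Local Notation D := D'.+1.
Variable lab : 'I_D * 'I_D * 'I_r -> 'I_n.
Variable V : 'M[R]_(n, D.+1).
Implicit Types (tau : {ffun 'I_D * 'I_D -> 'I_r}) (s : {ffun 'I_D -> 'I_n}).
Local Notation vertex := (vertex lab V).
Local Notation normals := (normals lab V).

Hypothesis vertex0 : forall tau, vertex tau 0 ord0 != 0.
Hypothesis gap0 : forall tau tau', tau != tau' -> height_gap lab V tau tau' != 0.

Let nvertex tau := (vertex tau 0 ord0)^-1 *: vertex tau.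

Let nvertex0 tau : nvertex tau 0 ord0 = 1.
Proof. by rewrite mxE mulVf. Qed.

Lemma height_dotv (x : 'rV[R]_D.+1) : height x = dotv (const_mx 1) x.
Proof. by apply: eq_bigr => k _; rewrite mxE mul1r. Qed.

(* The functional [height - height (nvertex tau)] is a combination of the
   hyperplanes through the vertex; taking the sides of these hyperplanes to be
   the signs of the coefficients makes the vertex the lowest point of its cell. *)
Let supporting tau : exists a : 'I_D -> R, forall x : 'rV[R]_D.+1, x 0 ord0 = 1 ->
  height x - height (nvertex tau) = \sum_j a j * dotv x (row j (normals tau)).
Proof.
pose M : 'M[R]_(1 + D) := col_mx (delta_mx 0 ord0 : 'rV[R]_D.+1) (normals tau).
have Mu : M \in unitmx.
  by rewrite unitmxE unitfE -dotv_cross dotvC dotv_delta vertex0.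
pose rho := height (nvertex tau).
pose lv : 'rV[R]_D.+1 := const_mx 1 - rho *: delta_mx 0 ord0.
have lvE (x : 'rV[R]_D.+1) : x 0 ord0 = 1 -> dotv lv x = height x - rho.
  by move=> x0; rewrite dotvBl dotvZl -height_dotv [dotv (delta_mx _ _) _]dotvC dotv_delta x0 mulr1.
pose c : 'rV[R]_(1 + D) := lv *m invmx M.
have cE : lv = c 0 (lshift D 0) *: delta_mx 0 ord0 +
    \sum_j c 0 (rshift 1 j) *: row j (normals tau).
  have -> : lv = c *m M by rewrite mulmxKV.
  rewrite mulmx_sum_row big_split_ord big_ord1; congr (_ + _).
    by rewrite rowKu row_id.
  by apply: eq_bigr => j _; rewrite rowKd.
have dotc (x : 'rV[R]_D.+1) : dotv lv x = c 0 (lshift D 0) * x 0 ord0 +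
    \sum_j c 0 (rshift 1 j) * dotv x (row j (normals tau)).
  rewrite {1}cE dotvDl dotvZl [dotv (delta_mx _ _) _]dotvC dotv_delta; congr (_ + _).
  by rewrite dotvC dotv_sumr; apply: eq_bigr => j _; rewrite dotvZr.
(* Evaluation at the vertex itself, where both the functional and all the hyperplanes vanish. *)
have c0 : c 0 (lshift D 0) = 0.
  have := dotc (nvertex tau); rewrite lvE ?nvertex0 // /rho subrr mulr1 big1 ?addr0 => [//|j _].
  by rewrite dotvZl dotvC cross_orth mulr0 mulr0.
exists (fun j => c 0 (rshift 1 j)) => x x0.
by rewrite -[X in _ - X]/rho -lvE // dotc c0 mul0r add0r.
Qed.

(** [w tau] composes the vertex, a direction [y tau] into the cell of which it is the lowest point,
    and a generic functional. If two of these points shared a cell, each vertex would be at most as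
    high as the other, against [gap0]. *)
Lemma cell_points : exists w : {ffun 'I_D * 'I_D -> 'I_r} -> 'rV[R]_D.+1,
  (forall tau s, gcross (rows V) s != 0 -> dotv (w tau) (gcross (rows V) s) != 0) /\
  forall tau tau', tau != tau' -> exists s, gcross (rows V) s != 0 /\
    Num.sg (dotv (w tau) (gcross (rows V) s)) !=
    Num.sg (dotv (w tau') (gcross (rows V) s)).
Proof.
have [a ha] := choice supporting.
have ex_y tau : exists y, forall j, dotv y (row j (normals tau)) = if a tau j < 0 then -1 else 1.
  pose M : 'M[R]_(1 + D) := col_mx (delta_mx 0 ord0 : 'rV[R]_D.+1) (normals tau).
  have Mu : M \in unitmx.
    by rewrite unitmxE unitfE -dotv_cross dotvC dotv_delta vertex0.
  pose t : 'rV[R]_(1 + D) := row_mx 0 (\row_j if a tau j < 0 then -1 else 1).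
  exists (t *m (invmx M)^T) => j.
  have -> : row j (normals tau) = row (rshift 1 j) M by rewrite rowKd.
  rewrite dotv_mulmx -mulmxA -trmx_mul -row_mul mulmxV //.
  rewrite -dotv_mulmx row1 dotv_delta row_mxEr mxE.
  by [].
have [y hy] := choice ex_y.
pose v (s : {ffun 'I_D -> 'I_n}) := gcross (rows V) s.
have [c0 hc0] : exists c0 : 'rV[R]_D.+1, forall s, v s != 0 -> dotv c0 (v s) != 0.
  pose v' s := if v s == 0 then delta_mx 0 ord0 else v s.
  have [|c hc] := @generic_covector R D.+1 _ v'.
    move=> s; rewrite /v'; case: ifPn => // _.
    by apply/eqP => /rowP/(_ ord0); rewrite !mxE !eqxx; apply/eqP; exact: oner_neq0.
  by exists c => s vs; have := hc s; rewrite /v' (negPf vs).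
have ex_w tau : exists w, forall s, v s != 0 ->
   [/\ dotv w (v s) != 0,
    dotv (nvertex tau) (v s) != 0 -> Num.sg (dotv w (v s)) = Num.sg (dotv (nvertex tau) (v s)) &
    dotv (nvertex tau) (v s) = 0 -> dotv (y tau) (v s) != 0 ->
      Num.sg (dotv w (v s)) = Num.sg (dotv (y tau) (v s))].
  have [u1 h1] := covector_comp v (nvertex tau) (y tau).
  have [w hw] := covector_comp v u1 c0.
  have keep s : dotv u1 (v s) != 0 -> Num.sg (dotv w (v s)) = Num.sg (dotv u1 (v s)).
    by move=> u10; rewrite hw (negPf u10).
  exists w => s vs; split.
  - have [e|ne] := eqVneq (dotv u1 (v s)) 0.
      by rewrite -sgr_eq0 hw e eqxx sgr_eq0 hc0.
    by rewrite -sgr_eq0 keep // sgr_eq0.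
  - move=> x0; have e1 := h1 s; rewrite (negPf x0) in e1.
    by rewrite keep // -sgr_eq0 e1 sgr_eq0.
  - move=> x0 y0; have e1 := h1 s; rewrite x0 eqxx in e1.
    by rewrite keep // -sgr_eq0 e1 sgr_eq0.
have [w hw] := choice ex_w.
have vfin (q : 'I_D -> 'I_n) : v (finfun q) = gcross (rows V) q.
  by rewrite /v /gcross; congr cross; apply/matrixP => i j; rewrite !mxE ffunE.
exists w; split=> [tau s vs|tau tau' ne]; first by have [] := hw tau s vs.
apply: contrapT => /forallNP same.
have {}same s : v s != 0 -> Num.sg (dotv (w tau) (v s)) = Num.sg (dotv (w tau') (v s)).
  move=> vs; apply/eqP; rewrite -[_ == _]negbK; apply/negP => ds.
  by apply: (same s); split.
(* The vertex of t' is in the closure of the common cell, so on each hyperplane through the vertex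
   of t it lies on the side given by the sign of the coefficient, and every term of the sum in [ha]
   is nonnegative. *)
have le t t' : (forall s, v s != 0 -> Num.sg (dotv (w t) (v s)) = Num.sg (dotv (w t') (v s))) ->
    height (nvertex t) <= height (nvertex t').
  move=> {}same; rewrite -subr_ge0 ha // sumr_ge0 // => j _.
  have [nE] : exists s, row j (normals t) = v s.
    by exists (finfun (selection lab t j)); rewrite vfin rowK.
  move=> sE; have [v0|vn0] := eqVneq (v nE) 0.
    by rewrite sE v0 dotvC dotv0l mulr0.
  have [_ _ st] := hw t nE vn0.
  have xj : dotv (nvertex t) (v nE) = 0.
    by rewrite -sE dotvZl dotvC cross_orth mulr0.
  have yj := hy t j; rewrite sE in yj.
  have yn0 : dotv (y t) (v nE) != 0.
    by rewrite yj; case: ifP => _; rewrite ?oppr_eq0 oner_eq0.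
  have {st} := st xj yn0; rewrite same // => sw.
  have [_ st' _] := hw t' nE vn0.
  rewrite sE; have [->|x'0] := eqVneq (dotv (nvertex t') (v nE)) 0; first by rewrite mulr0.
  have := st' x'0; rewrite sw yj; case: ltP => aj.
    rewrite sgrN sgr1 => /esym/eqP; rewrite sgr_cp0 => x'neg.
    by rewrite nmulr_rge0 // ltW.
  by rewrite sgr1 => /esym/eqP; rewrite sgr_cp0 => x'pos; rewrite mulr_ge0 // ltW.
have : height (nvertex tau) = height (nvertex tau').
  by apply/eqP; rewrite eq_le !le // => s vs; rewrite same.
move/eqP: (gap0 ne) => gap; rewrite !height_dotv /nvertex !dotvZr -!height_dotv => e; apply: gap.
rewrite /height_gap; have e1 := vertex0 tau; have e2 := vertex0 tau'.
apply/eqP; rewrite subr_eq0; apply/eqP.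
move: e e1 e2.
move: (vertex tau 0 ord0) (vertex tau' 0 ord0) (height _) (height _) => p q A B e p0 q0.
by rewrite -[B](mulVKf p0) e; field.
Qed.

End Cells.

(** * Lower bound *)

Section Counting.
Context {R : realType} {D' : nat}.
Local Notation D := D'.+1.

Lemma rows_new n (w : 'rV[R]_D.+1) (V : 'M[R]_(n, D.+1)) :
  rows (col_mx w V : 'M[R]_(n.+1, D.+1)) ord0 = w.
Proof.
have -> : ord0 = lshift n (0 : 'I_1) :> 'I_n.+1 by apply: val_inj.
by apply/rowP => j; rewrite [LHS]mxE; exact: col_mxEu.
Qed.

Lemma rows_old n (w : 'rV[R]_D.+1) (V : 'M[R]_(n, D.+1)) i :
  rows (col_mx w V : 'M[R]_(n.+1, D.+1)) (lift ord0 i) = rows V i.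
Proof.
have -> : lift ord0 i = rshift 1 i :> 'I_n.+1 by apply: val_inj.
by apply/rowP => j; rewrite [LHS]mxE [RHS]mxE; exact: col_mxEd.
Qed.

(** A minor with the new point is, up to a permutation of its rows, the value of [w] on the normal
    of a spanned hyperplane. *)
Lemma extend_uniform n (w : 'rV[R]_D.+1) (V : 'M[R]_(n, D.+1)) :
  (D < n)%N -> uniform V ->
  (forall s : {ffun 'I_D -> 'I_n}, gcross (rows V) s != 0 -> dotv w (gcross (rows V) s) != 0) ->
  uniform (col_mx w V : 'M[R]_(n.+1, D.+1)).
Proof.
move=> Dn uV hw s si.
have old m (t : 'I_m -> 'I_n.+1) : (forall k, t k != ord0) ->
    exists t' : 'I_m -> 'I_n, forall k, t k = lift ord0 (t' k).
  move=> t0; have ex k : exists i, t k = lift ord0 i.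
    by have [j ->|e] := unliftP ord0 (t k); [exists j|have := t0 k; rewrite e eqxx].
  by have [t' ht'] := choice ex; exists t'.
have [[k0 sk0]|nk] := pselect (exists k, s k = ord0); last first.
  have [|t st] := old _ s; first by move=> k; apply/eqP => e; apply: nk; exists k.
  have ti : injective t by move=> i j tij; apply: si; rewrite !st tij.
  have <- : gdet (rows V) t = gdet (rows (col_mx w V : 'M[R]_(n.+1, D.+1))) s.
    by congr (\det _); apply/matrixP => i j; rewrite [LHS]mxE [RHS]mxE st rows_old.
  exact: uV.
pose p := tperm ord0 k0; pose s1 := s \o p.
have s1i : injective s1 by move=> i j /si /perm_inj.
have s10 : s1 ord0 = ord0 by rewrite /s1 /= /p tpermL.
have [|t st] := old _ (fun k : 'I_D => s1 (lift ord0 k)).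
  by move=> k; apply/eqP => e; have := s1i _ _ (etrans e (esym s10)) => /eqP; rewrite eq_sym (negPf (neq_lift _ _)).
have ti : injective t.
  by move=> i j tij; have := st i; rewrite tij -st => /s1i /lift_inj.
have : gdet (rows (col_mx w V : 'M[R]_(n.+1, D.+1))) s1 != 0.
  have -> : s1 = scons ord0 (fun k => lift ord0 (t k)).
    apply/funext => k; rewrite /scons; have [j ->|->] := unliftP ord0 k; last exact: s10.
    exact: st.
  rewrite -dotv_gcross rows_new.
  have -> : gcross (rows (col_mx w V : 'M[R]_(n.+1, D.+1))) (fun k => lift ord0 (t k)) =
      gcross (rows V) (finfun t).
    congr cross; apply/matrixP => i j; rewrite [LHS]mxE [RHS]mxE rows_old.
    by rewrite ffunE.
  apply: hw; apply: uniform_gcross => // i j; rewrite !ffunE; exact: ti.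
by rewrite /s1 gdet_perm; apply: contraNneq => ->; rewrite mulr0.
Qed.

Lemma covset_restrict n (w w' : 'rV[R]_D.+1) (V V' : 'M[R]_(n, D.+1)) :
  covset (rows (col_mx w V : 'M[R]_(n.+1, D.+1))) =
  covset (rows (col_mx w' V' : 'M[R]_(n.+1, D.+1))) ->
  covset (rows V) = covset (rows V').
Proof.
move=> e; apply/setP => x; apply/covsetP/covsetP => -[c ->].
  have [c' hc] := covset_sub c e; exists c'; apply/ffunP => i; rewrite !ffunE.
  by apply/sgb_sg; have := hc (lift ord0 i); rewrite !rows_old.
have [c' hc] := covset_sub c (esym e); exists c'; apply/ffunP => i; rewrite !ffunE.
by apply/sgb_sg; have := hc (lift ord0 i); rewrite !rows_old.
Qed.

(** The normal of the hyperplane spanned by the points of [s] is determined up to a positive factor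
    by its signs on [V]; the covector that extends these signs therefore records the side of the new
    point. *)
Lemma covset_cell n (w w' : 'rV[R]_D.+1) (V : 'M[R]_(n, D.+1)) (s : 'I_D -> 'I_n) :
  spanning (rows V) -> gcross (rows V) s != 0 ->
  covset (rows (col_mx w V : 'M[R]_(n.+1, D.+1))) =
  covset (rows (col_mx w' V : 'M[R]_(n.+1, D.+1))) ->
  Num.sg (dotv w (gcross (rows V) s)) = Num.sg (dotv w' (gcross (rows V) s)).
Proof.
move=> sp; set c := gcross (rows V) s => c0 e.
have [c' hc] := covset_sub c e.
have hV i : Num.sg (dotv c' (rows V i)) = Num.sg (dotv c (rows V i)).
  by have := hc (lift ord0 i); rewrite !rows_old.
have [|la laE] := @cross_uniq _ _ _ c' (cross_neq0_free c0).
  move=> i; rewrite rowK dotvC; apply/eqP; rewrite -sgr_eq0 hV sgr_eq0 dotvC.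
  by rewrite -[rows V (s i)](rowK (fun k => rows V (s k)) i) cross_orth.
have [i ci] : exists i, dotv c (rows V i) != 0.
  apply: contrapT => /forallNP h; move/eqP: c0; apply; apply: sp => i.
  by apply/eqP; rewrite -[_ == _]negbK; apply/negP/h.
have la1 : Num.sg la = 1.
  have := hV i; rewrite laE dotvZl sgrM -/(gcross _ _) -/c => h.
  by apply: (mulIf (_ : Num.sg (dotv c (rows V i)) != 0)); rewrite ?sgr_eq0 // mul1r.
have := hc ord0; rewrite !rows_new laE dotvZl sgrM la1 mul1r -/(gcross _ _) -/c.
by rewrite ![dotv c _]dotvC => ->.
Qed.

Definition unif_covsets n : {set {set {ffun 'I_n -> bool * bool}}} :=
  [set L | `[< exists V : 'M[R]_(n, D.+1), uniform V /\ covset (rows V) = L >]]%SET.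

Lemma unif_covsetsP n L : reflect
  (exists V : 'M[R]_(n, D.+1), uniform V /\ covset (rows V) = L) (L \in unif_covsets n).
Proof. by rewrite inE; exact: asboolP. Qed.

Lemma unif_covsets_gt0 n : (0 < #|unif_covsets n|)%N.
Proof.
have noq (q : 'I_D * 'I_D * 'I_0) : False by case: q => _ [].
have [|V [uV _]] := @generic_realization R D' n 0 (fun q => match noq q with end) _ 0.
  by move=> q; case: (noq q).
by apply/card_gt0P; exists (covset (rows V)); apply/unif_covsetsP; exists V.
Qed.

(** Each covector set receives one generic realization. From an extended covector set, deleting the
    new point recovers the original set, and the cell of the new point recovers [tau]. *)
Lemma unif_covsets_step n r : (D < n)%N -> (D * D * r <= n)%N ->
  (#|unif_covsets n| * r ^ (D * D) <= #|unif_covsets n.+1|)%N.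
Proof.
move=> Dn rn.
have cardn : (#|{: 'I_D * 'I_D * 'I_r}| <= n)%N by rewrite !card_prod !card_ord.
pose lab (q : 'I_D * 'I_D * 'I_r) : 'I_n := widen_ord cardn (enum_rank q).
have lab_inj : injective lab.
  by move=> p q /(congr1 val) /= /val_inj /enum_rank_inj.
pose T := {ffun 'I_D * 'I_D -> 'I_r}.
have ex L : exists VW : 'M[R]_(n, D.+1) * (T -> 'rV[R]_D.+1), L \in unif_covsets n ->
    [/\ covset (rows VW.1) = L, uniform VW.1,
     forall tau, uniform (col_mx (VW.2 tau) VW.1 : 'M[R]_(n.+1, D.+1)) &
     forall tau tau', covset (rows (col_mx (VW.2 tau) VW.1 : 'M[R]_(n.+1, D.+1))) =
       covset (rows (col_mx (VW.2 tau') VW.1 : 'M[R]_(n.+1, D.+1))) -> tau = tau'].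
  have [/unif_covsetsP[V0 [uV0 cV0]]|nL] := boolP (L \in unif_covsets n); last first.
    by exists (0, fun=> 0).
  have [V [uV [sV v0 gap]]] := generic_realization lab_inj V0.
  have [w [w0 wd]] := cell_points v0 gap.
  exists (V, w) => _; split=> //=.
  - rewrite -cV0; apply: chirotope_covset; [exact: uniform_spanning|exact: uniform_spanning|].
    exact: sV.
  - by move=> tau; apply: extend_uniform => // s; exact: w0.
  - move=> tau tau' e; apply/eqP/negP => /negP ne.
    have [s [s0 /eqP ds]] := wd _ _ ne; apply: ds.
    by apply: covset_cell e => //; exact: uniform_spanning.
have [VW hVW] := choice ex.
pose Psi (p : {set {ffun 'I_n -> bool * bool}} * T) :=
  covset (rows (col_mx ((VW p.1).2 p.2) (VW p.1).1 : 'M[R]_(n.+1, D.+1))).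
have -> : (#|unif_covsets n| * r ^ (D * D))%N = #|finset.setX (unif_covsets n) [set: T]%SET|.
  by rewrite cardsX cardsT card_ffun card_prod !card_ord.
rewrite -(@card_in_imset _ _ Psi).
  apply: subset_leq_card; apply/fintype.subsetP => _ /imsetP[[L tau] /finset.setXP[/= hL _] ->].
  have [_ _ h _] := hVW _ hL.
  by apply/unif_covsetsP; eexists; split; [exact: h|].
move=> [L1 t1] [L2 t2] /finset.setXP[/= h1 _] /finset.setXP[/= h2 _] e.
have [c1 _ _ inj1] := hVW _ h1; have [c2 _ _ _] := hVW _ h2.
have L12 : L1 = L2 by rewrite -c1 -c2; exact: covset_restrict e.
by subst L2; congr (_, _); exact: inj1.
Qed.

Lemma unif_covsets_lower : exists K0 K, (0 < K0)%N /\ (0 < K)%N /\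
  forall n, (n`! ^ (D * D) <= K0 * #|unif_covsets n| * K ^ n)%N.
Proof.
(* From this size on there are more than D points and every group has at least one. *)
pose n0 := (D + D * D)%N.
exists (n0`! ^ (D * D))%N, ((2 * (D * D)) ^ (D * D))%N.
split; first by rewrite expn_gt0 fact_gt0.
split; first by rewrite expn_gt0.
move=> n; set K := ((2 * (D * D)) ^ _)%N; set K0 := (n0`! ^ _)%N.
have K1 : (0 < K)%N by rewrite expn_gt0.
elim: n => [|n IH].
  rewrite fact0 exp1n muln1 muln_gt0 unif_covsets_gt0 andbT expn_gt0 fact_gt0 //.
have [nn0|n0n] := leqP n.+1 n0.
  apply: (@leq_trans K0).
    by rewrite leq_exp2r //; apply: leq_fact.
  by rewrite -mulnA leq_pmulr // muln_gt0 unif_covsets_gt0 expn_gt0 K1.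
pose r := (n %/ (D * D))%N.
have DD0 : (0 < D * D)%N by [].
have nE := divn_eq n (D * D); have nm := ltn_pmod n DD0.
have r0 : (0 < r)%N by rewrite divn_gt0 //; move: n0n; rewrite /n0; lia.
have rn : (D * D * r <= n)%N by rewrite mulnC leq_trunc_div.
have Dn' : (D < n)%N by move: n0n; rewrite /n0; lia.
have step := unif_covsets_step Dn' rn.
(* Rounding in the group size costs at most a factor 2 as r is positive; this is the 2 in [K]. *)
have nr : (n.+1 <= 2 * (D * D) * r)%N.
  rewrite -/r in nE; move: nE nm r0; move: (D * D)%N (n %% _)%N => a b; nia.
rewrite factS expnMn expnS.
apply: (@leq_trans ((2 * (D * D) * r) ^ (D * D) * (K0 * #|unif_covsets n| * K ^ n))%N).
  by apply: leq_mul => //; rewrite leq_exp2r.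
rewrite expnMn -/K.
have -> : (K * r ^ (D * D) * (K0 * #|unif_covsets n| * K ^ n) =
  K0 * (#|unif_covsets n| * r ^ (D * D)) * (K * K ^ n))%N by ring.
by rewrite leq_mul2r leq_mul2l step !orbT.
Qed.

(** Each type that occurs gets one reference covector set; any other set of this type is recovered
    from the type and the reorientation that carries the reference to it. *)
Lemma comb_type_lower n K (Ps : 'I_K -> set 'rV[R]_D.+1) : (D < n)%N ->
  (forall P, @zonotopes_nd R n D.+1 P -> exists i, same_comb_type P (Ps i)) ->
  (#|unif_covsets n| <= K * (n`! * 2 ^ n))%N.
Proof.
move=> Dn hPs.
have ex L : exists Vi : 'M[R]_(n, D.+1) * option 'I_K, L \in unif_covsets n ->
    [/\ covset (rows Vi.1) = L, generator_family (rows Vi.1) &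
     exists2 i, Vi.2 = Some i & same_comb_type (zonotope (rows Vi.1)) (Ps i)].
  have [/unif_covsetsP[V [uV cV]]|nL] := boolP (L \in unif_covsets n); last first.
    by exists (0, None).
  have [gf fd] := uniform_generator (ltn0Sn _) Dn uV.
  have [|i hi] := hPs (zonotope (rows V)); first by exists (rows V).
  by exists (V, Some i) => _; split=> //; exists i.
have [F hF] := choice ex.
have ref i : exists L0, forall L, L \in unif_covsets n -> (F L).2 = i ->
    L0 \in unif_covsets n /\ (F L0).2 = i.
  have [[L0 [h1 h2]]|nL] := pselect (exists L, L \in unif_covsets n /\ (F L).2 = i).
    by exists L0.
  by exists finset.set0 => L h1 h2; case: nL; exists L.
have [rf hrf] := choice ref.
have ex2 L : exists pe : {perm 'I_n} * {ffun 'I_n -> bool}, L \in unif_covsets n ->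
    L = [set reorient pe s | s in rf (F L).2]%SET.
  have [hL|nL] := boolP (L \in unif_covsets n); last by exists (1%g, [ffun=> true]).
  have [hr1 hr2] := hrf _ _ hL erefl.
  have [c1 g1 [i i1 t1]] := hF _ hL; have [c2 g2 [j j1 t2]] := hF _ hr1.
  have ij : j = i by apply: Some_inj; rewrite -j1 -i1.
  subst j.
  have [pe hpe] := same_comb_type_reorient g2 g1
    (same_comb_type_trans t2 (same_comb_type_sym t1)).
  by exists pe => _; rewrite -{1}c1 hpe c2.
have [pe hpe] := choice ex2.
have -> : (K * (n`! * 2 ^ n))%N = #|{: 'I_K * ({perm 'I_n} * {ffun 'I_n -> bool})}|.
  by rewrite !card_prod card_ffun card_bool !card_ord card_Sn.
have [K0|K0] := posnP K.
  rewrite leqNgt; apply/negP => lt.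
  have /card_gt0P[L hL] : (0 < #|unif_covsets n|)%N by exact: leq_ltn_trans lt.
  by have [_ _ [i _ _]] := hF _ hL; move: (ltn_ord i); rewrite {2}K0.
pose i0 : 'I_K := Ordinal K0.
pose G L := (odflt i0 (F L).2, pe L).
rewrite -(@card_in_imset _ _ G); first exact: max_card.
move=> L1 L2 h1 h2 /= [e1 e2]; rewrite (hpe _ h1) (hpe _ h2) e2.
have [_ _ [i i1 _]] := hF _ h1; have [_ _ [j j1 _]] := hF _ h2.
by move: e1; rewrite i1 j1 /= => ->.
Qed.

End Counting.

(** * Asymptotics *)

Section Asymptotics.
Context {R : realType}.

(** [comb_type_upper] bounds every list of pairwise inequivalent zonotopes, and a longest list is
    complete. This excludes the default value 0 in [num_types]. *)
Lemma has_types D n : exists k, has_k_types (@zonotopes_nd R n D.+2) k.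
Proof.
set S := @zonotopes_nd R n D.+2.
pose P k := `[< exists Ps : 'I_k -> set 'rV[R]_D.+2, (forall i, S (Ps i)) /\
  forall i j, same_comb_type (Ps i) (Ps j) -> i = j >].
have exP : exists k, P k by exists 0%N; apply/asboolP; exists (fun=> set0); split=> -[].
have [B hB] : exists B, forall k, P k -> (k <= B)%N.
  by eexists => k /asboolP[Ps [h1 h2]]; exact: (comb_type_upper _ h1 h2).
case: (ex_maxnP exP hB) => k /asboolP[Ps [h1 h2]] kmax.
exists k, Ps; split=> //; split=> // Q SQ; apply: contrapT => /forallNP nQ.
suff /kmax : P k.+1 by rewrite ltnn.
apply/asboolP; exists (fun i => if unlift ord0 i is Some j then Ps j else Q); split=> [i|i j].
  by case: (unliftP ord0 i).
case: (unliftP ord0 i) => [i' ->|->]; case: (unliftP ord0 j) => [j' ->|->] //.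
- by move=> /h2 ->.
- by move=> /same_comb_type_sym t; case: (nQ i').
- by move=> t; case: (nQ j').
Qed.

Lemma z_spec D n : has_k_types (@zonotopes_nd R n D.+2) (z R n D.+2).
Proof.
rewrite /z /num_types; case: pselect => [H|nH]; first exact: projT2 (cid H).
by case: nH; exact: has_types.
Qed.

Lemma z_upper D : exists A, (0 < A)%N /\ forall n, (0 < n)%N ->
  (z R n D.+2 <= (A * n ^ D.+1) ^ (n * D.+1))%N.
Proof.
exists ((3 * D.+2 + 7) * (6 * D.+2).+1)%N; split=> // m m0.
have [Ps [h1 [h2 _]]] := z_spec D m.
apply: leq_trans (comb_type_upper _ h1 h2) _ => //.
rewrite leq_exp2r ?muln_gt0 ?m0 // mulnAC leq_mul2r; apply/orP; right.
have : (0 < m ^ D.+1)%N by rewrite expn_gt0 m0.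
by move: (m ^ _)%N => q q0; rewrite mulnDl -mulnA leq_add2l leq_pmulr.
Qed.

(** The n! relabellings cancel one of the (D+1)^2 factors n!, and the 2^n reorientations are
    absorbed in K^n. *)
Lemma z_lower D : exists K0 K, (0 < K0)%N /\ (0 < K)%N /\ forall n, (D.+1 < n)%N ->
  (0 < z R n D.+2)%N /\
  (n`! ^ (D.+1 * D.+1 - 1) <= K0 * z R n D.+2 * K ^ n)%N.
Proof.
have [K0 [K [K00 [K1 hK]]]] := @unif_covsets_lower R D.
exists K0, (2 * K)%N; do 2 (split; first by rewrite ?muln_gt0).
move=> n Dn; have [Ps [_ [_ h3]]] := z_spec D n.
have le := comb_type_lower Dn h3; have U0 := @unif_covsets_gt0 R D n.
have z0 : (0 < z R n D.+2)%N by move: (leq_trans U0 le); rewrite muln_gt0 => /andP[].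
split=> //; have f0 := fact_gt0 n.
rewrite -(leq_pmul2l f0) -expnS subn1 prednK ?muln_gt0 //.
apply: leq_trans (hK n) _; rewrite expnMn.
apply: (@leq_trans (K0 * (z R n D.+2 * (n`! * 2 ^ n)) * K ^ n)).
  by rewrite leq_mul2r leq_mul2l le !orbT.
by apply: eq_leq; ring.
Qed.

(** Induction on n through (1 + 1/n)^n <= e. *)
Lemma expr_le_fact n : (n%:R : R) ^+ n <= n`!%:R * expR n%:R.
Proof.
elim: n => [|n IH]; first by rewrite expr0 fact0 expR0 mulr1.
have [->|n0] := posnP n.
  by rewrite expr1 factS fact0 mul1r; apply: le_trans (expR_ge1Dx _); lra.
have m0 : (0 : R) < n%:R by rewrite ltr0n.
have step : (n.+1%:R : R) ^+ n <= n%:R ^+ n * expR 1.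
  have -> : (n.+1%:R : R) = n%:R * (1 + n%:R^-1).
    by rewrite mulrDr mulr1 divff ?lt0r_neq0 // -natr1.
  rewrite exprMn ler_wpM2l ?exprn_ge0 ?ler0n //.
  rewrite -[X in expR X](divff (lt0r_neq0 m0)) expRM_natl.
  apply: lerXn2r; rewrite ?nnegrE ?expR_ge0 ?expR_ge1Dx //.
rewrite exprS factS natrM -mulrA ler_wpM2l //.
apply: le_trans step _; rewrite -[n.+1%:R]natr1 expRD mulrA.
by rewrite ler_wpM2r ?expR_ge0.
Qed.

Lemma expR_le_fact n : expR (n%:R * ln (n%:R : R) - n%:R) <= n`!%:R.
Proof.
have [->|n0] := posnP n; first by rewrite mul0r subr0 expR0 fact0.
have m0 : (0 : R) < n%:R by rewrite ltr0n.
by rewrite expRB expRM_natl lnK ?posrE // ler_pdivrMr ?expR_gt0 // expr_le_fact.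
Qed.

Lemma expR_lower D K0 K n (Z : nat) : (0 < K0)%N -> (0 < K)%N -> (0 < n)%N ->
  (n`! ^ D <= K0 * Z * K ^ n)%N ->
  expR (D%:R * (n%:R * ln n%:R - n%:R) - n%:R * (ln K0%:R + ln K%:R)) <= (Z%:R : R).
Proof.
move=> K00 K1 n0 le.
have e : expR (D%:R * (n%:R * ln n%:R - n%:R)) <= (K0%:R * Z%:R * K%:R ^+ n : R).
  apply: le_trans (_ : (n`!%:R : R) ^+ D <= _).
    by rewrite expRM_natl; apply: lerXn2r; rewrite ?nnegrE ?expR_ge0 ?expR_le_fact.
  by rewrite -!natrX -!natrM ler_nat.
rewrite expRB ler_pdivrMr ?expR_gt0 //; apply: le_trans e _.
rewrite mulrDr expRD !expRM_natl !lnK ?posrE ?ltr0n // mulrA [K0%:R * _]mulrC.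
rewrite ler_wpM2r ?exprn_ge0 // ler_wpM2l //.
(* K0 <= K0^n, so that the constant joins the terms linear in n. *)
by rewrite -{1}[K0%:R]expr1 ler_weXn2l // ler1n.
Qed.

Lemma ln_ln_ge1 : exists N, forall n, (N <= n)%N -> 1 <= ln (ln (n%:R : R)).
Proof.
exists (Num.bound (expR (expR 1) : R)) => n Nn.
have h : expR (expR 1) <= (n%:R : R).
  apply: le_trans (_ : (Num.bound (expR (expR 1) : R))%:R <= _); last by rewrite ler_nat.
  by apply/ltW/archi_boundP/expR_ge0.
have n0 : (0 : R) < n%:R by exact: lt_le_trans (expR_gt0 _) h.
have l0 : expR 1 <= ln (n%:R : R) by rewrite -ler_expR lnK ?posrE.
have ln0 : 0 < ln (n%:R : R) by exact: lt_le_trans (expR_gt0 _) l0.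
by rewrite -ler_expR lnK ?posrE.
Qed.

Lemma powR_nat (n : nat) (a : R) : (0 < n)%N -> n%:R `^ a = expR (a * ln n%:R).
Proof. by move=> n0; rewrite /powR pnatr_eq0 gtn_eqF. Qed.

End Asymptotics.

Theorem theorem2p4 (R : realType) (d : nat) (hd : (2 <= d)%N) :
  exists (C : R) (N : nat) (e1 e2 : nat -> R),
    (forall n : nat, (N <= n)%N ->
       `|e1 n| <= C / ln (n%:R : R) /\
       `|e2 n| <= C * (ln (ln (n%:R : R)) / ln (n%:R : R))) /\
    (forall n : nat, (N <= n)%N ->
       (n%:R : R) `^ (((d ^ 2 - 2 * d)%N)%:R * n%:R * (1 + e1 n))
         <= ((z R n d)%:R : R) /\
       ((z R n d)%:R : R)
         <= (n%:R : R) `^ ((((d - 1) ^ 2)%N)%:R * n%:R * (1 + e2 n))).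
Proof.
case: d hd => [|[|D]] // _.
have -> : (D.+2 ^ 2 - 2 * D.+2 = D.+1 * D.+1 - 1)%N by lia.
have -> : (D.+2 - 1 = D.+1)%N by lia.
have [A [A0 up]] := @z_upper R D.
have [K0 [K [K00 [K1 low]]]] := @z_lower R D.
have [N1 hN1] := @ln_ln_ge1 R.
(* In [c1], the 1 is the loss in n! >= (n/e)^n and the logarithms come from the factors [K0] and
   [K]; [c2] comes from the constant base [A]. *)
pose c1 : R := 1 + ln K0%:R + ln K%:R; pose c2 : R := ln A%:R.
have lnK0 : 0 <= ln (K0%:R : R) by rewrite ln_ge0 // ler1n.
have lnK1 : 0 <= ln (K%:R : R) by rewrite ln_ge0 // ler1n.
have c20 : 0 <= c2 by rewrite ln_ge0 // ler1n.
have c10 : 0 <= c1 by rewrite /c1; lra.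
exists (c1 + c2), (N1 + D.+2)%N, (fun n => - (c1 / ln n%:R)),
  (fun n => c2 * (ln (ln n%:R) / ln n%:R)).
have setup n : (N1 + D.+2 <= n)%N ->
    [/\ 1 <= ln (ln (n%:R : R)), 0 < ln (n%:R : R), (D.+1 < n)%N & (0 < n)%N].
  move=> hn; have h1 : 1 <= ln (ln (n%:R : R)) by apply: hN1; lia.
  split=> //; try lia; rewrite ltNge; apply/negP => l0.
  by move: h1; rewrite ln0 // ler10.
split=> n /setup [h1 l0 Dn n0].
  have ll0 : 0 <= ln (ln (n%:R : R)) by lra.
  have i0 : 0 <= (ln (n%:R : R))^-1 by rewrite invr_ge0 ltW.
  have d0 : 0 <= ln (ln (n%:R : R)) / ln n%:R by exact: mulr_ge0.
  rewrite normrN (ger0_norm (mulr_ge0 c10 i0)) (ger0_norm (mulr_ge0 c20 d0)).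
  by rewrite !ler_wpM2r // ?lerDl ?lerDr.
have [z0 lown] := low n Dn.
rewrite !powR_nat //; split.
  (* In dimension 2 the exponent is zero and only the existence of one zonotope is claimed. *)
  have [D0|D0] := posnP D.
    have -> : (D.+1 * D.+1 - 1 = 0)%N by rewrite D0.
    by rewrite !mul0r expR0 ler1n.
  apply: le_trans (expR_lower K00 K1 n0 lown); rewrite ler_expR.
  set DD := (D.+1 * D.+1 - 1)%N; set L := ln (n%:R : R) in l0 *.
  have DD1 : (1 : R) <= DD%:R by rewrite ler1n /DD; lia.
  have -> : DD%:R * n%:R * (1 - c1 / L) * L = DD%:R * n%:R * (L - c1).
    by field; exact: lt0r_neq0.
  have nn : (0 : R) <= n%:R by [].
  (* The exponent of [expR_lower] loses n (ln K0 + ln K) once, while the claimed one loses it DD >=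
     1 times. *)
  rewrite /c1; have : 0 <= (DD%:R - 1) * (n%:R * (ln (K0%:R : R) + ln (K%:R : R))).
    by rewrite mulr_ge0 ?subr_ge0 // mulr_ge0 // addr_ge0.
  lra.
apply: le_trans (_ : ((A * n ^ D.+1) ^ (n * D.+1))%N%:R <= _).
  by rewrite ler_nat; exact: up.
have Ap : (0 : R) < A%:R by rewrite ltr0n.
have np : (0 : R) < n%:R by rewrite ltr0n.
have -> : (((A * n ^ D.+1) ^ (n * D.+1))%N%:R : R) =
    expR ((n * D.+1)%:R * (c2 + D.+1%:R * ln n%:R)).
  rewrite expRM_natl expRD expRM_natl /c2 !lnK ?posrE //.
  by rewrite natrX natrM natrX.
rewrite ler_expR; set L := ln (n%:R : R) in l0 h1 *.
have -> : (D.+1 ^ 2)%:R * n%:R * (1 + c2 * (ln L / L)) * L =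
    D.+1%:R * D.+1%:R * n%:R * (L + c2 * ln L) :> R.
  by rewrite natrX expr2; field; exact: lt0r_neq0.
rewrite natrM.
have D1 : (1 : R) <= D.+1%:R by rewrite ler1n.
(* Here ln ln n >= 1 is used: the bounded contribution of [A] is absorbed by the larger error
   term. *)
have h2 : c2 <= D.+1%:R * (c2 * ln L).
  apply: le_trans (_ : c2 * ln L <= _); first by rewrite ler_peMr.
  by rewrite ler_peMl // mulr_ge0 //; lra.
have : 0 <= n%:R * D.+1%:R * (D.+1%:R * (c2 * ln L) - c2).
  by rewrite mulr_ge0 ?subr_ge0 // mulr_ge0.
lra.
Qed.
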